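(* Let $n\ge 1$, $p>1$, and let $\phi:\mathbb{R}^n\to[0,\infty)$ be bounded, continuous and not identically zero. Consider the Cauchy problem $$u_t=\Delta u+|u|^{p-1}u \ \text{ in } \mathbb{R}^n\times(0,+\infty),\qquad u(x,0)=\phi(x),\ x\in\mathbb{R}^n .$$ For $\alpha,r>0$ put $$D(\alpha;r)=\sup_{x\in\mathbb{R}^n}\frac{\operatorname{mes}\bigl(B(x,r)\cap\{y\mid\phi(y)\ge\alpha\}\bigr)}{\operatorname{mes}\bigl(B(x,r)\bigr)},\qquad \overline{D}(\alpha)=\limsup_{r\to+\infty}D(\alpha;r).$$ Suppose that there exists $\alpha>0$ such that $\overline{D}(\alpha)>0$. Then the solution of the Cauchy problem blows up in finite time $T^{*}$, and (for such $\alpha$) $$T^{*}\le\frac{1}{p-1}\bigl(\alpha\overline{D}(\alpha)\bigr)^{1-p}.$$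
   Context: $\operatorname{mes}$ denotes Lebesgue measure on $\mathbb{R}^n$ and $B(x,r)$ the ball centered at $x$ with radius $r$. The solution $u$ of the Cauchy problem is the (unique, non-negative) maximal solution that is bounded on $\mathbb{R}^n\times[0,T]$ for every $T<T^*$, where $[0,T^* )$ is its maximal existence interval; it satisfies $$u(x,t)=\int_{\mathbb{R}^n}g(x,y,t)\phi(y)\,dy+\int_0^t\int_{\mathbb{R}^n}g(x,y,t-s)|u|^{p-1}u(y,s)\,dy\,ds,\qquad g(x,y,t)=\frac{1}{(4\pi t)^{n/2}}\exp\Bigl(-\frac{|x-y|^2}{4t}\Bigr).$$ It blows up in finite time $T^*$ (the life span) if $T^*<\infty$ and $\lim_{t\to T^{*-}}\|u(\cdot,t)\|_{L^\infty(\mathbb{R}^n)}=\infty$. *)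

(* Defs.v *)
From HB Require Import structures.
From mathcomp Require Import all_boot all_order all_algebra.
From mathcomp Require Import all_classical all_reals all_analysis.

Set Implicit Arguments.
Unset Strict Implicit.
Unset Printing Implicit Defensive.

Import Order.TTheory GRing.Theory Num.Theory.
Import numFieldNormedType.Exports.

Local Open Scope classical_set_scope.
Local Open Scope ring_scope.

Definition measure_rV_display : measure_display -> measure_display.
Proof. exact. Qed.

(* Product sigma-algebra on row vectors, generated by the coordinates, as the
   library does for [n.-tuple T]. On ['rV[R]_n] these are the Borel sets. *)
Section measurable_rV.
Context {d} {T : sigmaRingType d}.
Variable n : nat.

Let coord : 'I_n -> 'rV[T]_n -> T := fun i x => x 0 i.

Let rV_set0 : g_sigma_preimage coord set0.
Proof. exact: sigma_algebra0. Qed.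

Let rV_setC A : g_sigma_preimage coord A -> g_sigma_preimage coord (~` A).
Proof. exact: sigma_algebraC. Qed.

Let rV_bigcup (F : (set 'rV[T]_n)^nat) :
  (forall i, g_sigma_preimage coord (F i)) ->
  g_sigma_preimage coord (\bigcup_i (F i)).
Proof. exact: sigma_algebra_bigcup. Qed.

HB.instance Definition _ := @isMeasurable.Build (measure_rV_display d)
  ('rV[T]_n) (g_sigma_preimage coord) rV_set0 rV_setC rV_bigcup.

End measurable_rV.

Lemma measurable_coord d (T : sigmaRingType d) n (i : 'I_n) :
  measurable_fun [set: 'rV[T]_n] (fun x : 'rV[T]_n => x 0 i).
Proof.
move=> _ Y mY; rewrite setTI; apply: sub_sigma_algebra => /=.
rewrite -bigcup_seq/=; exists i => /=; first by rewrite mem_index_enum.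
by exists Y => //; rewrite setTI.
Qed.

Lemma measurable_fun_rVP d1 d2 (T1 : measurableType d1)
    (T2 : measurableType d2) n (f : T1 -> 'rV[T2]_n) :
  (forall i, measurable_fun [set: T1] (fun x => f x 0 i)) ->
  measurable_fun [set: T1] f.
Proof.
move=> mf _ A mA; rewrite setTI.
suff : g_sigma_preimage (fun i (x : 'rV[T2]_n) => x 0 i) `<=`
    [set B | measurable (f @^-1` B)] by apply.
apply: smallest_sub.
  split => /=.
  - by rewrite preimage_set0.
  - by move=> B mB; rewrite setTD preimage_setC; exact: measurableC.
  - by move=> F mF; rewrite preimage_bigcup; exact: bigcup_measurable.
rewrite -bigcup_seq => B [i _ [C mC <-]] /=.
by rewrite setTI -[X in measurable X]setTI; exact: mf.
Qed.

Section rV_cons.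
Variables (R : realType) (n : nat).

Definition rV_cons (z : R * 'rV[R]_n) : 'rV[R]_n.+1 :=
  \row_(i < n.+1) if unlift ord0 i is Some j then z.2 0 j else z.1.

Definition rV_uncons (x : 'rV[R]_n.+1) : R * 'rV[R]_n :=
  (x 0 ord0, \row_(j < n) x 0 (lift ord0 j)).

Lemma rV_consK : cancel rV_cons rV_uncons.
Proof.
case=> a v; rewrite /rV_uncons mxE unlift_none; congr pair.
by apply/rowP => j; rewrite !mxE liftK.
Qed.

Lemma measurable_rV_cons : measurable_fun [set: R * 'rV[R]_n] rV_cons.
Proof.
apply: measurable_fun_rVP => i.
under eq_fun do rewrite mxE.
case: (unlift ord0 i) => [j|]; last exact: measurable_fst.
exact: (measurableT_comp (measurable_coord j) measurable_snd).
Qed.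

Lemma measurable_rV_uncons : measurable_fun [set: 'rV[R]_n.+1] rV_uncons.
Proof.
apply/measurable_fun_pairP; split; first exact: measurable_coord.
apply: measurable_fun_rVP => i.
under eq_fun do rewrite mxE.
exact: measurable_coord.
Qed.

End rV_cons.

Section lebesgue_rV.
Variable R : realType.
Local Open Scope ereal_scope.

Section step.
Variables (n : nat) (m : {sigma_finite_measure set 'rV[R]_n -> \bar R}).

Definition measure_rV_cons : set 'rV[R]_n.+1 -> \bar R :=
  pushforward (@lebesgue_measure R \x m) (@rV_cons R n).

Let measure_rV_cons0 : measure_rV_cons set0 = 0.
Proof. by rewrite /measure_rV_cons /pushforward preimage_set0 measure0. Qed.

Let measure_rV_cons_ge0 A : 0 <= measure_rV_cons A.
Proof. by rewrite /measure_rV_cons /pushforward; exact: measure_ge0. Qed.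

Let measure_rV_cons_sigma_additive : semi_sigma_additive measure_rV_cons.
Proof.
move=> F mF tF mUF; rewrite /measure_rV_cons /pushforward preimage_bigcup.
have mpre A : measurable A -> measurable (@rV_cons R n @^-1` A).
  by move=> mA; rewrite -[X in measurable X]setTI; exact: measurable_rV_cons.
apply: measure_semi_sigma_additive => [i||].
- exact: mpre.
- apply/trivIsetP => /= i j _ _ ij; rewrite -preimage_setI.
  by move/trivIsetP : tF => /(_ _ _ _ _ ij) ->//; rewrite preimage_set0.
- by rewrite -preimage_bigcup; exact: mpre.
Qed.

HB.instance Definition _ := isMeasure.Build _ _ _ measure_rV_cons
  measure_rV_cons0 measure_rV_cons_ge0 measure_rV_cons_sigma_additive.

Let measure_rV_cons_sigma_finite : sigma_finite setT measure_rV_cons.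
Proof.
have /sigma_finiteP[F [TF ndF Foo]] := sigma_finiteT (@lebesgue_measure R).
have /sigma_finiteP[G [TG ndG Goo]] := sigma_finiteT m.
exists (fun i => @rV_uncons R n @^-1` (F i `*` G i)).
  rewrite -preimage_bigcup (_ : \bigcup_i _ = setT) ?preimage_setT//.
  apply/seteqP; split=> // -[x y] _.
  have [i _ Fx] : (\bigcup_i F i) x by rewrite -TF.
  have [k _ Gy] : (\bigcup_k G k) y by rewrite -TG.
  exists (maxn i k) => //; split.
  - by move: x Fx; exact/subsetPset/ndF/leq_maxl.
  - by move: y Gy; exact/subsetPset/ndG/leq_maxr.
move=> i; have [mF Fi] := Foo i; have [mG Gi] := Goo i; split.
  rewrite -[X in measurable X]setTI.
  by apply: measurable_rV_uncons => //; exact: measurableX.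
rewrite /measure_rV_cons /pushforward -comp_preimage.
rewrite (_ : _ \o _ = id); last by apply/funext => z; exact: rV_consK.
by rewrite product_measure1E// lte_mul_pinfty// ge0_fin_numE.
Qed.

HB.instance Definition _ := @Measure_isSigmaFinite.Build _ _ _ measure_rV_cons
  measure_rV_cons_sigma_finite.

End step.

(* [n]-fold product of the Lebesgue measure on the line, moved to ['rV[R]_n]. *)
Fixpoint mes (n : nat) : {sigma_finite_measure set 'rV[R]_n -> \bar R} :=
  if n is m.+1 return {sigma_finite_measure set 'rV[R]_n -> \bar R}
  then measure_rV_cons (mes m) else dirac (0%R : 'rV[R]_0).

End lebesgue_rV.

Section heat.
Variables (R : realType) (n : nat).
Implicit Types (x y : 'rV[R]_n) (f phi : 'rV[R]_n -> R) (r t alpha p : R).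
Implicit Types (u v : 'rV[R]_n -> R -> R) (T : \bar R).

(* The library norm on ['rV[R]_n] is the sup norm. *)
Definition enorm x : R := Num.sqrt (\sum_i x 0 i ^+ 2).

Definition eball x r : set 'rV[R]_n := [set y | enorm (y - x) < r].

(* For [0 < n] and [0 < r] balls have finite positive measure, so that [fine]
   loses nothing and the quotients lie in [[0, 1]]. *)
Definition density phi alpha r : \bar R :=
  ereal_sup [set (fine (mes R n (eball x r `&` [set y | alpha <= phi y]))
                  / fine (mes R n (eball x r)))%:E | x in [set: 'rV[R]_n]].

Definition upper_density phi alpha : \bar R :=
  limf_esup (density phi alpha) (pinfty_nbhs R).

Definition heat_kernel x y t : R :=
  ((4 * pi * t) `^ (n%:R / 2))^-1 * expR (- (enorm (x - y) ^+ 2 / (4 * t))).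

Definition source p (z : R) : R := `|z| `^ (p - 1) * z.

Definition basis_vec (i : 'I_n) : 'rV[R]_n := delta_mx 0 i.

Definition twice_derivable f x : Prop := forall i,
  (forall y, derivable f y (basis_vec i)) /\
  derivable ('D_(basis_vec i) f) x (basis_vec i).

Definition laplacian f x : R :=
  \sum_i 'D_(basis_vec i) ('D_(basis_vec i) f) x.

(* Non-negative solution on [R^n x [0, T)], T possibly infinite; the values of
   [u] at times outside [[0, T)] are irrelevant. The integrands of the integral
   equation are non-negative, so it is stated in [\bar R]. *)
Record solution_on p phi u T : Prop := SolutionOn {
  solution_gt0 : (0 < T)%E ;
  solution_continuous :
    {within [set z : 'rV[R]_n * R | 0 <= z.2 /\ (z.2%:E < T)%E],
      continuous (fun z => u z.1 z.2)} ;
  solution_initial : forall x, u x 0 = phi x ;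
  solution_ge0 : forall x t, 0 <= t -> (t%:E < T)%E -> 0 <= u x t ;
  solution_bounded : forall t1, 0 <= t1 -> (t1%:E < T)%E ->
    exists M : R, forall x t, 0 <= t <= t1 -> `|u x t| <= M ;
  solution_heat : forall x t, 0 < t -> (t%:E < T)%E ->
    [/\ derivable (u x) t 1,
        twice_derivable (fun y => u y t) x &
        derive1 (u x) t = laplacian (fun y => u y t) x + source p (u x t)] ;
  solution_integral : forall x t, 0 < t -> (t%:E < T)%E ->
    (u x t)%:E =
      (\int[mes R n]_y (heat_kernel x y t * phi y)%:E +
       \int[lebesgue_measure]_(s in `[0%R, t]) \int[mes R n]_y
         (heat_kernel x y (t - s) * source p (u y s))%:E)%E }.

Definition maximal_solution p phi u T : Prop :=
  solution_on p phi u T /\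
  forall v T', solution_on p phi v T' ->
    (forall x t, 0 <= t -> (t%:E < T)%E -> (t%:E < T')%E -> v x t = u x t) ->
    (T' <= T)%E.

Definition sup_norm u t : \bar R := 'N[mes R n]_+oo%E[EFin \o u^~ t].

Definition blows_up_at u T : Prop :=
  (T < +oo)%E /\ sup_norm u t @[t --> (fine T)^'-] --> +oo%E.

End heat.

(* Main.v *)
(* By Duhamel's formula and Jensen's inequality, [h s := heat (t - s) (u s) x]
   satisfies [h' >= h ^ p] on [0, t], so that [(p - 1) * t <= (heat t phi x) ^ (1 - p)]
   at every point [x] and every time [t] before the life span. Averaging
   [heat t phi] over larger and larger balls, the Gaussian tail becoming negligible,
   some [heat t phi x] is almost [alpha * upper_density phi alpha]; this bounds the
   life span. Blow-up of the sup norm is the usual continuation argument. If the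
   sup norm stayed below [N] along times tending to the life span, a Picard iteration
   started at such a time, whose step depends on [N] only, would extend the solution.
   The extension is a classical solution because mild solutions are smooth: the
   Gaussian integration by parts moves one space derivative onto the kernel, twice,
   and the time derivative follows from
   [heat h w x - w x = \int_(0, sqrt (2 * h)) r * \sum_i E (d_i^2 w (x + r Z)) dr]. *)

From HB Require Import structures.
Require Import Defs.
From mathcomp Require Import all_boot all_order all_algebra.
From mathcomp Require Import all_classical all_reals all_analysis.
From mathcomp Require Import measurable_realfun ring lra.

Set Implicit Arguments.
Unset Strict Implicit.
Unset Printing Implicit Defensive.

Import Order.TTheory GRing.Theory Num.Theory.
Import numFieldNormedType.Exports.

Local Open Scope classical_set_scope.
Local Open Scope ring_scope.

(** * Gaussian measure and heat kernel *)

(** When [p <= 2] the source is once but not twice differentiable at [0], so it can pay for one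
    space derivative only. The first derivative of a mild solution is therefore taken from the
    kernel alone, with a merely continuous source; it makes the source differentiable in space, and
    after a restart at a positive time the kernel supplies the second one. Working with [gauss], the
    law of [Z] in [x + sqrt (2 * t) * Z], fixes the measure and moves [x] and [t] into the
    integrand: time [0] is no exception, and continuity in all parameters is dominated convergence.
    The Duhamel operator is studied for sources that are continuous and bounded at all times;
    functions given on a time interval are frozen outside it ([clip], [freeze]), which changes no
    Duhamel integral over the interval. The ball on which [heat t phi] is averaged exceeds the
    density ball by a fixed [rho] that captures almost all of the Gaussian mass, so that the ratio
    of volumes tends to [1]. Blow-up comes out as a limit, not only an upper limit, because the step
    [d] rules out every time closer than [d] to the end. *)

Section integral_scale.
Local Open Scope ereal_scope.
Context d (T : measurableType d) (R : realType) (mu : {measure set T -> \bar R}).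

Lemma ge0_integralTZr (f : T -> \bar R) (k : R) : measurable_fun setT f ->
  (forall x, 0 <= f x) -> (0 <= k)%R ->
  \int[mu]_x (f x * k%:E) = (\int[mu]_x f x) * k%:E.
Proof. by move=> mf f0 k0; rewrite ge0_integralZr// lee_fin. Qed.

Lemma ge0_integralTZl (f : T -> \bar R) (k : R) : measurable_fun setT f ->
  (forall x, 0 <= f x) -> (0 <= k)%R ->
  \int[mu]_x (k%:E * f x) = k%:E * \int[mu]_x f x.
Proof. by move=> mf f0 k0; rewrite ge0_integralZl// lee_fin. Qed.
End integral_scale.

Lemma integral_prob_cst d (T : measurableType d) (R : realType)
  (P : probability T R) (r : \bar R) : (\int[P]_x r = r)%E.
Proof. by rewrite integral_cst//; move: (probability_setT P) => /= ->; rewrite mule1. Qed.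

(* The library measures [lebesgue_measure] and [normal_prob] live on
   [measurableTypeR R], whose sigma-algebra is not the canonical one of [R];
   these are copies on [R]. *)
Section canonical_copies.
Variable R : realType.
Definition leb (A : set R) : \bar R := @lebesgue_measure R A.
Let leb0 : leb set0 = 0%E. Proof. exact: measure0. Qed.

Let leb_ge0 A : (0 <= leb A)%E. Proof. exact: measure_ge0. Qed.

Let leb_additive : semi_sigma_additive leb.
Proof. exact: (@measure_semi_sigma_additive _ _ _ (@lebesgue_measure R)). Qed.
HB.instance Definition _ := isMeasure.Build _ _ _ leb leb0 leb_ge0 leb_additive.
Let leb_sigma_finite : sigma_finite setT leb.
Proof. exact: (sigma_finiteT (@lebesgue_measure R)). Qed.
HB.instance Definition _ := Measure_isSigmaFinite.Build _ _ _ leb leb_sigma_finite.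
Definition stdn (A : set R) : \bar R := normal_prob (0 : R) 1 A.
Let stdn0 : stdn set0 = 0%E. Proof. exact: measure0. Qed.

Let stdn_ge0 A : (0 <= stdn A)%E. Proof. exact: measure_ge0. Qed.

Let stdn_additive : semi_sigma_additive stdn.
Proof. exact: (@measure_semi_sigma_additive _ _ _ (normal_prob (0:R) 1)). Qed.
HB.instance Definition _ := isMeasure.Build _ _ _ stdn stdn0 stdn_ge0 stdn_additive.
Let stdnT : stdn setT = 1%E.
Proof. exact: (@probability_setT _ _ _ (normal_prob (0:R) 1)). Qed.
HB.instance Definition _ := Measure_isProbability.Build _ _ _ stdn stdnT.

Let mid : measurable_fun setT (idfun : measurableTypeR R -> R).
Proof. by move=> _ A mA; rewrite setTI; exact: mA. Qed.

(** The identity between the two copies of the line is measurable, and pushing forward along it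
    keeps the values of the measure. *)
Lemma ge0_integral_leb D (f : R -> \bar R) : measurable D -> measurable_fun D f -> (forall x, 0 <= f x)%E ->
  (\int[leb]_(x in D) f x = \int[lebesgue_measure]_(x in D) f x)%E.
Proof.
move=> mD mf f0.
rewrite -(ge0_integral_pushforward mid lebesgue_measure mD mf (fun x _ => f0 x)).
by apply: eq_measure_integral => A mA _.
Qed.
End canonical_copies.

Arguments leb : clear implicits.
Arguments stdn : clear implicits.
Section affine1.
Context {R : realType}.
Notation mu := (@lebesgue_measure R).
Local Open Scope ereal_scope.

Lemma affine_preimage_itv (b c x y : R) : (0 < c)%R ->
  (fun z => b + c * z)%R @^-1` `]x, y] = `]((x - b) / c)%R, ((y - b) / c)%R]%classic.
Proof.
move=> c0; apply/seteqP; split => z /=; rewrite !in_itv/=.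
  move=> /andP[h1 h2]; apply/andP; split.
    by rewrite ltr_pdivrMr// mulrC ltrBlDl.
  by rewrite ler_pdivlMr// mulrC lerBrDl.
move=> /andP[h1 h2]; apply/andP; split.
  by rewrite -ltrBlDl mulrC -ltr_pdivrMr.
by rewrite -lerBrDl mulrC -ler_pdivlMr.
Qed.

Lemma measurable_affine (b c : R) : measurable_fun [set: R] (fun z => b + c * z)%R.
Proof. by apply: measurable_funD => //; exact: measurable_funM. Qed.

(** By uniqueness of the Lebesgue measure it is enough to compare both sides on intervals []x,
    y]]. *)
Lemma lebesgue_measure_affine (b c : R) (c0 : (0 < c)%R) (A : set R) :
  measurable A ->
  mu A = c%:E * pushforward mu ((fun z => b + c * z)%R : R -> measurableTypeR R) A.
Proof.
move=> mA; pose k : {nonneg R} := NngNum (ltW c0).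
have mf : measurable_fun setT ((fun z => b + c * z)%R : R -> measurableTypeR R).
  exact: measurable_affine.
rewrite (@lebesgue_measure_unique _ (mscale k (pushforward mu ((fun z => b + c * z)%R : R -> measurableTypeR R))))//.
move=> _ [[x y]] _ <-.
change (mu `]x, y] = c%:E * mu ((fun z => b + c * z)%R @^-1` `]x, y])).
rewrite (affine_preimage_itv b x y c0) !lebesgue_measure_itv/= !lte_fin.
rewrite ltr_pM2r ?invr_gt0// ltrD2r.
case: ifPn => _; last by rewrite mule0.
by rewrite -!EFinB -EFinM; congr EFin; field; rewrite gt_eqF.
Qed.

Lemma ge0_integral_affine (b c : R) (f : R -> \bar R) : (0 < c)%R ->
  measurable_fun [set: R] f -> (forall x, 0 <= f x) ->
  \int[leb R]_x f x = c%:E * \int[leb R]_x f (b + c * x)%R.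
Proof.
move=> c0 mf f0; rewrite !ge0_integral_leb//; last first.
  by apply: (measurableT_comp mf); exact: measurable_affine.
pose k : {nonneg R} := NngNum (ltW c0).
have mg : measurable_fun setT ((fun z => b + c * z)%R : R -> measurableTypeR R).
  exact: measurable_affine.
rewrite (eq_measure_integral (mscale k (pushforward mu ((fun z => b + c * z)%R : R -> measurableTypeR R)))).
  by rewrite ge0_integral_mscale//= ge0_integral_pushforward.
by move=> //= A mA _; exact: lebesgue_measure_affine.
Qed.
End affine1.

Section density.
Local Open Scope ereal_scope.
Context d (T : measurableType d) (R : realType).
Variables (mu P : {measure set T -> \bar R}) (w : T -> R).
Hypotheses (mw : measurable_fun setT w) (w0 : forall x, (0 <= w x)%R).
Hypothesis PE : forall A, measurable A -> P A = \int[mu]_(x in A) (w x)%:E.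

Import HBNNSimple.

Let mwE : measurable_fun setT (EFin \o w). Proof. exact/measurable_EFinP. Qed.

Let integral_density_nnsfun (f : {nnsfun T >-> R}) :
  \int[P]_x (f x)%:E = \int[mu]_x ((f x)%:E * (w x)%:E).
Proof.
under [LHS]eq_integral do rewrite fimfunE -fsumEFin//.
rewrite [LHS]ge0_integral_fsum//; last 2 first.
- by move=> r; exact/measurable_EFinP/measurableT_comp.
- by move=> n x _; rewrite EFinM nnfun_muleindic_ge0.
under [RHS]eq_integral.
  move=> x xD; rewrite fimfunE -fsumEFin// ge0_mule_fsuml; last first.
    by move=> r; rewrite EFinM nnfun_muleindic_ge0.
  over.
rewrite [RHS]ge0_integral_fsum//; last 2 first.
- move=> r; apply: emeasurable_funM => //; exact/measurable_EFinP/measurableT_comp.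
- by move=> n x _; rewrite EFinM mule_ge0// ?nnfun_muleindic_ge0 ?lee_fin.
apply: eq_fsbigr => r _.
rewrite integralZl_indic_nnsfun//= integral_indic// setIT PE//.
under [RHS]eq_integral do rewrite EFinM -muleA.
(* A negative [r] is not a value of [f]: its preimage is empty and both sides vanish. *)
have [r0|r0] := leP 0%R r.
  rewrite ge0_integralZl//.
  - congr (_ * _); rewrite [LHS]integral_mkcond; apply: eq_integral => x _.
    by rewrite patchE indicE; case: ifP => _; rewrite ?mul1e ?mul0e.
  - by apply: emeasurable_funM => //; exact/measurable_EFinP/measurable_indic.
  - by move=> x _; rewrite mule_ge0// lee_fin.
rewrite preimage_nnfun0// integral_set0 mule0 integral0_eq// => x _.
by rewrite indicE in_set0 mul0e mule0.
Qed.

(** Simple functions first, then monotone convergence along [nnsfun_approx] on both sides. *)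
Lemma ge0_integral_density (f : T -> \bar R) :
  measurable_fun setT f -> (forall x, 0 <= f x) ->
  \int[P]_x f x = \int[mu]_x (f x * (w x)%:E).
Proof.
move=> mf f0; pose f_ := nnsfun_approx measurableT mf.
have f_f x : (f_ n x)%:E @[n --> \oo] --> f x by exact: cvg_nnsfun_approx.
transitivity (limn (fun n => \int[P]_x (f_ n x)%:E)).
  rewrite -monotone_convergence//=.
  - by apply: eq_integral => x _; apply/esym/cvg_lim => //; exact: f_f.
  - by move=> n; exact/measurable_EFinP.
  - by move=> n ? _; rewrite lee_fin.
  - by move=> ? _ ? ? mn; rewrite lee_fin; exact/lefP/nd_nnsfun_approx.
under eq_fun do rewrite integral_density_nnsfun.
rewrite -monotone_convergence//=.
- apply: eq_integral => x _; apply/cvg_lim => //.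
  by apply: cvgeZr => //; exact: f_f.
- by move=> n; apply: emeasurable_funM => //; exact/measurable_EFinP.
- by move=> n x _; rewrite mule_ge0// lee_fin.
- move=> x _ m n mn; rewrite lee_wpmul2r ?lee_fin//.
  exact/lefP/nd_nnsfun_approx.
Qed.
End density.

Section gauss.
Variable R : realType.
Local Open Scope ereal_scope.

Section step.
Variables (n : nat) (m : probability 'rV[R]_n R).

Definition gauss_cons : set 'rV[R]_n.+1 -> \bar R :=
  pushforward (stdn R \x m) (@rV_cons R n).

Let mpre A : measurable A -> measurable (@rV_cons R n @^-1` A).
Proof.
by move=> mA; rewrite -[X in measurable X]setTI; exact: measurable_rV_cons.
Qed.

Let gauss_cons0 : gauss_cons set0 = 0.
Proof. by rewrite /gauss_cons /pushforward preimage_set0 measure0. Qed.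

Let gauss_cons_ge0 A : 0 <= gauss_cons A.
Proof. by rewrite /gauss_cons /pushforward; exact: measure_ge0. Qed.

Let gauss_cons_sigma_additive : semi_sigma_additive gauss_cons.
Proof.
move=> F mF tF mUF; rewrite /gauss_cons /pushforward preimage_bigcup.
apply: measure_semi_sigma_additive => [i||].
- exact: mpre.
- apply/trivIsetP => /= i j _ _ ij; rewrite -preimage_setI.
  by move/trivIsetP : tF => /(_ _ _ _ _ ij) ->//; rewrite preimage_set0.
- by rewrite -preimage_bigcup; exact: mpre.
Qed.

HB.instance Definition _ := isMeasure.Build _ _ _ gauss_cons
  gauss_cons0 gauss_cons_ge0 gauss_cons_sigma_additive.

Let gauss_consT : gauss_cons setT = 1.
Proof. by rewrite /gauss_cons /pushforward preimage_setT probability_setT. Qed.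

HB.instance Definition _ := Measure_isProbability.Build _ _ _ gauss_cons gauss_consT.

End step.

(** The same recursion as for [mes], so that the density of one measure with respect to the other is
    found by induction on the dimension. *)
Fixpoint gauss (n : nat) : probability 'rV[R]_n R :=
  if n is m.+1 return probability 'rV[R]_n R
  then gauss_cons (gauss m) else dirac (0%R : 'rV[R]_0).

Lemma ge0_integral_gauss1 (f : R -> \bar R) :
  measurable_fun [set: R] f -> (forall x, 0 <= f x) ->
  \int[stdn R]_x f x = \int[leb R]_x (f x * (normal_pdf 0 1 x)%:E).
Proof.
have mp := @measurable_normal_pdf R 0 1.
move=> mf f0; apply: ge0_integral_density => //.
- by move=> x; exact: normal_pdf_ge0.
- move=> A mA; rewrite ge0_integral_leb//; last by move=> x; rewrite lee_fin normal_pdf_ge0.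
  exact/measurable_funTS/measurable_EFinP.
Qed.

Lemma ge0_integral_mesS n (f : 'rV[R]_n.+1 -> \bar R) :
  measurable_fun setT f -> (forall x, 0 <= f x) ->
  \int[mes R n.+1]_x f x =
  \int[leb R]_a \int[mes R n]_v f (rV_cons (a, v)).
Proof.
move=> mf f0.
have mc := @measurable_rV_cons R n.
have mfc : measurable_fun setT (f \o @rV_cons R n) by exact: measurableT_comp.
rewrite /= ge0_integral_pushforward//= fubini_tonelli1//=.
rewrite ge0_integral_leb//; last by move=> a; exact: integral_ge0.
by apply: (measurable_fun_fubini_tonelli_F (f \o @rV_cons R n)) => //= z; exact: f0.
Qed.

Lemma ge0_integral_gaussS n (f : 'rV[R]_n.+1 -> \bar R) :
  measurable_fun setT f -> (forall x, 0 <= f x) ->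
  \int[gauss n.+1]_x f x =
  \int[stdn R]_a \int[gauss n]_v f (rV_cons (a, v)).
Proof.
move=> mf f0.
have mc := @measurable_rV_cons R n.
rewrite /= ge0_integral_pushforward//=.
by rewrite fubini_tonelli1//=; exact: measurableT_comp.
Qed.

Lemma integral_mes0 (f : 'rV[R]_0 -> \bar R) :
  measurable_fun setT f -> \int[mes R 0]_x f x = f 0%R.
Proof. by move=> mf; rewrite /= integral_dirac// diracT mul1e. Qed.

Lemma integral_gauss0 (f : 'rV[R]_0 -> \bar R) :
  measurable_fun setT f -> \int[gauss 0]_x f x = f 0%R.
Proof. by move=> mf; rewrite /= integral_dirac// diracT mul1e. Qed.

End gauss.

Section rV_tools.
Variable R : realType.

Lemma rV_unconsK n (x : 'rV[R]_n.+1) : rV_cons (rV_uncons x) = x.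
Proof.
apply/rowP => i; rewrite mxE; case: unliftP => [j|] -> //=.
by rewrite mxE.
Qed.

Lemma rV_cons0 n a (v : 'rV[R]_n) : rV_cons (a, v) 0 ord0 = a.
Proof. by rewrite mxE unlift_none. Qed.

Lemma rV_consS n a (v : 'rV[R]_n) i : rV_cons (a, v) 0 (lift ord0 i) = v 0 i.
Proof. by rewrite mxE liftK. Qed.

Lemma rV_consP n (x : 'rV[R]_n.+1) a (v : 'rV[R]_n) :
  x 0 ord0 = a -> (forall i, x 0 (lift ord0 i) = v 0 i) -> x = rV_cons (a, v).
Proof.
move=> x0 xS; apply/rowP => i; case: (unliftP ord0 i) => [j|] ->.
  by rewrite xS rV_consS.
by rewrite x0 rV_cons0.
Qed.

Lemma rV_consZD n (b : R) (w : 'rV[R]_n) (c : R) a v :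
  rV_cons (b, w) + c *: rV_cons (a, v) = rV_cons (b + c * a, w + c *: v).
Proof.
by apply: rV_consP => [|i]; rewrite !mxE ?unlift_none ?liftK//= !mxE.
Qed.

Lemma rV_consD n (b : R) (w : 'rV[R]_n) a v :
  rV_cons (b, w) + rV_cons (a, v) = rV_cons (b + a, w + v).
Proof. by have := rV_consZD b w 1 a v; rewrite !scale1r mul1r. Qed.

Lemma rV_consZ n (c : R) a (v : 'rV[R]_n) :
  c *: rV_cons (a, v) = rV_cons (c * a, c *: v).
Proof.
by apply: rV_consP => [|i]; rewrite !mxE ?unlift_none ?liftK//= !mxE.
Qed.

Lemma rV_cons_delta0 n : delta_mx 0 ord0 = rV_cons (1, 0) :> 'rV[R]_n.+1.
Proof. by apply: rV_consP => [|i]; rewrite !mxE ?eqxx//. Qed.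

Lemma rV_cons_deltaS n (i : 'I_n) :
  delta_mx 0 (lift ord0 i) = rV_cons (0, delta_mx 0 i) :> 'rV[R]_n.+1.
Proof.
apply: rV_consP => [|j]; rewrite !mxE eqxx//=.
Qed.

Lemma measurable_rV_cons2 n (a : R) : measurable_fun setT (fun v : 'rV[R]_n => rV_cons (a, v)).
Proof.
exact: (measurableT_comp (@measurable_rV_cons R n) (pair1_measurable a)).
Qed.

Lemma measurable_rVD d (T : measurableType d) n (f g : T -> 'rV[R]_n) :
  measurable_fun setT f -> measurable_fun setT g ->
  measurable_fun setT (fun x => f x + g x).
Proof.
move=> mf mg; apply: measurable_fun_rVP => i.
under eq_fun do rewrite mxE.
by apply: measurable_funD; exact: (measurableT_comp (measurable_coord i)).
Qed.

Lemma measurable_rVZ d (T : measurableType d) n (c : T -> R) (f : T -> 'rV[R]_n) :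
  measurable_fun setT c -> measurable_fun setT f ->
  measurable_fun setT (fun x => c x *: f x).
Proof.
move=> mc mf; apply: measurable_fun_rVP => i.
under eq_fun do rewrite mxE.
by apply: measurable_funM => //; exact: (measurableT_comp (measurable_coord i)).
Qed.

Lemma measurable_fun_rV_cons n (f : 'rV[R]_n.+1 -> \bar R) : measurable_fun setT f ->
  measurable_fun setT (fun z : R * 'rV[R]_n => f (rV_cons z)).
Proof. by move=> mf; exact: (measurableT_comp mf (@measurable_rV_cons R n)). Qed.

Lemma measurable_fun_rV_cons2 n (f : 'rV[R]_n.+1 -> \bar R) a : measurable_fun setT f ->
  measurable_fun setT (fun v : 'rV[R]_n => f (rV_cons (a, v))).
Proof. by move=> mf; exact: (measurableT_comp mf (measurable_rV_cons2 a)). Qed.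

Lemma measurable_integral_rV_cons n (f : 'rV[R]_n.+1 -> \bar R) (m : {sigma_finite_measure set 'rV[R]_n -> \bar R}) :
  measurable_fun setT f -> (forall x, 0 <= f x)%E ->
  measurable_fun setT (fun a : R => \int[m]_v f (rV_cons (a, v)))%E.
Proof.
move=> mf f0.
by apply: (measurable_fun_fubini_tonelli_F (fun z : R * 'rV[R]_n => f (rV_cons z))) => //; exact: measurable_fun_rV_cons.
Qed.

End rV_tools.

Section mes_gauss.
Variable R : realType.
Local Open Scope ereal_scope.
Notation leb := (leb R).
Notation N01 := (stdn R).

(** Induction on the dimension: for a fixed first coordinate the induction hypothesis handles the
    tail and gives [c ^+ n]; the one-dimensional formula gives the last factor [c]. *)
Lemma ge0_integral_mes_affine n (b : 'rV[R]_n) (c : R) (f : 'rV[R]_n -> \bar R) :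
  (0 < c)%R -> measurable_fun setT f -> (forall x, 0 <= f x) ->
  \int[mes R n]_x f x = (c ^+ n)%:E * \int[mes R n]_x f (b + c *: x)%R.
Proof.
move=> c0; elim: n => [|n IH] in b f *.
  move=> mf f0; rewrite !integral_mes0//; last first.
    by apply: (measurableT_comp mf); apply: measurable_rVD => //; exact: measurable_rVZ.
  by rewrite expr0 mul1e; congr f; apply/rowP => -[].
move=> mf f0; rewrite !ge0_integral_mesS//; last first.
  by apply: (measurableT_comp mf); apply: measurable_rVD => //; exact: measurable_rVZ.
rewrite -(rV_unconsK b); case: (rV_uncons b) => b0 bt.
pose G a := \int[mes R n]_v f (rV_cons (a, bt + c *: v))%R.
have mG : measurable_fun [set: R] G.
  apply: (measurable_fun_fubini_tonelli_F (fun z : R * 'rV[R]_n => f (rV_cons (z.1, bt + c *: z.2)%R))) => //.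
  apply: (measurableT_comp mf); apply: (measurableT_comp (@measurable_rV_cons R n)).
  apply/measurable_fun_pairP; split; first exact: measurable_fst.
  by apply: (measurable_rVD (f := fun=> bt)) => //; apply: measurable_rVZ => //; exact: measurable_snd.
have G0 a : 0 <= G a by exact: integral_ge0.
transitivity (\int[leb]_a ((c ^+ n)%:E * G a)).
  by apply: eq_integral => a _; rewrite (IH bt)//; exact: measurable_fun_rV_cons2.
have cn0 : 0 <= (c ^+ n)%:E by rewrite lee_fin exprn_ge0// ltW.
rewrite (ge0_integralZl leb measurableT mG (fun a _ => G0 a) cn0).
rewrite (ge0_integral_affine b0 c0 mG G0) muleA -EFinM -exprSr; congr (_ * _).
by apply: eq_integral => a _; apply: eq_integral => v _; rewrite rV_consZD.
Qed.

Definition gauss_density n (z : 'rV[R]_n) : R := (\prod_i normal_pdf 0 1 (z 0 i))%R.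

Lemma gauss_density_ge0 n (z : 'rV[R]_n) : (0 <= gauss_density z)%R.
Proof. by apply: prodr_ge0 => i _; exact: normal_pdf_ge0. Qed.

Lemma measurable_gauss_density n : measurable_fun setT (@gauss_density n).
Proof.
apply: measurable_prod => i _.
exact: (measurableT_comp (@measurable_normal_pdf _ _ _) (measurable_coord i)).
Qed.

Lemma gauss_densityS n a (v : 'rV[R]_n) :
  gauss_density (rV_cons (a, v)) = (normal_pdf 0 1 a * gauss_density v)%R.
Proof.
rewrite /gauss_density big_ord_recl rV_cons0; congr (_ * _)%R.
by apply: eq_bigr => i _; rewrite rV_consS.
Qed.

Lemma ge0_integral_gauss n (f : 'rV[R]_n -> \bar R) :
  measurable_fun setT f -> (forall x, 0 <= f x) ->
  \int[gauss R n]_x f x = \int[mes R n]_x (f x * (gauss_density x)%:E).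
Proof.
have me k : measurable_fun setT (fun x => (@gauss_density k x)%:E).
  by apply/measurable_EFinP; exact: measurable_gauss_density.
have f1 k (g : 'rV[R]_k -> \bar R) x : (forall x, 0 <= g x) -> 0 <= g x * (gauss_density x)%:E.
  by move=> g0; rewrite mule_ge0// lee_fin gauss_density_ge0.
elim: n f => [|n IH] f mf f0.
  rewrite integral_gauss0// integral_mes0//; last (apply: emeasurable_funM; [exact: mf|exact: me]).
  by rewrite /gauss_density big_ord0 mule1.
have mh : measurable_fun setT (fun x => f x * (gauss_density x)%:E).
  by apply: emeasurable_funM; [exact: mf|exact: me].
have mi := measurable_integral_rV_cons (gauss R n) mf f0.
have i0 a : 0 <= \int[gauss R n]_v f (rV_cons (a, v)) by exact: integral_ge0.
rewrite (ge0_integral_gaussS mf f0) (ge0_integral_mesS mh (fun x => f1 _ f x f0)).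
rewrite (ge0_integral_gauss1 mi i0).
apply: eq_integral => a _; rewrite IH//; last exact: measurable_fun_rV_cons2.
rewrite -ge0_integralZr//.
- by apply: eq_integral => v _; rewrite gauss_densityS EFinM muleAC -muleA.
- by apply: emeasurable_funM; [exact: measurable_fun_rV_cons2|exact: me].
- by move=> v _; rewrite mule_ge0// lee_fin gauss_density_ge0.
- by rewrite lee_fin normal_pdf_ge0.
Qed.

End mes_gauss.

Section kernel.
Variable R : realType.

Lemma enorm_sqr n (x : 'rV[R]_n) : enorm x ^+ 2 = \sum_i x 0 i ^+ 2.
Proof. by rewrite sqr_sqrtr// sumr_ge0// => i _; rewrite sqr_ge0. Qed.

Lemma gauss_densityE n (z : 'rV[R]_n) :
  gauss_density z = (Num.sqrt (pi *+ 2))^-1 ^+ n * expR (- (enorm z ^+ 2 / 2)).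
Proof.
rewrite /gauss_density enorm_sqr mulr_suml -sumrN expR_sum.
have -> : (Num.sqrt (pi *+ 2))^-1 ^+ n = \prod_(i < n) ((Num.sqrt (pi *+ 2))^-1 : R).
  by rewrite prodr_const card_ord.
rewrite -big_split/=; apply: eq_bigr => i _.
rewrite normal_pdfE ?oner_neq0// /normal_peak /normal_fun expr1n mul1r subr0.
by rewrite mulNr.
Qed.

(** In the variable [y = x + sqrt (2 * t) * z] the Jacobian times the kernel is the standard
    Gaussian density; this is the origin of the width [sqrt (2 * t)] used everywhere below. *)
Lemma heat_kernel_affine n (x z : 'rV[R]_n) (t : R) : 0 < t ->
  Num.sqrt (2 * t) ^+ n * heat_kernel x (x + Num.sqrt (2 * t) *: z) t =
  gauss_density z.
Proof.
move=> t0; have t20 : 0 <= 2 * t by rewrite mulr_ge0// ltW.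
rewrite gauss_densityE /heat_kernel mulrA; congr (_ * expR _); last first.
  congr (- _); rewrite !enorm_sqr.
  have -> : \sum_i (x - (x + Num.sqrt (2 * t) *: z)) 0 i ^+ 2 = 2 * t * \sum_i z 0 i ^+ 2.
    rewrite mulr_sumr; apply: eq_bigr => i _.
    by rewrite !mxE opprD addNKr sqrrN exprMn sqr_sqrtr.
  by field; rewrite gt_eqF.
rewrite (_ : 4 * pi * t = (2 * t) * (pi *+ 2)); last by rewrite -mulr_natr; ring.
rewrite mulrC [n%:R / 2]mulrC powRrM powR12_sqrt; last first.
  by rewrite mulr_ge0// mulrn_wge0// pi_ge0.
rewrite powR_mulrn ?sqrtr_ge0// sqrtrM// exprMn invfM mulrAC mulVf ?mul1r ?exprVn//.
by rewrite expf_neq0// gt_eqF// sqrtr_gt0 mulr_gt0.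
Qed.

Lemma measurable_enorm n : measurable_fun setT (@enorm R n).
Proof.
apply: (measurableT_comp (f := @Num.sqrt R)).
  by apply: continuous_measurable_fun; exact: sqrt_continuous.
apply: measurable_sum => i.
by apply: measurable_funX; exact: measurable_coord.
Qed.

Lemma measurable_rV_affine n (b : 'rV[R]_n) c :
  measurable_fun setT (fun z : 'rV[R]_n => b + c *: z).
Proof.
by apply: measurable_rVD => //; apply: measurable_rVZ => //; exact: measurable_id.
Qed.

Lemma measurable_heat_kernel n (x : 'rV[R]_n) t :
  measurable_fun setT (fun y => heat_kernel x y t).
Proof.
apply: measurable_funM => //; apply: measurableT_comp => //.
apply: measurableT_comp => //; apply: measurable_funM => //.
apply: measurable_funX; apply: (measurableT_comp (@measurable_enorm n)).
under eq_fun do rewrite -scaleN1r.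
exact: measurable_rV_affine.
Qed.

Lemma heat_kernel_ge0 n (x y : 'rV[R]_n) t : 0 <= heat_kernel x y t.
Proof. by rewrite mulr_ge0// ?expR_ge0// invr_ge0 powR_ge0. Qed.

(** The bridge from the kernel of the integral equation to Gaussian averages; past this point the
    kernel only reappears when the equation itself is translated and in the estimates on the measure
    of balls. *)
Lemma integral_heat_kernel n (x : 'rV[R]_n) (t : R) (f : 'rV[R]_n -> R) :
  0 < t -> measurable_fun setT f -> (forall y, 0 <= f y) ->
  (\int[mes R n]_y (heat_kernel x y t * f y)%:E =
   \int[gauss R n]_z (f (x + Num.sqrt (2 * t) *: z))%:E)%E.
Proof.
move=> t0 mf f0; have c0 : 0 < Num.sqrt (2 * t) by rewrite sqrtr_gt0 mulr_gt0.
have ma := measurable_rV_affine x (Num.sqrt (2 * t)).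
have mfa : measurable_fun setT (fun z : 'rV[R]_n => (f (x + Num.sqrt (2 * t) *: z))%:E).
  by apply/measurable_EFinP; exact: (measurableT_comp mf ma).
have mh : measurable_fun setT (fun y : 'rV[R]_n => (heat_kernel x y t * f y)%:E).
  by apply/measurable_EFinP; apply: measurable_funM => //; exact: measurable_heat_kernel.
have h0 y : (0 <= (heat_kernel x y t * f y)%:E)%E.
  by rewrite lee_fin mulr_ge0// heat_kernel_ge0.
rewrite (ge0_integral_mes_affine x c0 mh h0).
rewrite ge0_integral_gauss//; last by move=> z; rewrite lee_fin.
rewrite -ge0_integralZl//.
- apply: eq_integral => z _; rewrite -!EFinM; congr EFin.
  by rewrite -(heat_kernel_affine x z t0) mulrA mulrC.
- exact: (measurableT_comp mh ma).
Qed.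
End kernel.

(** * Translations and convolution of the Gaussian measure *)

Section gauss1_invariance.
Variable R : realType.
Local Open Scope ereal_scope.
Notation leb := (leb R).
Notation N01 := (stdn R).
Notation pdf := (@normal_pdf R 0 1).
Implicit Types f : R -> \bar R.

Lemma normal_pdf01E (x : R) : pdf x = ((Num.sqrt (pi *+ 2))^-1 * expR (- (x ^+ 2 / 2)))%R.
Proof.
rewrite normal_pdfE ?oner_neq0// /normal_peak /normal_fun expr1n mul1r subr0.
by rewrite mulNr.
Qed.

Let mpdf : measurable_fun setT pdf. Proof. exact: measurable_normal_pdf. Qed.

Let mpdfE : measurable_fun setT (EFin \o pdf). Proof. exact/measurable_EFinP. Qed.

Let mul_ge0 (y : \bar R) (r : R) : 0 <= y -> (0 <= r)%R -> 0 <= y * r%:E.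
Proof. by move=> y0 r0; rewrite mule_ge0// lee_fin. Qed.

Lemma integral_leb_normal_pdf01 : \int[leb]_x (pdf x)%:E = 1.
Proof.
rewrite ge0_integral_leb//; first exact: integral_normal_pdf.
by move=> x; rewrite lee_fin normal_pdf_ge0.
Qed.

(** Cameron-Martin formula on the line: completing the square in the translated density leaves the
    exponential factor. *)
Lemma gauss1_shift f (h : R) : measurable_fun setT f -> (forall x, 0 <= f x) ->
  \int[N01]_a f (h + a)%R = \int[N01]_a (f a * (expR (h * a - h ^+ 2 / 2))%:E).
Proof.
move=> mf f0; pose e a := expR (h * a - h ^+ 2 / 2).
have me : measurable_fun [set: R] (EFin \o e).
  apply/measurable_EFinP; apply: measurableT_comp => //.
  by apply: measurable_funB => //; exact: measurable_funM.
have ms : measurable_fun [set: R] (fun a => f (h + a)%R).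
  by apply: (measurableT_comp mf); exact: measurable_funD.
rewrite !ge0_integral_gauss1//; last 2 first.
- exact: emeasurable_funM.
- by move=> a; rewrite mul_ge0// expR_ge0.
rewrite [RHS](@ge0_integral_affine R h 1)//; last 2 first.
- by apply: emeasurable_funM => //; exact: emeasurable_funM.
- by move=> x; rewrite !mul_ge0// ?normal_pdf_ge0// expR_ge0.
rewrite mul1e; apply: eq_integral => a _.
rewrite mul1r -muleA; congr (_ * _); rewrite -EFinM; congr EFin.
rewrite !normal_pdf01E mulrCA -expRD; congr (_ * expR _)%R.
by field.
Qed.

(** Independent centered Gaussians add their variances: [a * X + b * Y] has the law of
    [sqrt (a ^+ 2 + b ^+ 2) * X]. *)
Lemma gauss1_conv f (a b : R) : (0 <= a)%R -> (0 <= b)%R ->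
  measurable_fun setT f -> (forall x, 0 <= f x) ->
  \int[N01]_x \int[N01]_y f (a * x + b * y)%R =
  \int[N01]_x f (Num.sqrt (a ^+ 2 + b ^+ 2) * x)%R.
Proof.
(* A zero coefficient removes one variable; the density argument that follows divides by [b]. *)
move=> + + mf f0; rewrite le_eqVlt => /predU1P[<- b0|a0].
  under eq_integral do under eq_integral do rewrite mul0r add0r.
  rewrite integral_prob_cst; apply: eq_integral => x _.
  by rewrite expr0n add0r sqrtr_sqr ger0_norm.
rewrite le_eqVlt => /predU1P[<-|b0].
  apply: eq_integral => x _.
  under eq_integral do rewrite mul0r addr0.
  rewrite integral_prob_cst.
  by rewrite expr0n addr0 sqrtr_sqr ger0_norm// ltW.
set s := Num.sqrt _; have s2 : (s ^+ 2 = a ^+ 2 + b ^+ 2)%R.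
  by rewrite sqr_sqrtr// addr_ge0// sqr_ge0.
have s0 : (0 < s)%R by rewrite sqrtr_gt0 addr_gt0// exprn_gt0.
have s20 : (a ^+ 2 + b ^+ 2 != 0)%R by rewrite -s2 expf_neq0// gt_eqF.
(* Joint density of [(z, w)] for [w = a * z + b * y], the factor [b^-1] being the Jacobian of
   [y -> w]. *)
pose k z w : R := (b^-1 * pdf ((w - a * z) / b) * pdf z)%R.
have k0 z w : (0 <= k z w)%R.
  by rewrite /k !mulr_ge0// ?normal_pdf_ge0// invr_ge0 ltW.
have mk : measurable_fun [set: R * R] (fun z => k z.1 z.2).
  apply: measurable_funM; last exact: (measurableT_comp mpdf).
  apply: measurable_funM => //; apply: (measurableT_comp mpdf).
  by apply: measurable_funM => //; apply: measurable_funB => //; exact: measurable_funM.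
have mkz z : measurable_fun [set: R] (k z).
  exact: (measurableT_comp mk (pair1_measurable z)).
have mkw w : measurable_fun [set: R] (k ^~ w).
  exact: (measurableT_comp mk (pair2_measurable w)).
have mfk : measurable_fun [set: R * R] (fun z => f z.2 * (k z.1 z.2)%:E).
  apply: emeasurable_funM; first exact: (measurableT_comp mf).
  exact/measurable_EFinP.
(* Marginal density of [w]. Completing the square in [z] centers it at [a * w / s ^+ 2] with
   deviation [b / s], which dictates the affine substitution. *)
have intk w : \int[leb]_z (k z w)%:E = (s^-1 * pdf (w / s))%:E.
  have c0 : (0 < s / b)%R by rewrite divr_gt0.
  have p0 (x : R) : 0 <= (pdf x)%:E by rewrite lee_fin normal_pdf_ge0.
  have := ge0_integral_affine (- (a * w / (s * b)))%R c0 mpdfE p0.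
  rewrite /= integral_leb_normal_pdf01 => E1.
  have -> : (s^-1 * pdf (w / s))%:E = (s^-1 * pdf (w / s))%:E * 1 by rewrite mule1.
  rewrite E1 muleA -EFinM -ge0_integralZl; first last.
  - by rewrite lee_fin mulr_ge0 ?mulr_ge0 ?normal_pdf_ge0// ?invr_ge0 ltW// divr_gt0.
  - by move=> x _; exact: p0.
  - by apply: (measurableT_comp mpdfE); exact: measurable_affine.
  - exact: measurableT.
  - apply: eq_integral => z _; rewrite /k -EFinM; congr EFin.
    rewrite !normal_pdf01E.
    rewrite -![(s^-1 * _ * _)%R]mulrA.
    set q := (Num.sqrt _)^-1%R.
    transitivity (b^-1 * q * q * expR (- (((w - a * z) / b) ^+ 2 / 2) - z ^+ 2 / 2))%R.
      by rewrite expRD; ring.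
    transitivity (b^-1 * q * q * expR (- ((w / s) ^+ 2 / 2) - (- (a * w / (s * b)) + s / b * z) ^+ 2 / 2))%R; last first.
      by rewrite expRD; field; rewrite !gt_eqF.
    congr (_ * expR _)%R.
    have -> : ((w / s) ^+ 2 = w ^+ 2 / (a ^+ 2 + b ^+ 2))%R by rewrite exprMn exprVn s2.
    have -> : ((- (a * w / (s * b)) + s / b * z) ^+ 2 =
       (a ^+ 2 * w ^+ 2 / (a ^+ 2 + b ^+ 2) - 2 * a * w * z + (a ^+ 2 + b ^+ 2) * z ^+ 2) / b ^+ 2)%R.
      by rewrite -s2; field; rewrite !gt_eqF.
    by field; rewrite s20 gt_eqF.
transitivity (\int[leb]_z \int[leb]_w (f w * (k z w)%:E)).
  have mab : measurable_fun [set: R * R] (fun z => f (a * z.1 + b * z.2)%R).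
    by apply: (measurableT_comp mf); apply: measurable_funD; exact: measurable_funM.
  have mi : measurable_fun [set: R] (fun x => \int[N01]_y f (a * x + b * y)%R).
    by apply: (measurable_fun_fubini_tonelli_F (fun z : R * R => f (a * z.1 + b * z.2)%R)).
  rewrite (ge0_integral_gauss1 mi (fun x => integral_ge0 N01 (fun y _ => f0 _))).
  apply: eq_integral => z _.
  have mx : measurable_fun [set: R] (fun y => f (a * z + b * y)%R).
    exact: (measurableT_comp mf (measurable_affine _ _)).
  have mfkz : measurable_fun [set: R] (fun w => f w * (k z w)%:E).
    by apply: emeasurable_funM => //; apply/measurable_EFinP.
  have mpz : measurable_fun [set: R] (fun y => f (a * z + b * y)%R * (pdf y)%:E) by exact: emeasurable_funM.
  rewrite (ge0_integral_affine (a * z) b0 mfkz (fun w => mul_ge0 (f0 w) (k0 z w))).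
  rewrite (ge0_integral_gauss1 mx (fun y => f0 _)).
  rewrite -(ge0_integralTZr leb mpz (fun y => mul_ge0 (f0 _) (normal_pdf_ge0 _ _ _)) (normal_pdf_ge0 _ _ _)).
  have mfka := measurableT_comp mfkz (measurable_affine (a * z)%R b).
  rewrite -(ge0_integralTZl leb mfka (fun y => mul_ge0 (f0 _) (k0 z _)) (ltW b0)).
  apply: eq_integral => y _; rewrite /= muleCA -muleA -!EFinM; congr (_ * EFin _).
  by rewrite /k addrAC subrr add0r mulrAC [(b * y)%R]mulrC mulfK ?gt_eqF//; field; rewrite gt_eqF.
rewrite (fubini_tonelli (fun z : R * R => f z.2 * (k z.1 z.2)%:E) mfk (fun z => mul_ge0 (f0 z.2) (k0 z.1 z.2))).
transitivity (\int[leb]_w (f w * (s^-1 * pdf (w / s))%:E)).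
  apply: eq_integral => w _ /=; rewrite -intk ge0_integralZl//.
  - exact/measurable_EFinP.
  - by move=> x _; rewrite lee_fin.
have mg : measurable_fun [set: R] (fun w => f w * (s^-1 * pdf (w / s))%:E).
  apply: emeasurable_funM => //; apply/measurable_EFinP; apply: measurable_funM => //.
  by apply: (measurableT_comp mpdf); exact: measurable_funM.
have g0 w : 0 <= f w * (s^-1 * pdf (w / s))%:E.
  by rewrite mul_ge0// mulr_ge0 ?normal_pdf_ge0// invr_ge0 ltW.
have mfs : measurable_fun [set: R] (fun w => f (s * w)%R).
  by apply: (measurableT_comp mf); exact: measurable_funM.
rewrite (ge0_integral_affine 0 s0 mg g0) (ge0_integral_gauss1 mfs (fun _ => f0 _)).
have mga := measurableT_comp mg (measurable_affine 0 s).
rewrite -(ge0_integralTZl leb mga (fun=> g0 _) (ltW s0)).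
apply: eq_integral => w _; rewrite /= add0r muleCA -EFinM; congr (_ * EFin _).
by rewrite mulrA mulfV ?gt_eqF// mul1r [(s * w)%R]mulrC mulfK ?gt_eqF.
Qed.

End gauss1_invariance.

Section gauss_invariance.
Variable R : realType.
Local Open Scope ereal_scope.
Notation N01 := (stdn R).

Let int0 n (f : 'rV[R]_n.+1 -> \bar R) a : (forall x, 0 <= f x) ->
  0 <= \int[gauss R n]_v f (rV_cons (a, v)).
Proof. by move=> f0; exact: integral_ge0. Qed.

Lemma measurable_rV_shift n (b : 'rV[R]_n) : measurable_fun setT (fun z => b + z)%R.
Proof. by apply: measurable_rVD => //; exact: measurable_id. Qed.

Let measurable_tilt n (i : 'I_n) h :
  measurable_fun setT (fun z : 'rV[R]_n => (expR (h * z 0 i - h ^+ 2 / 2))%:E).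
Proof.
apply/measurable_EFinP; apply: measurableT_comp => //.
apply: measurable_funB => //; apply: measurable_funM => //.
exact: measurable_coord.
Qed.

(* Cameron-Martin formula in a coordinate direction *)
Lemma gauss_shift n (i : 'I_n) (h : R) (f : 'rV[R]_n -> \bar R) :
  measurable_fun setT f -> (forall x, 0 <= f x) ->
  \int[gauss R n]_z f (h *: delta_mx 0 i + z)%R =
  \int[gauss R n]_z (f z * (expR (h * z 0 i - h ^+ 2 / 2))%:E).
Proof.
elim: n => [|n IH] in i f *; first by case: i.
move=> mf f0.
have ms : measurable_fun setT (fun z => f (h *: delta_mx 0 i + z)%R).
  exact: (measurableT_comp mf (measurable_rV_shift _)).
have mt : measurable_fun setT (fun z : 'rV[R]_n.+1 => f z * (expR (h * z 0 i - h ^+ 2 / 2))%:E).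
  by apply: emeasurable_funM; [exact: mf|exact: measurable_tilt].
have t0 (z : 'rV[R]_n.+1) : 0 <= f z * (expR (h * z 0 i - h ^+ 2 / 2))%:E.
  by rewrite mule_ge0// lee_fin expR_ge0.
rewrite (ge0_integral_gaussS ms (fun _ => f0 _)) (ge0_integral_gaussS mt t0).
case: (unliftP ord0 i) => [j|] -> in ms mt t0 *.
  apply: eq_integral => a _.
  have mfa := measurable_fun_rV_cons2 a mf.
  under [RHS]eq_integral do rewrite rV_consS.
  rewrite -(IH j _ mfa (fun _ => f0 _)); apply: eq_integral => v _.
  by rewrite rV_cons_deltaS rV_consZ rV_consD mulr0 add0r.
have G0 a := int0 a f0.
transitivity (\int[N01]_a \int[gauss R n]_v f (rV_cons ((h + a)%R, v))).
  apply: eq_integral => a _; apply: eq_integral => v _.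
  by rewrite rV_cons_delta0 rV_consZ rV_consD mulr1 scaler0 add0r.
rewrite (gauss1_shift h (measurable_integral_rV_cons (gauss R n) mf f0) G0); apply: eq_integral => a _.
rewrite -(ge0_integralTZr (gauss R n) (measurable_fun_rV_cons2 a mf) (fun=> f0 _) (expR_ge0 _)).
by apply: eq_integral => v _; rewrite rV_cons0.
Qed.

(** The probabilistic form of the semigroup law of the heat operator, by induction on the
    dimension. *)
Lemma gauss_conv n (a b : R) (f : 'rV[R]_n -> \bar R) : (0 <= a)%R -> (0 <= b)%R ->
  measurable_fun setT f -> (forall x, 0 <= f x) ->
  \int[gauss R n]_x \int[gauss R n]_y f (a *: x + b *: y)%R =
  \int[gauss R n]_x f (Num.sqrt (a ^+ 2 + b ^+ 2) *: x)%R.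
Proof.
move=> a0 b0; elim: n f => [|n IH] f mf f0.
  have e0 (g : 'rV[R]_0 -> \bar R) : \int[gauss R 0]_x g x = g 0%R.
    rewrite (eq_integral (cst (g 0%R))) ?integral_prob_cst// => x _ /=.
    by congr g; apply/rowP => -[].
  by rewrite !e0; congr f; apply/rowP => -[].
have ms : measurable_fun setT (fun z : 'rV[R]_n.+1 => f (Num.sqrt (a ^+ 2 + b ^+ 2) *: z)%R).
  by apply: (measurableT_comp mf); apply: measurable_rVZ => //; exact: measurable_id.
have mab k : measurable_fun [set: 'rV[R]_k * 'rV[R]_k] (fun z => a *: z.1 + b *: z.2)%R.
  by apply: measurable_rVD; apply: measurable_rVZ.
have mf2 := measurableT_comp mf (mab n.+1).
have mi : measurable_fun setT (fun x : 'rV[R]_n.+1 => \int[gauss R n.+1]_y f (a *: x + b *: y)%R).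
  exact: (measurable_fun_fubini_tonelli_F (fun z : 'rV[R]_n.+1 * 'rV[R]_n.+1 => f (a *: z.1 + b *: z.2)%R) mf2 (fun=> f0 _)).
rewrite (ge0_integral_gaussS mi (fun=> integral_ge0 _ (fun _ _ => f0 _))).
rewrite (ge0_integral_gaussS ms (fun=> f0 _)).
pose s := Num.sqrt (a ^+ 2 + b ^+ 2).
pose G c := \int[gauss R n]_v f (rV_cons (c, s *: v))%R.
have G0 c : 0 <= G c by exact: integral_ge0.
have mG : measurable_fun [set: R] G.
  apply: (measurable_fun_fubini_tonelli_F (fun z : R * 'rV[R]_n => f (rV_cons (z.1, s *: z.2)%R))) => //.
  apply: (measurableT_comp mf); apply: (measurableT_comp (@measurable_rV_cons R n)).
  apply/measurable_fun_pairP; split; first exact: measurable_fst.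
  by apply: measurable_rVZ => //; exact: measurable_snd.
transitivity (\int[N01]_x \int[N01]_y G (a * x + b * y)%R); last first.
  rewrite (gauss1_conv a0 b0 mG G0); apply: eq_integral => x _.
  by apply: eq_integral => v _; rewrite rV_consZ.
apply: eq_integral => x _.
have mK : measurable_fun [set: ('rV[R]_n * R) * 'rV[R]_n]
    (fun z => f (rV_cons ((a * x + b * z.1.2)%R, (a *: z.1.1 + b *: z.2)%R))).
  apply: (measurableT_comp mf); apply: (measurableT_comp (@measurable_rV_cons R n)).
  have m1 := @measurable_fst _ _ ('rV[R]_n * R)%type 'rV[R]_n.
  apply/measurable_fun_pairP; split.
    apply: (measurableT_comp (measurable_affine (a * x)%R b)).
    exact: (measurableT_comp measurable_snd m1).
  apply: measurable_rVD; apply: measurable_rVZ => //.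
  exact: (measurableT_comp measurable_fst m1).
pose K (z : 'rV[R]_n * R) :=
  \int[gauss R n]_w f (rV_cons ((a * x + b * z.2)%R, (a *: z.1 + b *: w)%R)).
have mKi : measurable_fun setT K.
  exact: (measurable_fun_fubini_tonelli_F _ mK (fun=> f0 _)).
(* The integrals run over the head and tail of the first vector, then over those of the second.
   Exchanging the tail [v] with the head [y] makes both tails innermost, where the induction
   hypothesis applies; the heads are left to [gauss1_conv]. *)
transitivity (\int[gauss R n]_v \int[N01]_y K (v, y)).
  apply: eq_integral => v _.
  have mfx : measurable_fun setT (fun y : 'rV[R]_n.+1 => f (a *: rV_cons (x, v) + b *: y)%R).
    by apply: (measurableT_comp mf); exact: measurable_rV_affine.
  rewrite (ge0_integral_gaussS mfx (fun=> f0 _)).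
  apply: eq_integral => y _; apply: eq_integral => w _.
  by rewrite rV_consZ rV_consZD.
rewrite (fubini_tonelli K mKi (fun=> integral_ge0 _ (fun _ _ => f0 _))).
apply: eq_integral => y _; rewrite /K/=.
exact: (IH _ (measurable_fun_rV_cons2 _ mf) (fun=> f0 _)).
Qed.

End gauss_invariance.

Section ftc_tools.
Variable R : realType.
Notation mu := (@lebesgue_measure R).

Lemma derivable_oo_LR (F : R -> R) a b : (forall x, derivable F x 1) ->
  derivable_oo_LRcontinuous F a b.
Proof.
move=> dF; have cF x : {for x, continuous F}.
  exact/differentiable_continuous/derivable1_diffP/dF.
split; first by move=> x _; exact: dF.
- by apply: cvg_at_right_filter; exact: cF.
- by apply: cvg_at_left_filter; exact: cF.
Qed.

Lemma integral_is_derive (F f : R -> R) (a b : R) : a <= b ->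
  (forall x : R, is_derive x (1 : R) F (f x)) -> continuous f ->
  (\int[mu]_(x in `[a, b]) (f x)%:E = (F b - F a)%:E)%E.
Proof.
move=> ab dF cf; move: ab; rewrite le_eqVlt => /predU1P[->|ab].
  by rewrite set_itv1 integral_set1 subrr.
rewrite (continuous_FTC2 ab (F := F))//.
- exact: continuous_subspaceT.
- apply: derivable_oo_LR => x; exact: ex_derive.
- by move=> x _; rewrite derive1E; apply: derive_val.
Qed.

Lemma Rintegral_is_derive (F f : R -> R) (a b : R) : a <= b ->
  (forall x : R, is_derive x (1 : R) F (f x)) -> continuous f ->
  \int[mu]_(x in `[a, b]) f x = F b - F a.
Proof. by move=> ab dF cf; rewrite /Rintegral (integral_is_derive ab dF cf). Qed.

Lemma continuous_itv_integrable (f : R -> R) (a b : R) : continuous f ->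
  mu.-integrable `[a, b] (EFin \o f).
Proof.
move=> cf; apply: continuous_compact_integrable; first exact: segment_compact.
exact: continuous_subspaceT.
Qed.

End ftc_tools.

(** * Measurability of continuous functions *)

Section discretization.

(* [F k z] runs through a countable set and tends to [z]; rounding to a grid
   thus makes continuous functions measurable for the product sigma-algebra. *)
Lemma measurable_discretized d (T : measurableType d) (R : realType)
    (D : nat -> T -> T) (f : T -> R) :
  (forall k, countable (range (D k))) ->
  (forall k v, measurable (D k @^-1` [set v])) ->
  (forall x, f (D k x) @[k --> \oo] --> f x) ->
  measurable_fun setT f.
Proof.
move=> cD mD fD; apply: (@measurable_fun_cvg _ _ _ _ (fun k => f \o D k)).
  move=> k _ Y mY; rewrite setTI.
  have -> : (f \o D k) @^-1` Y = \bigcup_(v in range (D k) `&` f @^-1` Y) (D k @^-1` [set v]).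
    apply/seteqP; split => [x Yx|x [v [_ Yv] /= Dxv]]; last by rewrite /= Dxv.
    by exists (D k x) => //; split => //; exists x.
  have cV : countable (range (D k) `&` f @^-1` Y).
    exact: sub_countable (subset_card_le (@subIsetl _ _ _)) (cD k).
  (* An injection of the countable set of values into [nat] turns the union into one indexed by
     [nat]. *)
  have /countable_injP[g ginj] := cV.
  have [V0|/set0P[v0 _]] := eqVneq (range (D k) `&` f @^-1` Y) set0.
    by rewrite V0 bigcup_set0.
  rewrite -(injpinv_image (cst v0) ginj) bigcup_image.
  by apply: bigcup_measurable => i _; exact: mD.
by move=> x _; exact: fD.
Qed.

Variable R : realType.

Definition grid (k : nat) (t : R) : R := (Num.floor (t * k.+1%:R))%:~R / k.+1%:R.

Lemma grid_cvg t : grid k t @[k --> \oo] --> t.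
Proof.
apply/cvgrPdist_le => e e0; near=> k.
rewrite /grid; set m := k.+1%:R.
have m0 : 0 < m :> R by rewrite ltr0n.
have /andP[f1 f2] := floor_itv (t * m).
have -> : t - (Num.floor (t * m))%:~R / m = (t * m - (Num.floor (t * m))%:~R) / m.
  by rewrite mulrBl mulfK// gt_eqF.
rewrite ger0_norm ?divr_ge0 ?subr_ge0 ?(ltW m0)//.
rewrite (@le_trans _ _ m^-1)//; last first.
  rewrite {f1 f2 m0}/m; near: k; have := @cvg_harmonic R => /cvgrPdist_le/(_ _ e0).
  by apply: filterS => k; rewrite sub0r normrN ger0_norm ?harmonic_ge0.
rewrite ler_pdivrMr// mulVf ?gt_eqF// lerBlDr ltW//.
by rewrite addrC -[1]/(1%:~R) -intrD.
Unshelve. all: by end_near. Qed.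

Lemma measurable_grid1 k v : measurable (grid k @^-1` [set v]).
Proof.
pose m : R := k.+1%:R; have m0 : 0 < m :> R by rewrite ltr0n.
have [[j vj]|nv] := pselect (exists j : int, v = j%:~R / m); last first.
  rewrite (_ : _ @^-1` _ = set0)//; apply/seteqP; split => // t /= gv.
  by apply: nv; exists (Num.floor (t * m)).
rewrite (_ : _ @^-1` _ = `[j%:~R / m, (j + 1)%:~R / m[%classic)//.
apply/seteqP; split => t /=; rewrite in_itv/= /grid -/m vj.
  have minj : injective (fun x : R => x / m).
    by apply: mulIf; rewrite invr_eq0 gt_eqF.
  move=> /minj/intr_inj <-; have /andP[h1 h2] := floor_itv (t * m).
  by rewrite ler_pdivrMr// h1/= ltr_pdivlMr.
rewrite ler_pdivrMr// ltr_pdivlMr// => h.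
by congr (_%:~R / _); apply: floor_def.
Qed.

Lemma countable_grid k : countable (range (grid k)).
Proof.
have -> : range (grid k) = (fun j : int => j%:~R / k.+1%:R) @` range (fun t => Num.floor (t * k.+1%:R : R)).
  by rewrite image_comp.
apply: (sub_countable (card_image_le _ _)); exact: countableP.
Qed.

Definition gridrV n k (x : 'rV[R]_n) : 'rV[R]_n := \row_i grid k (x 0 i).

Lemma gridrV_cvg n (x : 'rV[R]_n) : gridrV k x @[k --> \oo] --> x.
Proof.
apply/cvg_ballP => e e0.
have : \forall k \near \oo, forall i : 'I_n, ball (x 0 i) e (grid k (x 0 i)).
  by apply: filter_forall => i; have /cvg_ballP/(_ e e0) := @grid_cvg (x 0 i).
apply: filterS => k xk; split => // i j; rewrite ord1 mxE; exact: xk.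
Qed.

Lemma measurable_gridrV1 n k v : measurable (@gridrV n k @^-1` [set v]).
Proof.
rewrite (_ : _ @^-1` _ = \bigcap_(i in [set: 'I_n]) ((fun x : 'rV[R]_n => x 0 i) @^-1` (grid k @^-1` [set v 0 i]))).
  apply: fin_bigcap_measurable => // i _; rewrite -[X in measurable X]setTI.
  by apply: measurable_coord => //; exact: measurable_grid1.
apply/seteqP; split => [x /= <- i _/=|x /= xv]; first by rewrite mxE.
by apply/rowP => i; rewrite mxE; exact: xv.
Qed.

Lemma countable_gridrV n k : countable (range (@gridrV n k)).
Proof.
have -> : range (@gridrV n k) =
  (fun w : 'rV[int]_n => \row_i ((w 0 i)%:~R / k.+1%:R)) @` range (fun x : 'rV[R]_n => \row_i (Num.floor (x 0 i * k.+1%:R))).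
  rewrite image_comp; congr (_ @` _); apply/funext => x; apply/rowP => i.
  by rewrite !mxE.
apply: (sub_countable (card_image_le _ _)); exact: countableP.
Qed.

Lemma continuous_measurable_rV n (f : 'rV[R]_n -> R) :
  continuous f -> measurable_fun setT f.
Proof.
move=> cf; apply: (@measurable_discretized _ _ _ (@gridrV n)).
- exact: countable_gridrV.
- exact: measurable_gridrV1.
- by move=> x; exact: (cvg_comp _ _ (@gridrV_cvg n x) (cf x)).
Qed.

Lemma continuous_measurable_rVR n (f : 'rV[R]_n * R -> R) :
  continuous f -> measurable_fun setT f.
Proof.
move=> cf; apply: (@measurable_discretized _ _ _ (fun k z => (gridrV k z.1, grid k z.2))).
- move=> k; have := countableX (@countable_gridrV n k) (countable_grid k).
  apply: sub_countable; apply: subset_card_le => _ [z _ <-]/=.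
  by split; [exists z.1|exists z.2].
- move=> k v.
  rewrite (_ : _ @^-1` _ = (@gridrV n k @^-1` [set v.1]) `*` (grid k @^-1` [set v.2])).
    by apply: measurableX; [exact: measurable_gridrV1|exact: measurable_grid1].
  by apply/seteqP; split => z /=; [move=> <-|case=> -> ->; case: v].
- move=> [x t]; exact: (cvg_comp _ _ (cvg_pair (@gridrV_cvg n x) (@grid_cvg t)) (cf (x, t))).
Qed.

Lemma continuous_measurable_RR (f : R * R -> R) :
  continuous f -> measurable_fun setT f.
Proof.
move=> cf; apply: (@measurable_discretized _ _ _ (fun k z => (grid k z.1, grid k z.2))).
- move=> k; have := countableX (countable_grid k) (countable_grid k).
  apply: sub_countable; apply: subset_card_le => _ [z _ <-]/=.
  by split; [exists z.1|exists z.2].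
- move=> k v.
  rewrite (_ : _ @^-1` _ = (grid k @^-1` [set v.1]) `*` (grid k @^-1` [set v.2])).
    by apply: measurableX; exact: measurable_grid1.
  by apply/seteqP; split => z /=; [move=> <-|case=> -> ->; case: v].
- move=> [x t]; exact: (cvg_comp _ _ (cvg_pair (@grid_cvg x) (@grid_cvg t)) (cf (x, t))).
Qed.

End discretization.

(** * Integration along segments *)

Section convergence_tools.
Variable R : realType.

(** Dominated convergence speaks of sequences; this criterion transports it to continuity in a
    parameter. If the limit failed, a sequence of bad points within [1 / (k + 1)] of [p] would
    contradict the hypothesis. *)
Lemma cvg_seqP (V : pseudoMetricType R) (f : V -> R) (p : V) (l : R) :
  (forall u : nat -> V, u k @[k --> \oo] --> p -> f (u k) @[k --> \oo] --> l) ->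
  f x @[x --> p] --> l.
Proof.
move=> fl; apply: contrapT => nfl.
have [e [e0 ne]] : exists e : R, 0 < e /\ forall k : nat, exists x,
    ball p (k.+1%:R^-1) x /\ e <= `|l - f x|.
  apply: contrapT => /forallNP H; apply: nfl; apply/cvgrPdist_lt => e e0.
  have /not_andP[//|/existsNP[k /forallNP Hk]] := H e.
  apply/nbhs_ballP; exists (k.+1%:R^-1) => /=; first by rewrite invr_gt0.
  by move=> x px; have /not_andP[//|/negP] := Hk x; rewrite -ltNge.
have [u uP] := choice ne.
have up : u k @[k --> \oo] --> p.
  apply/cvg_ballP => d d0; near=> k.
  apply: (@le_ball _ _ _ k.+1%:R^-1); last by have [] := uP k.
  near: k; have := @cvg_harmonic R => /cvgrPdist_le/(_ _ d0).
  by apply: filterS => k; rewrite sub0r normrN ger0_norm ?harmonic_ge0.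
have /cvgrPdist_lt/(_ _ e0)[N _ /(_ N (leqnn N))] := fl u up.
by have [_] := uP N; rewrite leNgt => /negP.
Unshelve. all: by end_near. Qed.

Section under_integral.
Context d (T : measurableType d) (mu : {measure set T -> \bar R}).
Variables (D : set T) (mD : measurable D) (g : T -> R).
Hypothesis ig : mu.-integrable D (EFin \o g).

Lemma integrable_dominated (f : T -> R) : measurable_fun D f ->
  (forall x, D x -> `|f x| <= g x) -> mu.-integrable D (EFin \o f).
Proof.
move=> mf fg; apply: (le_integrable mD _ _ ig); first exact/measurable_EFinP.
by move=> x Dx /=; rewrite lee_fin (le_trans (fg _ Dx))// ler_norm.
Qed.

Lemma cvg_Rintegral_dominated (f_ : nat -> T -> R) (f : T -> R) :
  (forall k, measurable_fun D (f_ k)) ->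
  (forall x, D x -> f_ k x @[k --> \oo] --> f x) ->
  (forall k x, D x -> `|f_ k x| <= g x) ->
  \int[mu]_(x in D) f_ k x @[k --> \oo] --> \int[mu]_(x in D) f x.
Proof.
move=> mf ff fg.
have mlim : measurable_fun D f by apply: (measurable_fun_cvg mf) => x Dx; exact: ff.
have fg' x : D x -> `|f x| <= g x.
  move=> Dx; apply: (ler_cvg_to (cvg_norm (ff x Dx)) (cvg_cst (g x))).
  by apply: nearW => k; exact: fg.
have if_ k := integrable_dominated (mf k) (fg k).
have if0 := integrable_dominated mlim fg'.
apply: fine_cvg; rewrite fineK; last exact: integrable_fin_num.
apply: (@dominated_cvg _ _ _ mu D mD (fun k x => (f_ k x)%:E) (EFin \o f) (EFin \o g)) => //.
- by move=> k; apply/measurable_EFinP.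
- by move=> x Dx; apply: cvg_EFin; [exact: nearW|exact: ff].
Qed.

Lemma continuous_Rintegral (V : pseudoMetricType R) (F : V -> T -> R) :
  (forall x, measurable_fun D (F x)) ->
  (forall z, D z -> continuous (F ^~ z)) ->
  (forall x z, D z -> `|F x z| <= g z) ->
  continuous (fun x => \int[mu]_(z in D) F x z).
Proof.
move=> mF cF Fg p; apply: cvg_seqP => u up.
apply: cvg_Rintegral_dominated => [//|z Dz|k z]; last exact: Fg.
exact: (cvg_comp _ _ up (cF z Dz p)).
Qed.

End under_integral.

Lemma integral_leb D (f : R -> \bar R) : measurable D -> measurable_fun D f ->
  (\int[leb R]_(x in D) f x = \int[lebesgue_measure]_(x in D) f x)%E.
Proof.
move=> mD mf; rewrite [LHS]integralE [RHS]integralE; congr (_ - _)%E.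
  by apply: ge0_integral_leb => //; exact: measurable_funepos.
by apply: ge0_integral_leb => //; exact: measurable_funeneg.
Qed.

Lemma Rintegral_leb D (f : R -> R) : measurable D -> measurable_fun D f ->
  \int[leb R]_(x in D) f x = \int[lebesgue_measure]_(x in D) f x.
Proof. by move=> mD mf; rewrite /Rintegral integral_leb//; exact/measurable_EFinP. Qed.

Lemma continuous_itv_integrable_leb (f : R -> R) (a b : R) : continuous f ->
  (leb R).-integrable `[a, b] (EFin \o f).
Proof.
move=> cf; have /integrableP[mf foo] := continuous_itv_integrable a b cf.
apply/integrableP; split; first exact: mf.
have ma : measurable_fun `[a, b] (abse \o (EFin \o f)) by exact: measurableT_comp.
have mI : measurable (`[a, b] : set R) by exact: measurable_itv.
by rewrite (ge0_integral_leb mI ma (fun _ => abse_ge0 _)).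
Qed.

(** Fubini on [D] times a segment. The bound [C], uniform in [s], makes the kernel integrable on the
    product; it is first extended by zero, so that Fubini is applied on the whole product space. *)
Lemma Rintegral_swap d (T : measurableType d) (mu : {sigma_finite_measure set T -> \bar R})
    (D : set T) (K : T -> R -> R) (a b C : R) : measurable D ->
  measurable_fun setT (fun z => K z.1 z.2) ->
  (forall x, D x -> (leb R).-integrable `[a, b] (EFin \o K x)) ->
  (forall s, a <= s <= b -> (\int[mu]_(x in D) (`|K x s|)%:E <= C%:E)%E) ->
  \int[mu]_(x in D) \int[leb R]_(s in `[a, b]) K x s =
  \int[leb R]_(s in `[a, b]) \int[mu]_(x in D) K x s.
Proof.
move=> mD mK iK KC; pose I : set R := `[a, b]%classic.
have mI : measurable I by exact: measurable_itv.
have mKE : measurable_fun setT (fun z : T * R => (K z.1 z.2)%:E) by exact/measurable_EFinP.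
pose k := (fun z : T * R => (K z.1 z.2)%:E) \_ (D `*` I).
have mk : measurable_fun setT k.
  apply: (measurable_restrictT _ (measurableX mD mI)).1.
  exact: measurable_funTS.
have mKx x : measurable_fun setT (K x) by exact: (measurableT_comp mK (pair1_measurable x)).
have mKs s : measurable_fun setT (K ^~ s) by exact: (measurableT_comp mK (pair2_measurable s)).
have kE x s : k (x, s) = if (x \in D) && (s \in I) then (K x s)%:E else 0%E.
  by rewrite /k patchE in_setX.
have k1 x : (\int[leb R]_s k (x, s) = if x \in D then \int[leb R]_(s in I) (K x s)%:E else 0)%E.
  case: ifPn => xD.
    rewrite [RHS]integral_mkcond; apply: eq_integral => s _.
    by rewrite kE xD patchE.
  by apply: integral0_eq => s _; rewrite kE (negbTE xD).
have k2 s : (\int[mu]_x k (x, s) = if s \in I then \int[mu]_(x in D) (K x s)%:E else 0)%E.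
  case: ifPn => sI.
    rewrite [RHS]integral_mkcond; apply: eq_integral => x _.
    by rewrite kE sI andbT patchE.
  by apply: integral0_eq => x _; rewrite kE (negbTE sI) andbF.
have iKs s : I s -> mu.-integrable D (EFin \o K ^~ s).
  rewrite /I/= in_itv/= => sI; apply/integrableP; split.
    exact/measurable_EFinP/measurable_funTS.
  by apply: (le_lt_trans (KC s sI)); rewrite ltry.
have mak : measurable_fun setT (abse \o k) by exact: measurableT_comp.
have ik : (mu \x leb R)%E.-integrable setT k.
  apply/(integrable21ltyP mu (leb R) mk).
  apply: (@le_lt_trans _ _ (\int[leb R]_(s in I) C%:E)%E).
    rewrite [leRHS]integral_mkcond; apply: ge0_le_integral => //.
    - by move=> s _; exact: integral_ge0.
    - exact: (measurable_fun_fubini_tonelli_G (abse \o k) mak (fun=> abse_ge0 _)).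
    - by apply: (measurable_restrictT _ mI).1; exact: measurable_cst.
    - move=> s _; rewrite patchE; case: ifPn => sI.
        have sI' : a <= s <= b by move: sI; rewrite inE /I/= in_itv.
        rewrite (le_trans _ (KC s sI'))// [leRHS]integral_mkcond.
        apply: ge0_le_integral => //.
        + exact: (measurableT_comp mak (pair2_measurable s)).
        + apply: (measurable_restrictT _ mD).1; apply/measurable_EFinP.
          by apply: measurableT_comp => //; exact: measurable_funTS.
        + move=> x _; rewrite kE sI andbT patchE; case: ifP => //= _.
          by rewrite normr0.
      by rewrite integral0_eq// => x _; rewrite kE (negbTE sI) andbF abse0.
  have := integrable_fin_num mI (continuous_itv_integrable_leb a b (@cst_continuous _ _ C)).
  by rewrite fin_numElt => /andP[_].
rewrite {1}/Rintegral.
transitivity (fine (\int[mu]_x \int[leb R]_s k (x, s))%E).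
  congr fine; rewrite integral_mkcond; apply: eq_integral => x _.
  rewrite k1 patchE; case: ifPn => // /set_mem xD.
  by rewrite fineK//; exact: integrable_fin_num (iK _ xD).
rewrite (Fubini ik) [in RHS]/Rintegral; congr fine.
rewrite [RHS]integral_mkcond; apply: eq_integral => s _.
rewrite k2 patchE; case: ifPn => // /set_mem sI.
by rewrite fineK//; exact: integrable_fin_num (iKs _ sI).
Qed.
End convergence_tools.

Lemma Rintegral_leb_cst (R : realType) (a b r : R) : a <= b ->
  \int[leb R]_(s in `[a, b]) r = (b - a) * r.
Proof.
move=> ab; rewrite Rintegral_leb; [|exact: measurable_itv|exact: measurable_cst].
rewrite Rintegral_cst; last exact: measurable_itv.
have := @lebesgue_measure_itv R `[a, b]; rewrite /= lte_fin => E.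
transitivity (r * fine (if a < b then (b%:E - a%:E)%E else 0%E)); first by rewrite -E.
by move: ab; rewrite le_eqVlt => /predU1P[->|->]; rewrite ?ltxx ?subrr ?mulr0 ?mul0r// -EFinB mulrC.
Qed.

Lemma cvg_comp2 (X A B C : topologicalType) (a : X -> A) (b : X -> B)
    (F : A -> B -> C) (p : X) : continuous (fun q => F q.1 q.2) ->
  a y @[y --> p] --> a p -> b y @[y --> p] --> b p ->
  F (a y) (b y) @[y --> p] --> F (a p) (b p).
Proof.
move=> cF ca cb.
exact: (cvg_comp (fun y => (a y, b y)) (fun q => F q.1 q.2) (cvg_pair ca cb) (cF (a p, b p))).
Qed.

Lemma continuous_fix2 (A B C : topologicalType) (F : A -> B -> C) (s : B) :
  continuous (fun q => F q.1 q.2) -> continuous (F ^~ s).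
Proof.
move=> cF x; apply: (cvg_comp2 (a := id) (b := cst s) cF); first exact: cvg_id.
exact: cvg_cst.
Qed.

Lemma continuous_fix1 (A B C : topologicalType) (F : A -> B -> C) (x : A) :
  continuous (fun q => F q.1 q.2) -> continuous (F x).
Proof.
move=> cF s; apply: (cvg_comp2 (a := cst x) (b := id) cF); last exact: cvg_id.
exact: cvg_cst.
Qed.

(** * Weighted Gaussian averages and the shift identity *)

Section gauss_averages.
Variables (R : realType) (n : nat).
Implicit Types (x z : 'rV[R]_n) (f F w : 'rV[R]_n -> R) (i : 'I_n) (c h : R).
Notation G := (gauss R n).
Notation ee i := (delta_mx 0 i : 'rV[R]_n).

Lemma gauss_integrable_cst (r : R) : G.-integrable setT (fun=> r%:E).
Proof. exact: finite_measure_integrable_cst. Qed.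

Lemma gauss_integrable_bounded f (M : R) : measurable_fun setT f ->
  (forall z, `|f z| <= M) -> G.-integrable setT (EFin \o f).
Proof.
move=> mf fM; apply: (integrable_dominated measurableT (gauss_integrable_cst M) mf).
by move=> z _; exact: fM.
Qed.

Lemma gauss_cst (r : R) : \int[G]_z r = r.
Proof. by rewrite /Rintegral integral_prob_cst. Qed.

Lemma gauss_le_norm f (M : R) : measurable_fun setT f ->
  (forall z, `|f z| <= M) -> `|\int[G]_z f z| <= M.
Proof.
move=> mf fM; have if_ := gauss_integrable_bounded mf fM.
apply: (le_trans (le_normr_Rintegral measurableT if_)).
rewrite -[leRHS]gauss_cst; apply: le_Rintegral => //.
- exact: integrable_norm.
- exact: gauss_integrable_cst.
Qed.

Let max_mul (r s : R) : 0 <= s -> (maxe (r * s)%:E 0 = maxe r%:E 0 * s%:E)%E.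
Proof.
by move=> s0; rewrite -!EFin_max -EFinM maxr_pMl// mul0r.
Qed.

(** Positive and negative parts are treated separately; multiplying by a nonnegative exponential
    commutes with taking either part. *)
Lemma gauss_shiftR i h f : measurable_fun setT f ->
  (\int[G]_z (f (h *: ee i + z))%:E =
   \int[G]_z (f z * expR (h * z 0 i - h ^+ 2 / 2))%:E)%E.
Proof.
move=> mf; have mfE : measurable_fun setT (EFin \o f) by exact/measurable_EFinP.
rewrite [LHS]integralE [RHS]integralE; congr (_ - _)%E.
  transitivity (\int[G]_z (EFin \o f)^\+ (h *: ee i + z)%R)%E.
    by apply: eq_integral => z _; rewrite !funeposE.
  rewrite (gauss_shift i h (measurable_funepos mfE) (funepos_ge0 _)).
  by apply: eq_integral => z _; rewrite !funeposE/= max_mul ?expR_ge0.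
transitivity (\int[G]_z (EFin \o f)^\- (h *: ee i + z)%R)%E.
    by apply: eq_integral => z _; rewrite !funenegE.
  rewrite (gauss_shift i h (measurable_funeneg mfE) (funeneg_ge0 _)).
by apply: eq_integral => z _; rewrite !funenegE/= -(mulNr (f z)) max_mul ?expR_ge0.
Qed.

(** The tilts [exp (h * z_i - h ^ 2 / 2)] have integral [1], by the shift formula for the constant
    [1]. The inequality [exp y >= 1 + y] for [h = 1] and [h = -1] bounds the absolute value of the
    coordinate by the sum of the two tilts. *)
Lemma gauss_integrable_coord i : G.-integrable setT (fun z => (z 0 i)%:E).
Proof.
pose E (h : R) (z : 'rV[R]_n) := expR (h * z 0 i - h ^+ 2 / 2).
have mE h : measurable_fun setT (E h).
  apply: measurableT_comp => //; apply: measurable_funB => //.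
  by apply: measurable_funM => //; exact: measurable_coord.
have iE h : G.-integrable setT (EFin \o E h).
  apply/integrableP; split; first exact/measurable_EFinP.
  have m1 : measurable_fun setT (cst 1 : 'rV[R]_n -> R) by exact: measurable_cst.
  have -> : (\int[G]_z `|(EFin \o E h) z| = \int[G]_z (cst 1%R z * E h z)%:E)%E.
    by apply: eq_integral => z _; rewrite /= ger0_norm ?expR_ge0// mul1r.
  by rewrite -(gauss_shiftR i h m1) [X in (X < _)%E](integral_prob_cst G 1%:E) ltry.
apply: (integrable_dominated measurableT (integrableD measurableT (iE 1) (iE (-1))) (measurable_coord i)) => z _.
have := expR_ge1Dx (1 * z 0 i - 1 ^+ 2 / 2); have := expR_ge1Dx (-1 * z 0 i - (-1) ^+ 2 / 2).
have := expR_ge0 (1 * z 0 i - 1 ^+ 2 / 2); have := expR_ge0 (-1 * z 0 i - (-1) ^+ 2 / 2).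
rewrite /E; move: (expR _) (expR _) => u w; rewrite sqrrN expr1n mul1r mulN1r => *.
by rewrite ler_norml; apply/andP; split; lra.
Qed.

(** Adding the bound [M] makes the integrand nonnegative, where [gauss_conv] applies; the constant
    cancels in the end. *)
Lemma gauss_convR a b f (M : R) : 0 <= a -> 0 <= b -> measurable_fun setT f ->
  (forall z, `|f z| <= M) ->
  \int[G]_x \int[G]_y f (a *: x + b *: y) =
  \int[G]_x f (Num.sqrt (a ^+ 2 + b ^+ 2) *: x).
Proof.
move=> a0 b0 mf fM.
have mfM : measurable_fun setT (fun z => (f z + M)%:E).
  by apply/measurable_EFinP; exact: measurable_funD.
have fM0 z : (0 <= (f z + M)%:E)%E.
  by rewrite lee_fin; have := fM z; rewrite ler_norml => /andP[+ _]; rewrite -lerBlDr sub0r.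
have mZ s : measurable_fun setT (fun z => f (s *: z)).
  by apply: (measurableT_comp mf); apply: measurable_rVZ => //; exact: measurable_id.
have mab : measurable_fun setT (fun z : 'rV[R]_n * 'rV[R]_n => f (a *: z.1 + b *: z.2)).
  by apply: (measurableT_comp mf); apply: measurable_rVD; apply: measurable_rVZ.
have mabx x : measurable_fun setT (fun y : 'rV[R]_n => f (a *: x + b *: y)).
  by apply: (measurableT_comp mf); exact: measurable_rV_affine.
have iy x : G.-integrable setT (EFin \o (fun y : 'rV[R]_n => f (a *: x + b *: y))).
  exact: gauss_integrable_bounded (mabx x) (fun=> fM _).
have ic := gauss_integrable_cst M.
have Ey x : (\int[G]_y (f (a *: x + b *: y) + M)%:E = (\int[G]_y f (a *: x + b *: y) + M)%:E)%E.
  rewrite -[X in (_ + X)%:E]gauss_cst -RintegralD// /Rintegral fineK//.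
  apply: integrable_fin_num => //.
  exact: (@integrableD _ _ _ _ _ measurableT _ _ (iy x) ic).
have mE : measurable_fun setT (fun x : 'rV[R]_n => \int[G]_y f (a *: x + b *: y)).
  have := measurable_fun_fubini_tonelli_F (m2 := G) (fun z : 'rV[R]_n * 'rV[R]_n => (f (a *: z.1 + b *: z.2) + M)%:E).
  move=> /(_ _ (fun=> fM0 _)).
  have m1 : measurable_fun setT (fun z : 'rV[R]_n * 'rV[R]_n => (f (a *: z.1 + b *: z.2) + M)%:E).
    by apply/measurable_EFinP; exact: measurable_funD.
  move=> /(_ m1); rewrite /fubini_F/=.
  under eq_fun do rewrite Ey.
  move=> /measurable_EFinP mEM.
  have := measurable_funB mEM (measurable_cst M).
  by apply: eq_measurable_fun => x _ /=; rewrite addrK.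
have bE x : `|\int[G]_y f (a *: x + b *: y)| <= M by exact: gauss_le_norm.
have := gauss_conv a0 b0 mfM fM0.
under eq_integral do rewrite Ey.
move=> /(congr1 fine); rewrite -/(Rintegral _ _ _) -/(Rintegral _ _ _).
have iE := gauss_integrable_bounded mE bE.
have iZ := gauss_integrable_bounded (mZ (Num.sqrt (a ^+ 2 + b ^+ 2))) (fun=> fM _).
rewrite (RintegralD measurableT iE ic) (RintegralD measurableT iZ ic).
by rewrite gauss_cst => /addIr.
Qed.

(** One operator for the semigroup and its gradient: weight [1] and [c = sqrt (2 * t)] give the heat
    average, and the weight [z_i] gives [c] times its [i]-th partial derivative. *)
Definition avgw w F x c : R := \int[G]_z (w z * F (x + c *: z)).

Lemma measurable_avgw w F x c : measurable_fun setT w -> measurable_fun setT F ->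
  measurable_fun setT (fun z => w z * F (x + c *: z)).
Proof.
move=> mw mF; apply: measurable_funM => //.
exact: (measurableT_comp mF (measurable_rV_affine x c)).
Qed.

Lemma avgw_integrable w F (M : R) x c : measurable_fun setT w ->
  G.-integrable setT (EFin \o w) -> measurable_fun setT F ->
  (forall z, `|F z| <= M) ->
  G.-integrable setT (EFin \o (fun z => w z * F (x + c *: z))).
Proof.
move=> mw iw mF FM.
have iwM : G.-integrable setT (EFin \o (fun z => M * `|w z|)).
  exact: (integrableZl measurableT M (integrable_norm iw)).
apply: (integrable_dominated measurableT iwM (measurable_avgw x c mw mF)) => z _.
by rewrite normrM mulrC ler_wpM2r.
Qed.

Lemma avgw_le w F (M : R) x c : measurable_fun setT w ->
  G.-integrable setT (EFin \o w) -> measurable_fun setT F ->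
  (forall z, `|F z| <= M) -> `|avgw w F x c| <= M * \int[G]_z `|w z|.
Proof.
move=> mw iw mF FM.
have i1 := avgw_integrable x c mw iw mF FM.
apply: (le_trans (le_normr_Rintegral measurableT i1)).
rewrite -RintegralZl//; last exact: integrable_norm.
apply: le_Rintegral => //.
- exact: integrable_norm.
- exact: (integrableZl measurableT M (integrable_norm iw)).
- by move=> z _; rewrite normrM mulrC ler_wpM2r.
Qed.

Lemma avgw_continuous w (F : 'rV[R]_n -> R -> R) (M : R) : measurable_fun setT w ->
  G.-integrable setT (EFin \o w) -> continuous (fun q => F q.1 q.2) ->
  (forall z s, `|F z s| <= M) ->
  continuous (fun q : 'rV[R]_n * R * R => avgw w (F ^~ q.2) q.1.1 q.1.2).
Proof.
move=> mw iw cF FM.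
have iwM : G.-integrable setT (EFin \o (fun z => M * `|w z|)).
  exact: (integrableZl measurableT M (integrable_norm iw)).
apply: (continuous_Rintegral measurableT iwM) => [q|z _|q z _].
- have mFq : measurable_fun setT (F ^~ q.2).
    exact: (continuous_measurable_rV (continuous_fix2 cF)).
  exact: (measurable_avgw q.1.1 q.1.2 mw mFq).
- move=> q; apply: cvgMl_tmp.
  have c1 : p.1 @[p --> q] --> q.1 by exact: cvg_fst.
  have c2 : p.1.1 + p.1.2 *: z @[p --> q] --> q.1.1 + q.1.2 *: z.
    apply: cvgD; first exact: (cvg_comp _ _ c1 cvg_fst).
    by apply: cvgZr_tmp; exact: (cvg_comp _ _ c1 cvg_snd).
  apply: (cvg_comp2 (a := fun p : 'rV[R]_n * R * R => p.1.1 + p.1.2 *: z) (b := snd) cF c2).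
  exact: cvg_snd.
- by rewrite normrM mulrC ler_wpM2r.
Qed.

Definition coordw i : 'rV[R]_n -> R := fun z => z 0 i.

(** The translation by [s] along the axis is moved onto the Gaussian weight as a tilt [E s], which
    is smooth in [s] whatever [F] is. Integrating its derivative over [[0, h]], exchanging the
    integrals and undoing the tilt yields the right-hand side: a derivative in [x] without any
    derivative of [F]. *)
Let avg_shift_gt0 i F (M : R) x h c : 0 <= h -> 0 < c ->
  continuous F -> (forall z, `|F z| <= M) ->
  c * (avgw (cst 1) F (x + h *: ee i) c - avgw (cst 1) F x c) =
  \int[leb R]_(s in `[0, h]) avgw (coordw i) F (x + s *: ee i) c.
Proof.
move=> h0 c0 cF FM; have mF := continuous_measurable_rV cF.
pose g z := F (x + c *: z).
have mg : measurable_fun setT g by exact: (measurableT_comp mF (measurable_rV_affine x c)).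
have gM z : `|g z| <= M by exact: FM.
pose E s z := expR (s / c * z 0 i - (s / c) ^+ 2 / 2).
have mE s : measurable_fun setT (E s).
  apply: measurableT_comp => //; apply: measurable_funB => //.
  by apply: measurable_funM => //; exact: measurable_coord.
have E0 s z : 0 <= E s z by exact: expR_ge0.
have absE s f : measurable_fun setT f ->
    (\int[G]_z `|f z * E s z|%:E = \int[G]_z `|f (s / c *: ee i + z)|%:E)%E.
  move=> mf; have mnf : measurable_fun setT (fun z => `|f z|) by exact: measurableT_comp.
  rewrite (gauss_shiftR i (s / c) mnf).
  by apply: eq_integral => z _; rewrite normrM (ger0_norm (E0 s z)).
have igE s : G.-integrable setT (EFin \o (fun z => g z * E s z)).
  apply/integrableP; split; first by apply/measurable_EFinP; exact: measurable_funM.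
  rewrite [ltLHS](absE s g mg).
  apply: (@le_lt_trans _ _ (\int[G]_z M%:E)%E); last by rewrite integral_prob_cst ltry.
  apply: ge0_le_integral => //.
  - apply/measurable_EFinP; apply: measurableT_comp => //.
    exact: (measurableT_comp mg (measurable_rV_shift _)).
  - by move=> z _; rewrite lee_fin.
have ig := gauss_integrable_bounded mg gM.
have avgE y : avgw (cst 1) F y c = \int[G]_z F (y + c *: z).
  by rewrite /avgw; apply: eq_Rintegral => z _; rewrite /= mul1r.
have shiftE s z : x + s *: ee i + c *: z = x + c *: (s / c *: ee i + z).
  by rewrite scalerDr scalerA mulrCA mulfV ?gt_eqF// mulr1 addrA.
have avgh s : avgw (cst 1) F (x + s *: ee i) c = \int[G]_z (g z * E s z).
  rewrite avgE /Rintegral -(gauss_shiftR i (s / c) mg); congr fine.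
  by apply: eq_integral => z _; rewrite shiftE.
(* This is [c] times the derivative of [g z * E s z] in [s]. *)
pose K z s := g z * ((z 0 i - s / c) * E s z).
have cEs z : continuous (fun s : R => s / c * z 0 i - (s / c) ^+ 2 / 2).
  move=> s; have c1 : t / c @[t --> s] --> s / c by apply: cvgMr_tmp; exact: cvg_id.
  by apply: cvgB; apply: cvgMr_tmp => //; exact: (cvg_comp _ _ c1 (@sqr_continuous _ _)).
have cKz z : continuous (K z).
  move=> s; apply: cvgMl_tmp; apply: cvgM.
    by apply: cvgB; [exact: cvg_cst|apply: cvgMr_tmp; exact: cvg_id].
  by apply: (cvg_comp _ expR (cEs z s)); exact: continuous_expR.
have KI z : \int[leb R]_(s in `[0, h]) K z s = c * (g z * E h z - g z).
  rewrite Rintegral_leb; [|exact: measurable_itv|by apply: measurable_funTS; exact: continuous_measurable_fun].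
  have dF (s : R) : is_derive s (1 : R) (fun s => c * (g z * E s z)) (K z s).
    pose q (t : R) := z 0 i / c * t - (2 * c ^+ 2)^-1 * (t * t).
    have qE t : t / c * z 0 i - (t / c) ^+ 2 / 2 = q t.
      by rewrite /q; field; rewrite gt_eqF.
    have dq : is_derive s (1 : R) q (c^-1 * (z 0 i - s / c)).
      by apply: is_derive_eq; rewrite /GRing.scale/=; field; rewrite gt_eqF.
    have de : is_derive s (1 : R) (expR \o q) (c^-1 * (z 0 i - s / c) * expR (q s)).
      by apply: is_derive_eq; rewrite mulrC.
    have : is_derive s (1 : R) (cst (c * g z) * (expR \o q)) (K z s).
      apply: is_derive_eq; rewrite /GRing.scale/= mulr0 addr0 /K /E qE.
      by field; rewrite gt_eqF.
    by congr is_derive; apply/funext => t; rewrite /E qE /= -mulrA.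
  rewrite (Rintegral_is_derive h0 dF (cKz z)).
  by rewrite /E !mul0r expr0n/= mul0r subr0 expR0 mulr1 -mulrBr.
have mK : measurable_fun setT (fun q : 'rV[R]_n * R => K q.1 q.2).
  apply: measurable_funM; first exact: (measurableT_comp mg).
  have m1 : measurable_fun setT (fun q : 'rV[R]_n * R => q.1 0 i).
    exact: (measurableT_comp (measurable_coord i)).
  have m2 : measurable_fun setT (fun q : 'rV[R]_n * R => q.2 / c) by exact: measurable_funM.
  apply: measurable_funM; first exact: measurable_funB.
  apply: measurableT_comp => //; apply: measurable_funB; first exact: measurable_funM.
  by apply: measurable_funM => //; exact: measurable_funX.
have iB : G.-integrable setT (EFin \o (fun z => g z * E h z - g z)).
  exact: (integrableB measurableT (igE h) ig).
rewrite avgh avgE -(RintegralB measurableT (igE h) ig) -(RintegralZl c measurableT iB).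
transitivity (\int[G]_z \int[leb R]_(s in `[0, h]) K z s).
  by apply: eq_Rintegral => z _; rewrite KI.
have mz s : measurable_fun setT (fun z : 'rV[R]_n => g z * (z 0 i - s / c)).
  by apply: measurable_funM => //; apply: measurable_funB => //; exact: measurable_coord.
(* Undoing the tilt translates [z] by [s / c] along the axis, so that [z_i - s / c] becomes
   [z_i]. *)
have sh s z : g (s / c *: ee i + z) * ((s / c *: ee i + z) 0 i - s / c) = coordw i z * F (x + s *: ee i + c *: z).
  by rewrite /g -shiftE !mxE !eqxx mulr1 [s / c + _]addrC addrK mulrC.
have ic : G.-integrable setT (EFin \o coordw i) by exact: gauss_integrable_coord.
have mc : measurable_fun setT (coordw i) by exact: measurable_coord.
rewrite (@Rintegral_swap _ _ _ G setT K 0 h (fine (\int[G]_z (M * `|coordw i z|)%:E)%E)) => [|||z _|s _]//.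
- apply: eq_Rintegral => s _; rewrite /Rintegral; congr fine.
  transitivity (\int[G]_z (g z * (z 0 i - s / c) * E s z)%:E)%E.
    by apply: eq_integral => z _; rewrite /K mulrA.
  rewrite -(gauss_shiftR i (s / c) (mz s)).
  by apply: eq_integral => z _; rewrite sh.
- exact: continuous_itv_integrable_leb.
- have -> : (\int[G]_z `|K z s|%:E = \int[G]_z `|coordw i z * F (x + s *: ee i + c *: z)|%:E)%E.
    transitivity (\int[G]_z `|g z * (z 0 i - s / c) * E s z|%:E)%E.
      by apply: eq_integral => z _; rewrite /K mulrA.
    by rewrite (absE s _ (mz s)); apply: eq_integral => z _; rewrite sh.
  have iMc : G.-integrable setT (EFin \o (fun z => M * `|coordw i z|)).
    exact: (integrableZl measurableT M (integrable_norm ic)).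
  rewrite fineK; last exact: (integrable_fin_num measurableT iMc).
  apply: ge0_le_integral => //.
  + apply/measurable_EFinP; apply: measurableT_comp => //.
    exact: measurable_avgw.
  + apply/measurable_EFinP; apply: measurable_funM => //; exact: measurableT_comp.
  + by move=> z _; rewrite lee_fin normrM mulrC ler_wpM2r.
Qed.

(* The shift identity for [F = 1]. *)
Lemma gauss_coord i : \int[G]_z (z 0 i) = 0.
Proof.
have c1 : continuous (cst 1 : 'rV[R]_n -> R) by exact: cst_continuous.
have b1 (z : 'rV[R]_n) : `|cst 1 z| <= 1 :> R by rewrite /= normr1.
have := avg_shift_gt0 i 0 ler01 ltr01 c1 b1; rewrite subrr mulr0 => /esym.
have E s : avgw (coordw i) (cst 1) (0 + s *: ee i) 1 = \int[G]_z (z 0 i).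
  by rewrite /avgw; apply: eq_Rintegral => z _; rewrite /= mulr1.
under eq_Rintegral do rewrite E.
by rewrite Rintegral_leb_cst// subr0 mul1r.
Qed.

Lemma avg_shift_identity i F (M : R) x h c : 0 <= h -> 0 <= c ->
  continuous F -> (forall z, `|F z| <= M) ->
  c * (avgw (cst 1) F (x + h *: ee i) c - avgw (cst 1) F x c) =
  \int[leb R]_(s in `[0, h]) avgw (coordw i) F (x + s *: ee i) c.
Proof.
move=> h0; rewrite le_eqVlt => /predU1P[<- cF FM|c0]; last exact: avg_shift_gt0.
(* At [c = 0] the function [F] leaves the average, and the coordinate has mean zero. *)
have z0 y : avgw (coordw i) F y 0 = 0.
  rewrite /avgw; under eq_Rintegral do rewrite scale0r addr0.
  rewrite RintegralZr//; last exact: gauss_integrable_coord.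
  by rewrite gauss_coord mul0r.
by rewrite mul0r; under eq_Rintegral do rewrite z0; rewrite /Rintegral integral0.
Qed.

End gauss_averages.

(** * Partial derivatives in integrated form *)

Section antiderivative.
Variables (R : realType) (n : nat).
Implicit Types (x z : 'rV[R]_n) (f g F w : 'rV[R]_n -> R) (i : 'I_n) (c h : R).
Notation ee i := (delta_mx 0 i : 'rV[R]_n).

(* [g] is the [i]-th partial derivative of [f], in an integrated form that passes
   to averages and limits. *)
Definition antider i f g := forall x h, 0 <= h ->
  f (x + h *: ee i) - f x = \int[leb R]_(s in `[0, h]) g (x + s *: ee i).

Lemma continuous_line i x : continuous (fun s : R => x + s *: ee i).
Proof. by move=> s; apply: cvgD; [exact: cvg_cst|apply: cvgZr_tmp; exact: cvg_id]. Qed.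

Lemma continuous_on_line i g x : continuous g -> continuous (fun s : R => g (x + s *: ee i)).
Proof. by move=> cg s; exact: (cvg_comp _ _ (@continuous_line i x s) (cg _)). Qed.

Lemma is_derive_line i f x (l : R) :
  is_derive (0 : R) (1 : R) (fun s : R => f (x + s *: ee i)) l <-> is_derive x (ee i) f l.
Proof.
have E : (fun h : R => h^-1 *: (((fun s : R => f (x + s *: ee i)) \o shift 0) (h *: (1 : R)) - f (x + 0 *: ee i))) =
    (fun h : R => h^-1 *: ((f \o shift x) (h *: ee i) - f x)).
  apply/funext => h /=; rewrite /shift/= addr0 scale0r addr0 [x + _]addrC.
  by rewrite /GRing.scale/= mulr1.
split=> -[dl vl].
  split; first by rewrite /derivable -E.
  by rewrite -vl /derive -E.
split; first by rewrite /derivable E.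
by rewrite -vl /derive E.
Qed.

Lemma antider_is_derive i f g : continuous g -> antider i f g ->
  forall x, is_derive x (ee i) f (g x).
Proof.
move=> cg fg x; apply/is_derive_line.
(* [antider] only covers [h >= 0]; starting one unit back places [x] at parameter [1], inside []0,
   2[], where a two-sided derivative is available. *)
pose y := x - ee i; pose G s := g (y + s *: ee i).
have cG : continuous G by exact: continuous_on_line.
have G1 : G 1 = g x by rewrite /G scale1r subrK.
have h12 : (1 : R) < 2 by rewrite ltr1n.
have [dI vI] := continuous_FTC1_closed h12 (continuous_itv_integrable 0 2 cG) ltr01 (cG 1).
pose I (s : R) := \int[lebesgue_measure]_(t in `[0, s]) G t.
have dI1 : is_derive (1 : R) (1 : R) I (g x).
  by apply: DeriveDef; [exact: dI|rewrite -derive1E vI].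
have dI0 : is_derive (0 : R) (1 : R) (I \o (fun s : R => s + 1)) (g x).
  have ds : is_derive (0 : R) (1 : R) (fun s : R => s + 1) 1.
    by apply: is_derive_eq; rewrite addr0.
  have dI1' : is_derive ((0 : R) + 1) (1 : R) I (g x) by rewrite add0r.
  by have := is_derive1_comp (f := I) (g := fun s : R => s + 1) (x := 0) dI1' ds; rewrite mulr1.
have : is_derive (0 : R) (1 : R) (cst (f y) + (I \o (fun s : R => s + 1))) (g x).
  by apply: is_derive_eq; rewrite add0r.
apply: near_eq_is_derive => //.
near=> s.
have s1 : 0 <= s + 1.
  near: s; exists 1 => //= s; rewrite /ball_/= sub0r normrN => /ltW.
  by rewrite ler_norml -lerBlDr sub0r => /andP[].
have := fg y _ s1; rewrite Rintegral_leb; first last.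
- by apply: measurable_funTS; exact: continuous_measurable_fun.
- exact: measurable_itv.
move=> /eqP; rewrite subr_eq => /eqP E.
transitivity (f (y + (s + 1) *: ee i)); first by rewrite E addrC.
by rewrite /y scalerDl scale1r [s *: _ + _]addrC addrA subrK.
Unshelve. all: by end_near. Qed.

Lemma is_derive_antider i f g : continuous g ->
  (forall x, is_derive x (ee i) f (g x)) -> antider i f g.
Proof.
move=> cg df x h h0; have cG := continuous_on_line (i := i) (x := x) cg.
rewrite Rintegral_leb; first last.
- by apply: measurable_funTS; exact: continuous_measurable_fun.
- exact: measurable_itv.
have dF (s : R) : is_derive s (1 : R) (fun s : R => f (x + s *: ee i)) (g (x + s *: ee i)).
  have /is_derive_line := df (x + s *: ee i) => d0.
  have ds : is_derive s (1 : R) (fun t : R => t - s) 1.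
    by apply: is_derive_eq; rewrite subr0.
  have d0' : is_derive (s - s) (1 : R) (fun t : R => f (x + s *: ee i + t *: ee i)) (g (x + s *: ee i)).
    by rewrite subrr.
  have := is_derive1_comp (f := fun t : R => f (x + s *: ee i + t *: ee i)) (g := fun t : R => t - s) (x := s) d0' ds; rewrite mulr1.
  congr is_derive; apply/funext => t /=; congr f.
  by rewrite -addrA -scalerDl [s + _]addrC subrK.
by rewrite (Rintegral_is_derive h0 dF cG) scale0r addr0.
Qed.

Lemma antider_Rintegral i (A B : R -> 'rV[R]_n -> R) (M : R) :
  (forall th, 0 <= th <= 1 -> antider i (A th) (B th)) ->
  (forall x, continuous (A ^~ x)) -> continuous (fun q => B q.1 q.2) ->
  (forall th x, 0 <= th <= 1 -> `|B th x| <= M) ->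
  antider i (fun x => \int[leb R]_(th in `[0, 1]) A th x)
            (fun x => \int[leb R]_(th in `[0, 1]) B th x).
Proof.
move=> AB cA cB BM x h h0.
have mI (a b : R) : measurable (`[a, b] : set R) by exact: measurable_itv.
have iA x' := continuous_itv_integrable_leb 0 1 (cA x').
rewrite -(RintegralB (mI 0 1) (iA _) (iA _)).
have cK : continuous (fun q : R * R => B q.1 (x + q.2 *: ee i)).
  move=> q; apply: (cvg_comp2 (a := fst) (b := fun q : R * R => x + q.2 *: ee i) cB).
    exact: cvg_fst.
  by apply: cvgD; [exact: cvg_cst|apply: cvgZr_tmp; exact: cvg_snd].
transitivity (\int[leb R]_(th in `[0, 1]) \int[leb R]_(s in `[0, h]) B th (x + s *: ee i)).
  by apply: eq_Rintegral => th /set_mem /=; rewrite in_itv/= => th01; rewrite AB.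
rewrite (@Rintegral_swap _ _ _ (leb R) `[0, 1]%classic (fun th s => B th (x + s *: ee i)) 0 h (fine (\int[leb R]_(x in `[0%R, 1%R]) M%:E)%E)) => [//|||th _|s _].
- exact: mI.
- exact: (continuous_measurable_RR cK).
- apply: continuous_itv_integrable_leb.
  apply: continuous_on_line; exact: (continuous_fix1 (F := B) (x := th) cB).
- have iM := continuous_itv_integrable_leb 0 1 (@cst_continuous R R M).
  rewrite fineK; last exact: (integrable_fin_num (mI 0 1) iM).
  apply: ge0_le_integral => //.
  + apply/measurable_EFinP; apply: measurableT_comp => //; apply: measurable_funTS.
    apply: continuous_measurable_fun.
    exact: (continuous_fix2 (F := B) (s := x + s *: ee i) cB).
  + by move=> th /=; rewrite in_itv/= lee_fin => /BM.
Qed.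

Lemma antider_eq i f g g' : continuous g -> continuous g' ->
  antider i f g -> antider i f g' -> g = g'.
Proof.
move=> cg cg' fg fg'; apply/funext => x.
have [_ <-] := antider_is_derive cg fg x.
by have [_ <-] := antider_is_derive cg' fg' x.
Qed.

Lemma antiderD i f g f' g' : continuous g -> continuous g' ->
  antider i f g -> antider i f' g' ->
  antider i (fun x => f x + f' x) (fun x => g x + g' x).
Proof.
move=> cg cg' fg fg' x h h0; have mI : measurable (`[0, h] : set R) by exact: measurable_itv.
rewrite (RintegralD mI); [|exact: continuous_itv_integrable_leb (continuous_on_line cg)|exact: continuous_itv_integrable_leb (continuous_on_line cg')].
by rewrite -fg// -fg'//; ring.
Qed.

Lemma antiderZ i f g (k : R) : continuous g -> antider i f g ->
  antider i (fun x => k * f x) (fun x => k * g x).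
Proof.
move=> cg fg x h h0; have mI : measurable (`[0, h] : set R) by exact: measurable_itv.
rewrite (RintegralZl k mI (continuous_itv_integrable_leb 0 h (continuous_on_line cg))).
by rewrite -fg// mulrBr.
Qed.

End antiderivative.

(** * Heat semigroup and Duhamel operator *)

Lemma le_normr_Rintegral_leb (R : realType) (f : R -> R) (a b M : R) : a <= b ->
  continuous f -> (forall s, a <= s <= b -> `|f s| <= M) ->
  `|\int[leb R]_(s in `[a, b]) f s| <= (b - a) * M.
Proof.
move=> ab cf fM; have mI : measurable (`[a, b] : set R) by exact: measurable_itv.
apply: (le_trans (le_normr_Rintegral mI (continuous_itv_integrable_leb a b cf))).
rewrite -Rintegral_leb_cst//; apply: le_Rintegral.
- exact: mI.
- by apply: continuous_itv_integrable_leb => s; apply: cvg_norm; exact: cf.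
- by apply: continuous_itv_integrable_leb => s; exact: cvg_cst.
- by move=> s; rewrite /= in_itv/= => /fM.
Qed.

Section heat_operators.
Variables (R : realType) (n : nat).
Implicit Types (x z : 'rV[R]_n) (f g w : 'rV[R]_n -> R) (F : 'rV[R]_n -> R -> R) (i : 'I_n).
Implicit Types (t s M : R).
Notation ee i := (delta_mx 0 i : 'rV[R]_n).
Notation G := (gauss R n).
Let mI (a b : R) : measurable (`[a, b] : set R). Proof. exact: measurable_itv. Qed.

Definition heat t f x : R := avgw (cst 1) f x (Num.sqrt (2 * t)).

Let i1 : G.-integrable setT (EFin \o (cst 1 : 'rV[R]_n -> R)).
Proof. exact: gauss_integrable_cst. Qed.

Let m1 : measurable_fun setT (cst 1 : 'rV[R]_n -> R). Proof. exact: measurable_cst. Qed.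

Lemma heatE t f x : heat t f x = \int[G]_z f (x + Num.sqrt (2 * t) *: z).
Proof. by rewrite /heat/avgw; apply: eq_Rintegral => z _; rewrite /= mul1r. Qed.

Lemma heat0 f x : heat 0 f x = f x.
Proof.
rewrite heatE mulr0 sqrtr0; under eq_Rintegral do rewrite scale0r addr0.
exact: gauss_cst.
Qed.

Lemma avg1_le f M x c : measurable_fun setT f -> (forall z, `|f z| <= M) ->
  `|avgw (cst 1) f x c| <= M.
Proof.
move=> mf fM; have := avgw_le x c m1 i1 mf fM.
by under [X in _ <= _ * X -> _]eq_Rintegral do rewrite /= normr1; rewrite gauss_cst mulr1.
Qed.

Lemma heat_le t f M x : measurable_fun setT f -> (forall z, `|f z| <= M) ->
  `|heat t f x| <= M.
Proof. exact: avg1_le. Qed.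

Lemma heat_ge0 t f x : (forall z, 0 <= f z) -> 0 <= heat t f x.
Proof. by move=> f0; rewrite heatE; apply: Rintegral_ge0. Qed.

Lemma measurable_heat_arg f x c : measurable_fun setT f ->
  measurable_fun setT (fun z : 'rV[R]_n => f (x + c *: z)).
Proof. by move=> mf; exact: (measurableT_comp mf (measurable_rV_affine x c)). Qed.

Lemma heat_integrable f M x c : measurable_fun setT f -> (forall z, `|f z| <= M) ->
  G.-integrable setT (EFin \o (fun z => f (x + c *: z))).
Proof.
move=> mf fM; apply: (gauss_integrable_bounded (M := M)) => [|z]; last exact: fM.
exact: measurable_heat_arg.
Qed.

(** The variances [2 * s] and [2 * t] of two independent Gaussian steps add up. *)
Lemma heat_comp s t f M x : 0 <= s -> 0 <= t -> measurable_fun setT f ->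
  (forall z, `|f z| <= M) -> heat s (heat t f) x = heat (s + t) f x.
Proof.
move=> s0 t0 mf fM; rewrite !heatE; under eq_Rintegral do rewrite heatE.
have mfx : measurable_fun setT (fun z => f (x + z)).
  exact: (measurableT_comp mf (measurable_rV_shift x)).
have := gauss_convR (sqrtr_ge0 (2 * s)) (sqrtr_ge0 (2 * t)) mfx (fun=> fM _).
rewrite !sqr_sqrtr ?mulr_ge0// -mulrDr => <-.
by apply: eq_Rintegral => z _; apply: eq_Rintegral => z' _; rewrite addrA.
Qed.

Section continuity.
Variables (F : 'rV[R]_n -> R -> R) (M : R).
Hypotheses (cF : continuous (fun q => F q.1 q.2)) (FM : forall z s, `|F z s| <= M).

Lemma measurable_source s : measurable_fun setT (F ^~ s).
Proof. exact: (continuous_measurable_rV (continuous_fix2 cF)). Qed.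

Lemma avgw_cvg w (X : topologicalType) (a : X -> 'rV[R]_n) (b c : X -> R) (p : X) :
  measurable_fun setT w -> G.-integrable setT (EFin \o w) ->
  a y @[y --> p] --> a p -> b y @[y --> p] --> b p -> c y @[y --> p] --> c p ->
  avgw w (F ^~ (c y)) (a y) (b y) @[y --> p] --> avgw w (F ^~ (c p)) (a p) (b p).
Proof.
move=> mw iw ca cb cc.
have cA := avgw_continuous mw iw cF FM.
have cabc : (a y, b y, c y) @[y --> p] --> (a p, b p, c p).
  exact: (cvg_pair (cvg_pair ca cb) cc).
exact: (cvg_comp (fun y => (a y, b y, c y)) (fun q : 'rV[R]_n * R * R => avgw w (F ^~ q.2) q.1.1 q.1.2) cabc (cA (a p, b p, c p))).
Qed.

Lemma heat_cvg (X : topologicalType) (a : X -> 'rV[R]_n) (b c : X -> R) (p : X) :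
  a y @[y --> p] --> a p -> b y @[y --> p] --> b p -> c y @[y --> p] --> c p ->
  heat (b y) (F ^~ (c y)) (a y) @[y --> p] --> heat (b p) (F ^~ (c p)) (a p).
Proof.
move=> ca cb cc.
apply: (avgw_cvg (b := fun y => Num.sqrt (2 * b y))) => //.
apply: (cvg_comp (fun y => 2 * b y) Num.sqrt); last exact: sqrt_continuous.
exact: cvgMl_tmp.
Qed.

End continuity.

(* The Duhamel integral in the variable [th] with [s = t * (1 - th ^+ 2)] (see
   [duhE]): this substitution absorbs the singularity [(t - s) ^ (-1/2)] of the
   gradient, which becomes [duh1]. *)
Definition duhw w (k : R -> R) F x t : R := \int[leb R]_(th in `[0, 1])
  (k th * avgw w (F ^~ (t * (1 - th ^+ 2))) x (Num.sqrt (2 * t) * th)).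

Definition duh F x t : R := 2 * t * duhw (cst 1) id F x t.

Definition duh1 i F x t : R := Num.sqrt (2 * t) * duhw (coordw i) (cst 1) F x t.

Section duhamel_bounds.
Variables (F : 'rV[R]_n -> R -> R) (M : R).
Hypotheses (cF : continuous (fun q => F q.1 q.2)) (FM : forall z s, `|F z s| <= M).

Let M0 : 0 <= M.
Proof. exact: le_trans (normr_ge0 _) (FM 0 0). Qed.

Lemma duhw_integrand_cvg w (X : topologicalType) (a : X -> 'rV[R]_n) (b c : X -> R) (p : X) :
  measurable_fun setT w -> G.-integrable setT (EFin \o w) ->
  a y @[y --> p] --> a p -> b y @[y --> p] --> b p -> c y @[y --> p] --> c p ->
  avgw w (F ^~ (b y * (1 - c y ^+ 2))) (a y) (Num.sqrt (2 * b y) * c y) @[y --> p] -->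
  avgw w (F ^~ (b p * (1 - c p ^+ 2))) (a p) (Num.sqrt (2 * b p) * c p).
Proof.
move=> mw iw ca cb cc.
apply: (avgw_cvg cF FM (b := fun y => Num.sqrt (2 * b y) * c y) (c := fun y => b y * (1 - c y ^+ 2))) => //.
  apply: cvgM => //; apply: (cvg_comp (fun y => 2 * b y) Num.sqrt); last exact: sqrt_continuous.
  exact: cvgMl_tmp.
apply: cvgM => //; apply: cvgB; first exact: cvg_cst.
exact: (cvg_comp c (fun r => r ^+ 2) cc (@sqr_continuous _ _)).
Qed.

Lemma duhw_continuous w (k : R -> R) : measurable_fun setT w ->
  G.-integrable setT (EFin \o w) -> continuous k ->
  (forall th, 0 <= th <= 1 -> `|k th| <= 1) ->
  continuous (fun q => duhw w k F q.1 q.2).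
Proof.
move=> mw iw ck k1.
apply: (continuous_Rintegral (mI 0 1) (continuous_itv_integrable_leb 0 1 (@cst_continuous _ _ (M * \int[G]_z `|w z|)))) => [q|th _|q th].
- apply: measurable_funTS; apply: continuous_measurable_fun => th.
  apply: cvgM; first exact: ck.
  apply: (duhw_integrand_cvg (a := fun=> q.1) (b := fun=> q.2) (c := id)) => //; exact: cvg_cst.
- move=> q; apply: cvgMl_tmp.
  by apply: (duhw_integrand_cvg (a := fst) (b := snd) (c := fun=> th)) => //; [exact: cvg_fst|exact: cvg_snd|exact: cvg_cst].
- rewrite /= in_itv/= => th01; rewrite normrM -[leRHS]mul1r.
  apply: ler_pM => //; first exact: k1.
  exact: (avgw_le _ _ mw iw (measurable_source cF _)).
Qed.

Lemma duh_continuous : continuous (fun q => duh F q.1 q.2).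
Proof.
move=> q; apply: cvgM; first by apply: cvgMl_tmp; exact: cvg_snd.
apply: (duhw_continuous m1 i1); first by move=> ?; exact: cvg_id.
by move=> th /andP[h0 h1]; rewrite ger0_norm.
Qed.

Lemma duh1_continuous i : continuous (fun q => duh1 i F q.1 q.2).
Proof.
move=> q; apply: cvgM.
  apply: (cvg_comp (fun q : 'rV[R]_n * R => 2 * q.2) Num.sqrt); last exact: sqrt_continuous.
  by apply: cvgMl_tmp; exact: cvg_snd.
apply: duhw_continuous.
- exact: measurable_coord.
- exact: gauss_integrable_coord.
- by move=> ?; exact: cvg_cst.
- by move=> th _; rewrite normr1.
Qed.

Lemma duhw_le w (k : R -> R) x t : measurable_fun setT w ->
  G.-integrable setT (EFin \o w) -> continuous k ->
  (forall th, 0 <= th <= 1 -> `|k th| <= 1) ->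
  `|duhw w k F x t| <= M * \int[G]_z `|w z|.
Proof.
move=> mw iw ck k1; set C := M * _.
have cA : continuous (fun th => k th * avgw w (F ^~ (t * (1 - th ^+ 2))) x (Num.sqrt (2 * t) * th)).
  move=> th; apply: cvgM; first exact: ck.
  apply: (duhw_integrand_cvg (a := fun=> x) (b := fun=> t) (c := id)) => //; exact: cvg_cst.
rewrite (_ : C = (1 - 0) * C); last by ring.
apply: (le_normr_Rintegral_leb ler01 cA) => th th01.
rewrite normrM -[leRHS]mul1r; apply: ler_pM => //; first exact: k1.
exact: (avgw_le _ _ mw iw (measurable_source cF _)).
Qed.

End duhamel_bounds.
End heat_operators.

Lemma continuous_mull (T : topologicalType) (R : realType) (k : R) (f : T -> R) :
  continuous f -> continuous (fun x => k * f x : R).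
Proof. by move=> cf x; apply: cvgMl_tmp; exact: cf. Qed.

Lemma continuous_fstR (A B C : topologicalType) (f : A -> C) : continuous f ->
  continuous (fun q : A * B => f q.1).
Proof. by move=> cf q; apply: (cvg_comp fst f); [exact: cvg_fst|exact: cf]. Qed.

Lemma continuous_sndR (A B C : topologicalType) (f : B -> C) : continuous f ->
  continuous (fun q : A * B => f q.2).
Proof. by move=> cf q; apply: (cvg_comp snd f); [exact: cvg_snd|exact: cf]. Qed.

Section antider_heat.
Variables (R : realType) (n : nat).
Implicit Types (x z : 'rV[R]_n) (f g w : 'rV[R]_n -> R) (F : 'rV[R]_n -> R -> R) (i : 'I_n).
Implicit Types (t s M c : R).
Notation ee i := (delta_mx 0 i : 'rV[R]_n).
Notation G := (gauss R n).
Let mI (a b : R) : measurable (`[a, b] : set R). Proof. exact: measurable_itv. Qed.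

Let i1 : G.-integrable setT (EFin \o (cst 1 : 'rV[R]_n -> R)).
Proof. exact: gauss_integrable_cst. Qed.

Let m1 : measurable_fun setT (cst 1 : 'rV[R]_n -> R). Proof. exact: measurable_cst. Qed.

Let mc i : measurable_fun setT (coordw i : 'rV[R]_n -> R). Proof. exact: measurable_coord. Qed.

Let ic i : G.-integrable setT (EFin \o (coordw i : 'rV[R]_n -> R)).
Proof. exact: gauss_integrable_coord. Qed.

Lemma avgw_continuous1 w f M c : measurable_fun setT w ->
  G.-integrable setT (EFin \o w) -> continuous f -> (forall z, `|f z| <= M) ->
  continuous (fun x => avgw w f x c).
Proof.
move=> mw iw cf fM.
have cF : continuous (fun q : 'rV[R]_n * R => f q.1) by exact: continuous_fstR.
have cA := avgw_continuous (F := fun x _ => f x) mw iw cF (fun z _ => fM z).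
have cA2 := continuous_fix2 (F := fun (q : 'rV[R]_n * R) (_ : R) => avgw w f q.1 q.2) (s := 0) cA.
exact: (continuous_fix2 (F := fun (x : 'rV[R]_n) (c : R) => avgw w f x c) (s := c) cA2).
Qed.

(** Differentiation under the average, with the derivative falling on the averaged function; compare
    [avg_shift_identity], where it falls on the weight. *)
Lemma antider_avgw i w f g M c : measurable_fun setT w ->
  G.-integrable setT (EFin \o w) ->
  continuous f -> (forall z, `|f z| <= M) -> continuous g -> (forall z, `|g z| <= M) ->
  antider i f g -> antider i (fun x => avgw w f x c) (fun x => avgw w g x c).
Proof.
move=> mw iw cf fM cg gM fg x h h0.
have mf := continuous_measurable_rV cf; have mg := continuous_measurable_rV cg.
have iwf y := avgw_integrable y c mw iw mf fM.
rewrite /avgw -(RintegralB measurableT (iwf _) (iwf _)).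
pose K z (s : R) := w z * g (x + s *: ee i + c *: z).
have mK : measurable_fun setT (fun q : 'rV[R]_n * R => K q.1 q.2).
  apply: measurable_funM; first exact: (measurableT_comp mw).
  apply: continuous_measurable_rVR => q.
  apply: (cvg_comp (fun q : 'rV[R]_n * R => x + q.2 *: ee i + c *: q.1) g); last exact: cg.
  apply: cvgD; last by apply: cvgZl_tmp; exact: cvg_fst.
  by apply: cvgD; [exact: cvg_cst|apply: cvgZr_tmp; exact: cvg_snd].
have cK z : continuous (K z).
  move=> s; apply: cvgMl_tmp.
  apply: (cvg_comp (fun s : R => x + s *: ee i + c *: z) g); last exact: cg.
  apply: cvgD; last exact: cvg_cst.
  by apply: cvgD; [exact: cvg_cst|apply: cvgZr_tmp; exact: cvg_id].
transitivity (\int[G]_z \int[leb R]_(s in `[0, h]) K z s).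
  apply: eq_Rintegral => z _; rewrite -mulrBr.
  rewrite (_ : x + h *: ee i + c *: z = x + c *: z + h *: ee i); last by rewrite addrAC.
  rewrite fg// -RintegralZl//; last first.
    by apply: continuous_itv_integrable_leb; exact: continuous_on_line.
  by apply: eq_Rintegral => s _; rewrite /K addrAC.
rewrite (@Rintegral_swap _ _ _ G setT K 0 h (M * \int[G]_z `|w z|)) => [//|//|//|z _|s _].
- exact: continuous_itv_integrable_leb.
- have iMw : G.-integrable setT (EFin \o (fun z => M * `|w z|)).
    exact: (integrableZl measurableT M (integrable_norm iw)).
  rewrite -RintegralZl//; last exact: integrable_norm.
  rewrite fineK; last exact: (integrable_fin_num measurableT iMw).
  apply: ge0_le_integral => //.
  + apply/measurable_EFinP; apply: measurableT_comp => //.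
    exact: measurable_avgw.
  + apply/measurable_EFinP; apply: measurable_funM => //; exact: measurableT_comp.
  + by move=> z _; rewrite lee_fin normrM mulrC ler_wpM2r.
Qed.

(** The gradient of the heat average with the derivative carried by the kernel; its size is of order
    [t ^ (-1/2)]. *)
Definition heat1 i t f x : R := (Num.sqrt (2 * t))^-1 * avgw (coordw i) f x (Num.sqrt (2 * t)).

Lemma antider_heat1 i t f M : 0 < t -> continuous f -> (forall z, `|f z| <= M) ->
  antider i (heat t f) (heat1 i t f).
Proof.
move=> t0 cf fM x h h0; rewrite /heat; set c := Num.sqrt _.
have c0 : 0 < c by rewrite sqrtr_gt0 mulr_gt0.
have ci := continuous_on_line (i := i) (x := x) (avgw_continuous1 (c := c) (mc i) (ic i) cf fM).
rewrite /heat1 -/c (RintegralZl _ (mI 0 h) (continuous_itv_integrable_leb 0 h ci)).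
rewrite -(avg_shift_identity i x h0 (ltW c0) cf fM).
by rewrite mulKf// gt_eqF.
Qed.

Lemma heat1_continuous i t f M : continuous f -> (forall z, `|f z| <= M) ->
  continuous (heat1 i t f).
Proof. by move=> cf fM; apply: continuous_mull; exact: (avgw_continuous1 (mc i) (ic i) cf fM). Qed.

Lemma antider_heat i t f g M : continuous f -> (forall z, `|f z| <= M) ->
  continuous g -> (forall z, `|g z| <= M) -> antider i f g ->
  antider i (heat t f) (heat t g).
Proof. by move=> cf fM cg gM; exact: (antider_avgw _ m1 i1 cf fM cg gM). Qed.

Let avg_cvg F M (cF : continuous (fun q => F q.1 q.2)) (FM : forall z s, `|F z s| <= M) w (k : R -> R) t : measurable_fun setT w -> G.-integrable setT (EFin \o w) ->
  continuous k -> continuous (fun q : R * 'rV[R]_n =>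
    (k q.1 * avgw w (F ^~ (t * (1 - q.1 ^+ 2))) q.2 (Num.sqrt (2 * t) * q.1) : R)).
Proof.
move=> mw iw ck q; apply: cvgM; first exact: (continuous_fstR ck).
apply: (duhw_integrand_cvg cF FM (a := snd) (b := fun=> t) (c := fst) mw iw).
- exact: cvg_snd.
- exact: cvg_cst.
- exact: cvg_fst.
Qed.

Let ck1 (k : R) : continuous (cst k : R -> R). Proof. by move=> ?; exact: cvg_cst. Qed.

Let ckid : continuous (id : R -> R). Proof. by move=> ?; exact: cvg_id. Qed.

Section duhamel.
Variables (F : 'rV[R]_n -> R -> R) (M : R).
Hypotheses (cF : continuous (fun q => F q.1 q.2)) (FM : forall z s, `|F z s| <= M).

(** The gain of one space derivative: the source is only continuous and bounded. *)
Lemma antider_duh i t : 0 <= t -> antider i (duh F ^~ t) (duh1 i F ^~ t).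
Proof.
rewrite le_eqVlt => /predU1P[<-|t0].
  have E0 y : duh F y 0 = 0 by rewrite /duh mulr0 mul0r.
  have E1 y : duh1 i F y 0 = 0 by rewrite /duh1 mulr0 sqrtr0 mul0r.
  move=> x h h0; rewrite !E0 subrr; under eq_Rintegral do rewrite E1.
  by rewrite Rintegral_leb_cst// mulr0.
pose c : R := Num.sqrt (2 * t).
have c0 : 0 < c by rewrite sqrtr_gt0 mulr_gt0.
have cc : c ^+ 2 = 2 * t by rewrite sqr_sqrtr// mulr_ge0// ltW.
pose A (th : R) (x : 'rV[R]_n) : R := th * avgw (cst 1) (F ^~ (t * (1 - th ^+ 2))) x (c * th).
(* The factor [th] of [A] cancels the [1 / (c * th)] of the differentiated average, hence [B] is
   bounded up to [th = 0]. The outer factor [2 * t = c ^+ 2] then turns [c^-1] into the [c] of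
   [duh1]. *)
pose B (th : R) (x : 'rV[R]_n) : R := c^-1 * avgw (coordw i) (F ^~ (t * (1 - th ^+ 2))) x (c * th).
have cB : continuous (fun q : R * 'rV[R]_n => B q.1 q.2) by exact: (@avg_cvg F M cF FM (coordw i) (fun=> c^-1) t (mc i) (ic i) (@ck1 c^-1)).
have cA x : continuous (A ^~ x).
  exact: (continuous_fix2 (F := fun th x => A th x) (s := x) (avg_cvg cF FM (k := id) (t := t) m1 i1 ckid)).
have BM th x : 0 <= th <= 1 -> `|B th x| <= c^-1 * (M * \int[G]_z `|coordw i z|).
  move=> _; rewrite /B normrM (@ger0_norm _ c^-1) ?invr_ge0 ?(ltW c0)//.
  apply: ler_wpM2l; first by rewrite invr_ge0 ltW.
  exact: (avgw_le _ _ (mc i) (ic i) (measurable_source cF _)).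
have AB th : 0 <= th <= 1 -> antider i (A th) (B th).
  move=> /andP[th0 _] x h h0; rewrite /A /B.
  have cFs := continuous_fix2 (s := t * (1 - th ^+ 2)) cF.
  have ci := continuous_on_line (i := i) (x := x) (avgw_continuous1 (c := c * th) (mc i) (ic i) cFs (FM^~ _)).
  rewrite (RintegralZl _ (mI 0 h) (continuous_itv_integrable_leb 0 h ci)).
  rewrite -(avg_shift_identity i x h0 (mulr_ge0 (ltW c0) th0) cFs (FM^~ _)).
  by field; rewrite gt_eqF.
have EB x : \int[leb R]_(th in `[0, 1]) B th x = c^-1 * duhw (coordw i) (cst 1) F x t.
  have ck := continuous_fix2 (F := fun (th : R) (x : 'rV[R]_n) => cst 1 th * avgw (coordw i) (F ^~ (t * (1 - th ^+ 2))) x (c * th) : R) (s := x) (@avg_cvg F M cF FM (coordw i) (cst 1) t (mc i) (ic i) (@ck1 1)).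
  rewrite /duhw -(RintegralZl _ (mI 0 1) (continuous_itv_integrable_leb 0 1 ck)).
  by apply: eq_Rintegral => th _; rewrite /B /= mul1r.
have cI : continuous (fun x => \int[leb R]_(th in `[0, 1]) B th x).
  under eq_fun do rewrite EB; apply: continuous_mull.
  apply: (continuous_fix2 (F := duhw (coordw i) (cst 1) F) (s := t)).
  by apply: (duhw_continuous cF FM (mc i) (ic i)) => [|th _]; [exact: ck1|rewrite /= normr1].
have H := antiderZ (2 * t) cI (antider_Rintegral AB cA cB BM).
move=> x h h0; rewrite (H x h h0).
apply: eq_Rintegral => s _; rewrite EB /duh1 -/c -cc.
by field; rewrite gt_eqF.
Qed.

(** Here the derivative falls on the source, which keeps the form of the Duhamel operator and allows
    a second gain. *)
Lemma antider_duh_trans i Fi t : 0 <= t -> continuous (fun q => Fi q.1 q.2) ->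
  (forall z s, `|Fi z s| <= M) -> (forall s, antider i (F ^~ s) (Fi ^~ s)) ->
  antider i (duh F ^~ t) (duh Fi ^~ t).
Proof.
move=> t0 cFi FiM FFi.
pose A (th : R) (x : 'rV[R]_n) : R := th * avgw (cst 1) (F ^~ (t * (1 - th ^+ 2))) x (Num.sqrt (2 * t) * th).
pose B (th : R) (x : 'rV[R]_n) : R := th * avgw (cst 1) (Fi ^~ (t * (1 - th ^+ 2))) x (Num.sqrt (2 * t) * th).
have cB : continuous (fun q : R * 'rV[R]_n => B q.1 q.2).
  exact: (avg_cvg cFi FiM (k := id) (t := t) m1 i1 ckid).
have cA : continuous (fun q : R * 'rV[R]_n => A q.1 q.2).
  exact: (avg_cvg cF FM (k := id) (t := t) m1 i1 ckid).
have BM th x : 0 <= th <= 1 -> `|B th x| <= M.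
  move=> /andP[th0 th1]; rewrite normrM ger0_norm// -[leRHS]mul1r; apply: ler_pM => //.
  exact: (avg1_le _ _ (measurable_source cFi _)).
have AB th : 0 <= th <= 1 -> antider i (A th) (B th).
  have cFs := continuous_fix2 (s := t * (1 - th ^+ 2)) cF.
  have cFis := continuous_fix2 (s := t * (1 - th ^+ 2)) cFi.
  move=> _; apply: antiderZ; first exact: (avgw_continuous1 (c := Num.sqrt (2 * t) * th) m1 i1 cFis (FiM^~ _)).
  exact: (antider_avgw _ m1 i1 cFs (FM^~ _) cFis (FiM^~ _)).
have cI : continuous (fun x => \int[leb R]_(th in `[0, 1]) B th x).
  apply: (continuous_fix2 (F := duhw (cst 1) id Fi) (s := t)).
  apply: (duhw_continuous cFi FiM m1 i1); first exact: ckid.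
  by move=> th /andP[th0 th1]; rewrite ger0_norm.
have cAx x := continuous_fix2 (F := A) (s := x) cA.
exact: (antiderZ (2 * t) cI (antider_Rintegral AB cAx cB BM)).
Qed.

End duhamel.
End antider_heat.

(** * The Duhamel integral in the time variable, and restarts *)

Section time_integrals.
Variable R : realType.
Implicit Types (f g : R -> R) (a b c : R).
Let mI (a b : R) : measurable (`[a, b] : set R). Proof. exact: measurable_itv. Qed.

Lemma continuous_measurable_leb f (D : set R) : continuous f -> measurable_fun D f.
Proof. by move=> cf; apply: measurable_funTS; exact: continuous_measurable_fun. Qed.

Lemma Rintegral_leb_cat f a b c : a <= b -> b <= c -> continuous f ->
  \int[leb R]_(s in `[a, c]) f s = \int[leb R]_(s in `[a, b]) f s + \int[leb R]_(s in `[b, c]) f s.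
Proof.
move=> ab bc cf.
rewrite !(Rintegral_leb (mI _ _) (continuous_measurable_leb cf)).
have iac := continuous_itv_integrable a c cf.
have ibc := continuous_itv_integrable b c cf.
have ioc : lebesgue_measure.-integrable [set` Interval (BRight b) (BRight c)] (EFin \o f).
  apply: integrableS ibc; [exact: measurable_itv|exact: measurable_itv|].
  by apply: subset_itvr; rewrite bnd_simp.
have H := Rintegral_itvB iac (x := b); rewrite !bnd_simp in H.
by rewrite -(Rintegral_itv_obnd_cbnd ioc) -(H ab bc) addrC subrK.
Qed.

(** The decreasing substitution [s = a + (b - a) * (1 - th ^+ 2)], whose Jacobian is
    [2 * (b - a) * th]. *)
Lemma Rintegral_leb_quad (G : R -> R) a b : a <= b -> continuous G ->
  \int[leb R]_(s in `[a, b]) G s =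
  2 * (b - a) * \int[leb R]_(th in `[0, 1]) (th * G (a + (b - a) * (1 - th ^+ 2))).
Proof.
move=> + cG; rewrite le_eqVlt => /predU1P[<-|ab].
  rewrite subrr mulr0 mul0r (Rintegral_leb (mI _ _) (continuous_measurable_leb cG)).
  by rewrite set_itv1 Rintegral_set1.
pose F (th : R) : R := a + (b - a) * (1 - th * th).
have F0 : F 0 = b by rewrite /F; ring.
have F1 : F 1 = a by rewrite /F; ring.
have dF (th : R) : is_derive th (1 : R) F (- (2 * (b - a) * th)).
  by apply: is_derive_eq; rewrite /GRing.scale/=; ring.
have F'E : (derive1 F) = (fun th => - (2 * (b - a) * th)).
  by apply/funext => th; rewrite derive1E; have [_ ->] := dF th.
have cF' : continuous (fun th : R => - (2 * (b - a) * th)).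
  by move=> th; apply: cvgN; apply: cvgMl_tmp; exact: cvg_id.
have cF th : F x @[x --> th] --> F th.
  by apply: differentiable_continuous; apply/derivable1_diffP; have [] := dF th.
have cGF : continuous (fun th : R => th * G (F th) : R).
  move=> th; apply: cvgM; first exact: cvg_id.
  by apply: (cvg_comp F G (cF th)); exact: cG.
have cGF2 := continuous_mull (k := 2 * (b - a)) cGF.
have H : (\int[lebesgue_measure]_(x in `[F 1%R, F 0%R]) (G x)%:E =
   \int[lebesgue_measure]_(x in `[0%R, 1%R]) (((G \o F) * - (derive1 F))%R x)%:E)%E.
  apply: integration_by_substitution_decreasing => //.
  - move=> x y; rewrite !in_itv/= => /andP[x0 _] /andP[y0 _] yx; rewrite /F ltrD2l ltr_pM2l ?subr_gt0//.
    by rewrite ltrD2l ltrN2; nra.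
  - by move=> x _; rewrite F'E; exact: cF'.
  - rewrite F'E; apply/cvg_ex; exists (- (2 * (b - a) * 0)); apply: cvg_at_right_filter; exact: cF'.
  - rewrite F'E; apply/cvg_ex; exists (- (2 * (b - a) * 1)); apply: cvg_at_left_filter; exact: cF'.
  - apply: derivable_oo_LR => x; by have [] := dF x.
  - by apply: continuous_subspaceT => x; exact: cG.
rewrite -(RintegralZl _ (mI 0 1)); last exact: continuous_itv_integrable_leb.
rewrite (Rintegral_leb (mI _ _) (continuous_measurable_leb cG)).
rewrite (Rintegral_leb (mI _ _)); last first.
  by apply: continuous_measurable_leb; exact: cGF2.
rewrite F1 F0 in H; rewrite /Rintegral H; congr fine; apply: eq_integral => th _ /=; congr EFin.
transitivity (G (F th) * - derive1 F th); first by [].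
rewrite F'E expr2 (_ : a + (b - a) * (1 - th * th) = F th); last by [].
by move: (G (F th)) (th : R) => u v; ring.
Qed.

End time_integrals.

Section restart.
Variables (R : realType) (n : nat).
Implicit Types (x z : 'rV[R]_n) (f g : 'rV[R]_n -> R) (t s M a b : R).
Notation G := (gauss R n).
Let mI (a b : R) : measurable (`[a, b] : set R). Proof. exact: measurable_itv. Qed.

Lemma heatD t f g M x : measurable_fun setT f -> (forall z, `|f z| <= M) ->
  measurable_fun setT g -> (forall z, `|g z| <= M) ->
  heat t (fun y => f y + g y) x = heat t f x + heat t g x.
Proof.
move=> mf fM mg gM; rewrite !heatE -RintegralD//.
- exact: heat_integrable mf fM.
- exact: heat_integrable mg gM.
Qed.

Variables (F : 'rV[R]_n -> R -> R) (M : R).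
Hypotheses (cF : continuous (fun q => F q.1 q.2)) (FM : forall z s, `|F z s| <= M).

Lemma duh_integrand_continuous b :
  continuous (fun q : 'rV[R]_n * R => heat (b - q.2) (F ^~ q.2) q.1).
Proof.
move=> q; apply: (heat_cvg cF FM (a := fst) (b := fun q : 'rV[R]_n * R => b - q.2) (c := snd)).
- exact: cvg_fst.
- by apply: cvgB; [exact: cvg_cst|exact: cvg_snd].
- exact: cvg_snd.
Qed.

(** After the substitution [b - s = (b - a) * th ^+ 2], so that the width [sqrt (2 * (b - s))]
    becomes [sqrt (2 * (b - a)) * th], the one built into [duhw]. *)
Lemma duh_shiftE a b x : a <= b ->
  \int[leb R]_(s in `[a, b]) heat (b - s) (F ^~ s) x =
  duh (fun y s => F y (a + s)) x (b - a).
Proof.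
move=> ab; rewrite (Rintegral_leb_quad ab); last first.
  exact: (continuous_fix1 (F := fun x s => heat (b - s) (F ^~ s) x) (x := x) (@duh_integrand_continuous b)).
rewrite /duh /duhw; apply: (congr1 (fun r => 2 * (b - a) * r)).
apply: eq_Rintegral => th /set_mem; rewrite /= in_itv/= => /andP[th0 _].
apply: (congr1 (fun r => th * r)); rewrite /heat; apply: (congr1 (avgw _ _ _)).
rewrite (_ : 2 * (b - (a + (b - a) * (1 - th ^+ 2))) = 2 * (b - a) * th ^+ 2); last by ring.
by rewrite sqrtrM ?mulr_ge0 ?subr_ge0// sqrtr_sqr ger0_norm.
Qed.

Lemma duhE b x : 0 <= b ->
  duh F x b = \int[leb R]_(s in `[0, b]) heat (b - s) (F ^~ s) x.
Proof.
move=> b0; rewrite (duh_shiftE x b0) subr0; congr (duh _ x b).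
by apply/funext => y; apply/funext => s; rewrite add0r.
Qed.

(** Fubini brings [heat t] inside the time integral, where the semigroup law merges it with
    [heat (s - r)]. *)
Lemma heat_duh t s x : 0 <= t -> 0 <= s ->
  heat t (duh F ^~ s) x = \int[leb R]_(r in `[0, s]) heat (t + s - r) (F ^~ r) x.
Proof.
move=> t0 s0; rewrite heatE; set c := Num.sqrt _.
pose K z r : R := heat (s - r) (F ^~ r) (x + c *: z).
have cK : continuous (fun q : 'rV[R]_n * R => K q.1 q.2).
  move=> q.
  apply: (heat_cvg cF FM (a := fun q : 'rV[R]_n * R => x + c *: q.1) (b := fun q : 'rV[R]_n * R => s - q.2) (c := snd)).
  - by apply: cvgD; [exact: cvg_cst|apply: cvgZl_tmp; exact: cvg_fst].
  - by apply: cvgB; [exact: cvg_cst|exact: cvg_snd].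
  - exact: cvg_snd.
have mK := continuous_measurable_rVR cK.
transitivity (\int[G]_z \int[leb R]_(r in `[0, s]) K z r).
  by apply: eq_Rintegral => z _; rewrite duhE.
rewrite (@Rintegral_swap _ _ _ G setT K 0 s M) => [||//|z _|r r01].
- apply: eq_Rintegral => r /set_mem; rewrite /= in_itv/= => /andP[r0 rs].
  rewrite -addrA -(heat_comp _ t0 _ (measurable_source cF r) (FM^~ r)) ?subr_ge0//.
  by rewrite heatE.
- exact: measurableT.
- by apply: continuous_itv_integrable_leb; exact: (continuous_fix1 (F := K) (x := z) cK).
- rewrite -[leRHS](integral_prob_cst (gauss R n) M%:E).
  apply: ge0_le_integral => //.
  + apply/measurable_EFinP; apply: measurableT_comp => //.
    by apply: continuous_measurable_rV; exact: (continuous_fix2 (F := K) (s := r) cK).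
  + by move=> z _; rewrite lee_fin; exact: (heat_le _ _ (measurable_source cF r)).
Qed.

(** The time integral is cut at [s]: by [heat_duh], the part before [s] is the earlier Duhamel term
    transported by [heat t]. *)
Lemma duh_restart t s x : 0 <= t -> 0 <= s ->
  duh F x (s + t) = heat t (duh F ^~ s) x + duh (fun y r => F y (s + r)) x t.
Proof.
move=> t0 s0; rewrite duhE ?addr_ge0// heat_duh//.
have ck := continuous_fix1 (F := fun x r => heat (s + t - r) (F ^~ r) x) (x := x) (@duh_integrand_continuous (s + t)).
have sst : s <= s + t by rewrite lerDl.
rewrite (Rintegral_leb_cat s0 sst ck) (duh_shiftE x sst) [X in duh _ _ X](_ : _ = t); last by rewrite [s + t]addrC addrK.
by rewrite [s + t]addrC.
Qed.

End restart.

Lemma Rintegral_sum d (T : measurableType d) (R : realType) (mu : {measure set T -> \bar R})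
    (D : set T) (I : Type) (s : seq I) (f : I -> T -> R) : measurable D ->
  (forall i, mu.-integrable D (EFin \o f i)) ->
  mu.-integrable D (EFin \o (fun x => \sum_(i <- s) f i x)) /\
  \int[mu]_(x in D) (\sum_(i <- s) f i x) = \sum_(i <- s) \int[mu]_(x in D) f i x.
Proof.
move=> mD fi; elim: s => [|i s [IH1 IH2]].
  rewrite (_ : (fun x => _) = cst 0); last by apply/funext => x; rewrite big_nil.
  split; first exact: integrable0.
  by rewrite big_nil /Rintegral integral0.
have E : (fun x => \sum_(j <- i :: s) f j x) = (fun x => f i x + \sum_(j <- s) f j x).
  by apply/funext => x; rewrite big_cons.
rewrite E big_cons -IH2; split; last first.
  by rewrite -(RintegralD mD (fi i) IH1).
exact: (integrableD mD (fi i) IH1).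
Qed.

Lemma continuous_sumR (T : topologicalType) (R : realType) (I : Type) (s : seq I)
    (f : I -> T -> R) : (forall i, continuous (f i)) ->
  continuous (fun x => \sum_(i <- s) f i x : R).
Proof.
move=> cf x; elim: s => [|i s IH].
  by rewrite (_ : (fun _ => _) = cst 0); [exact: cvg_cst|apply/funext => y; rewrite big_nil].
rewrite (_ : (fun _ => _) = (fun y => f i y + \sum_(j <- s) f j y)); last first.
  by apply/funext => y; rewrite big_cons.
by apply: cvgD; [exact: cf|exact: IH].
Qed.

Lemma cvg_is_derive (R : realType) (f : R -> R) (x l : R) :
  h^-1 * (f (h + x) - f x) @[h --> (0 : R)^'] --> l -> is_derive x (1 : R) f l.
Proof.
have E : (fun h : R => h^-1 *: ((f \o shift x) (h *: (1 : R)) - f x)) =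
    (fun h => h^-1 * (f (h + x) - f x)).
  by apply/funext => h; rewrite /= /GRing.scale/= mulr1.
move=> H; apply: DeriveDef; first by rewrite /derivable E; exact: cvgP H.
by rewrite /derive E; exact: cvg_lim H.
Qed.

(** * Directional derivatives and the generator of the heat semigroup *)

Section chain_rule.
Variables (R : realType) (n : nat).
Implicit Types (x y z : 'rV[R]_n) (f g w : 'rV[R]_n -> R) (i : 'I_n) (h c eps : R).
Notation ee i := (delta_mx 0 i : 'rV[R]_n).
Let mI (a b : R) : measurable (`[a, b] : set R). Proof. exact: measurable_itv. Qed.

(** A mean value estimate for increments of either sign; for [h < 0] the end points are exchanged,
    since [antider] covers [h >= 0] only. *)
Lemma antider_near i f g x h c eps : continuous g -> antider i f g ->
  (forall s, `|s| <= `|h| -> `|g (x + s *: ee i) - c| <= eps) ->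
  `|f (x + h *: ee i) - f x - h * c| <= `|h| * eps.
Proof.
move=> cg fg.
have pos y a : 0 <= a -> (forall s, 0 <= s <= a -> `|g (y + s *: ee i) - c| <= eps) ->
    `|f (y + a *: ee i) - f y - a * c| <= a * eps.
  move=> a0 H; rewrite fg//.
  have cG := continuous_on_line (i := i) (x := y) cg.
  have cc : continuous (fun _ : R => c : R) by move=> ?; exact: cvg_cst.
  have := Rintegral_leb_cst c a0; rewrite subr0 => <-.
  rewrite -(RintegralB (mI 0 a) (continuous_itv_integrable_leb 0 a cG) (continuous_itv_integrable_leb 0 a cc)).
  have cGc : continuous (fun s : R => g (y + s *: ee i) - c : R).
    by move=> s; apply: cvgB; [exact: cG|exact: cvg_cst].
  by have := le_normr_Rintegral_leb a0 cGc H; rewrite subr0.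
have [h0|h0] := leP 0 h => H.
  rewrite (ger0_norm h0) in H *; apply: pos => // s /andP[s0 sh].
  by apply: H; rewrite ger0_norm.
have nh0 : 0 <= - h by rewrite oppr_ge0 ltW.
rewrite (ltr0_norm h0) in H *.
have := pos (x + h *: ee i) (- h) nh0.
rewrite scaleNr addrK mulNr => H1.
rewrite -normrN opprB (_ : h * c - _ = f x - f (x + h *: ee i) - - (h * c)); last by ring.
apply: H1 => s /andP[s0 sh]; rewrite -addrA -scalerDl; apply: H.
by rewrite ler_norml; apply/andP; split; lra.
Qed.

(** The corners of a path from [0] to [z] that changes one coordinate at a time. *)
Definition trunc k z : 'rV[R]_n := \row_j (if (j < k)%N then z 0 j else 0).

Lemma trunc0 z : trunc 0 z = 0.
Proof. by apply/rowP => j; rewrite !mxE. Qed.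

Lemma truncn z : trunc n z = z.
Proof. by apply/rowP => j; rewrite !mxE ltn_ord. Qed.

Lemma truncS i z : trunc i.+1 z = trunc i z + z 0 i *: ee i.
Proof.
apply/rowP => j; rewrite !mxE eqxx/= ltnS leq_eqVlt.
have [->|ji] := eqVneq j i; first by rewrite !eqxx ltnn/= add0r mulr1.
by rewrite (_ : (val j == val i) = false) ?mulr0 ?addr0//; exact/negbTE.
Qed.

Variables (w : 'rV[R]_n -> R) (V : 'I_n -> 'rV[R]_n -> R).
Hypotheses (cV : forall i, continuous (V i)) (wV : forall i, antider i w (V i)).

(** The increment telescopes along the path through [trunc k z]. Each leg is parallel to an axis and
    stays within [r] of [y], so [antider_near] applies to it. *)
Let dir_near y z h eps (r : R) : 0 < r ->
  (forall i y', ball y r y' -> `|V i y' - V i y| <= eps) ->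
  `|h| * (\sum_i `|z 0 i|) < r ->
  `|w (y + h *: z) - w y - h * \sum_i z 0 i * V i y| <= `|h| * (\sum_i `|z 0 i|) * eps.
Proof.
move=> r0 H hr; pose g k := w (y + h *: trunc k z).
have zj j : `|z 0 j| <= \sum_i `|z 0 i|.
  by rewrite (bigD1 j)//= lerDl sumr_ge0.
have -> : w (y + h *: z) - w y = \sum_(k < n) (g k.+1 - g k).
  rewrite -(big_mkord xpredT (fun k => g k.+1 - g k)) telescope_sumr// /g truncn.
  by rewrite trunc0 scaler0 addr0.
rewrite mulr_sumr -sumrB mulr_sumr mulr_suml; apply: (le_trans (ler_norm_sum _ _ _)).
apply: ler_sum => k _; rewrite /g truncS scalerDr scalerA addrA mulrA -normrM.
apply: (antider_near (@cV k) (@wV k)) => s sh; apply: H.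
split => // a j; rewrite ord1 /ball/= /ball_ !mxE eqxx/=.
have hz : `|h * z 0 j| < r.
  by rewrite normrM; apply: le_lt_trans hr; apply: ler_wpM2l.
have [jk|jk] := eqVneq j k; rewrite ?mulr1 ?mulr0.
  rewrite jk ltnn mulr0 addr0 opprD addNKr normrN.
  by apply: le_lt_trans sh _; rewrite -jk.
rewrite addr0; case: ifP => _; first by rewrite opprD addNKr normrN.
by rewrite mulr0 addr0 subrr normr0.
Qed.

Lemma is_derive_dir y z : is_derive (0 : R) (1 : R) (fun h : R => w (y + h *: z)) (\sum_i z 0 i * V i y).
Proof.
set L := \sum_i _; apply: cvg_is_derive; apply/cvgrPdist_le => eps eps0.
pose B : R := \sum_i `|z 0 i|.
have B0 : 0 <= B by apply: sumr_ge0.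
(* [B] is zero when [z] is; [B + 1] avoids dividing by it. *)
have e0 : 0 < eps / (B + 1) by rewrite divr_gt0// ltr_wpDl.
have : \forall y' \near y, forall i, `|V i y' - V i y| <= eps / (B + 1).
  apply: (@filter_forall _ _ _ _ (nbhs_filter y)) => i; have /cvgrPdist_le/(_ _ e0) := @cV i y.
  by apply: filterS => y'; rewrite distrC.
move=> /nbhs_ballP[r /= r0 Hr].
near=> h.
have h0 : h != 0 by near: h; exact: nbhs_dnbhs_neq.
have hr : `|h| * B < r.
  apply: (@le_lt_trans _ _ (`|h| * (B + 1))); first by apply: ler_wpM2l => //; rewrite lerDl.
  rewrite -ltr_pdivlMr ?ltr_wpDl//; near: h; apply: dnbhs0_lt.
  by rewrite divr_gt0// ltr_wpDl.
have := dir_near r0 (fun i y' yy' => Hr y' yy' i) hr.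
rewrite scale0r !addr0 -/L -/B => H.
rewrite (_ : L - _ = - (h^-1 * (w (y + h *: z) - w y - h * L))); last by field.
rewrite normrN normrM normfV ler_pdivrMl ?normr_gt0//.
apply: (le_trans H); rewrite -mulrA; apply: ler_wpM2l => //.
by rewrite mulrA ler_pdivrMr ?ltr_wpDl// mulrDr mulr1 mulrC lerDl ltW.
Unshelve. all: by end_near. Qed.

Lemma dir_FTC x z c : 0 <= c ->
  w (x + c *: z) - w x = \int[leb R]_(r in `[0, c]) \sum_i z 0 i * V i (x + r *: z).
Proof.
move=> c0.
have cline i : continuous (fun r : R => z 0 i * V i (x + r *: z) : R).
  apply: continuous_mull => r; apply: (cvg_comp (fun r : R => x + r *: z) (V i)); last exact: cV.
  by apply: cvgD; [exact: cvg_cst|apply: cvgZr_tmp; exact: cvg_id].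
have cS := continuous_sumR (s := index_enum 'I_n) cline.
rewrite (Rintegral_leb (mI _ _)); last exact: continuous_measurable_leb.
rewrite (Rintegral_is_derive (F := fun r => w (x + r *: z)) c0 _ cS); first by rewrite scale0r addr0.
move=> s; have d0 := is_derive_dir (x + s *: z) z.
have ds : is_derive s (1 : R) (fun t : R => t - s) 1.
  by apply: is_derive_eq; rewrite subr0.
have d0' : is_derive (s - s) (1 : R) (fun t : R => w (x + s *: z + t *: z)) (\sum_i z 0 i * V i (x + s *: z)).
  by rewrite subrr.
have := is_derive1_comp (f := fun t : R => w (x + s *: z + t *: z)) (g := fun t : R => t - s) (x := s) d0' ds; rewrite mulr1.
congr is_derive; apply/funext => t /=; congr w.
by rewrite -addrA -scalerDl [s + _]addrC subrK.
Qed.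

End chain_rule.

Section generator.
Variables (R : realType) (n : nat).
Implicit Types (x y z : 'rV[R]_n) (i : 'I_n) (h c M : R).
Notation ee i := (delta_mx 0 i : 'rV[R]_n).
Notation G := (gauss R n).
Let mI (a b : R) : measurable (`[a, b] : set R). Proof. exact: measurable_itv. Qed.

Let i1 : G.-integrable setT (EFin \o (cst 1 : 'rV[R]_n -> R)).
Proof. exact: gauss_integrable_cst. Qed.

Let m1 : measurable_fun setT (cst 1 : 'rV[R]_n -> R). Proof. exact: measurable_cst. Qed.

Let mc i : measurable_fun setT (coordw i : 'rV[R]_n -> R). Proof. exact: measurable_coord. Qed.

Let ic i : G.-integrable setT (EFin \o (coordw i : 'rV[R]_n -> R)).
Proof. exact: gauss_integrable_coord. Qed.

(** Gaussian integration by parts. Both sides are continuous [i]-th derivatives in [x] of the same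
    function [c * avgw (cst 1) f x c], one with the derivative on the weight and one with it on
    [f]. *)
Lemma gauss_ibp i (f g : 'rV[R]_n -> R) M x c : 0 <= c -> continuous f ->
  continuous g -> (forall z, `|f z| <= M) -> (forall z, `|g z| <= M) -> antider i f g ->
  avgw (coordw i) f x c = c * avgw (cst 1) g x c.
Proof.
move=> c0 cf cg fM gM fg.
have cA := avgw_continuous1 (c := c) (mc i) (ic i) cf fM.
have cB := continuous_mull (k := c) (avgw_continuous1 (c := c) m1 i1 cg gM).
have A1 : antider i (fun y => c * avgw (cst 1) f y c) (fun y => avgw (coordw i) f y c).
  by move=> y h h0; rewrite -(avg_shift_identity i y h0 c0 cf fM) mulrBr.
have A2 : antider i (fun y => c * avgw (cst 1) f y c) (fun y => c * avgw (cst 1) g y c).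
  apply: antiderZ; first exact: (avgw_continuous1 (c := c) m1 i1 cg gM).
  exact: (antider_avgw c m1 i1 cf fM cg gM fg).
by have := antider_eq cA cB A1 A2 => /(congr1 (fun k => k x)).
Qed.

(** The fundamental theorem along the ray [r -> x + r * Z] leaves the weights [Z_i] in front of
    first derivatives; integration by parts trades each for a factor [r] and a second derivative. *)
Lemma avgw_sub (w : 'rV[R]_n -> R) (V W : 'I_n -> 'rV[R]_n -> R) M x c : 0 <= c ->
  continuous w -> (forall i, continuous (V i)) -> (forall i, continuous (W i)) ->
  (forall z, `|w z| <= M) -> (forall i z, `|V i z| <= M) -> (forall i z, `|W i z| <= M) ->
  (forall i, antider i w (V i)) -> (forall i, antider i (V i) (W i)) ->
  avgw (cst 1) w x c - w x =
  \int[leb R]_(r in `[0, c]) (r * \sum_i avgw (cst 1) (W i) x r).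
Proof.
move=> c0 cw cV cW wM VM WM wV VW.
have mw := continuous_measurable_rV cw.
have M0 : 0 <= M by exact: le_trans (normr_ge0 _) (wM 0).
pose K z (r : R) : R := \sum_i z 0 i * V i (x + r *: z).
have cK : continuous (fun q : 'rV[R]_n * R => K q.1 q.2).
  apply: (continuous_sumR (f := fun i (q : 'rV[R]_n * R) => q.1 0 i * V i (x + q.2 *: q.1))) => i q.
  apply: cvgM; first exact: (continuous_fstR (f := fun z : 'rV[R]_n => z 0 i) (@coord_continuous _ _ _ 0 i)).
  apply: (cvg_comp (fun q : 'rV[R]_n * R => x + q.2 *: q.1) (V i)); last exact: cV.
  by apply: cvgD; [exact: cvg_cst|apply: cvgZ; [exact: cvg_snd|exact: cvg_fst]].
transitivity (\int[G]_z \int[leb R]_(r in `[0, c]) K z r).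
  have -> : avgw (cst 1) w x c - w x = \int[G]_z (w (x + c *: z) - w x).
    rewrite (RintegralB measurableT (heat_integrable x c mw wM) (gauss_integrable_cst n (w x))) gauss_cst.
    by congr (_ - _); apply: eq_Rintegral => z _; rewrite /= mul1r.
  by apply: eq_Rintegral => z _; rewrite (dir_FTC cV wV x z c0).
have icV i r := avgw_integrable x r (mc i) (ic i) (continuous_measurable_rV (cV i)) (VM i).
have iabs : G.-integrable setT (EFin \o (fun z : 'rV[R]_n => \sum_i M * `|z 0 i|)).
  apply: (Rintegral_sum (index_enum 'I_n) measurableT _).1 => i.
  exact: (integrableZl measurableT M (integrable_norm (ic i))).
rewrite (@Rintegral_swap _ _ _ G setT K 0 c (\int[G]_z \sum_i M * `|z 0 i|)) => [|||z _|r _].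
- apply: eq_Rintegral => r /set_mem; rewrite /= in_itv/= => /andP[r0 _].
  rewrite (Rintegral_sum (index_enum 'I_n) measurableT (fun i => icV i r)).2 mulr_sumr.
  by apply: eq_bigr => i _; rewrite -(gauss_ibp x r0 (cV i) (cW i) (VM i) (WM i) (VW i)).
- exact: measurableT.
- exact: continuous_measurable_rVR.
- by apply: continuous_itv_integrable_leb; exact: (continuous_fix1 (F := K) (x := z) cK).
- rewrite /Rintegral fineK; last exact: (integrable_fin_num measurableT iabs).
  apply: ge0_le_integral => //.
  + apply/measurable_EFinP; apply: measurableT_comp => //.
    by apply: continuous_measurable_rV; exact: (continuous_fix2 (F := K) (s := r) cK).
  + exact: (measurable_int G iabs).
  + move=> z _; rewrite lee_fin; apply: (le_trans (ler_norm_sum _ _ _)).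
    by apply: ler_sum => i _; rewrite normrM mulrC; apply: ler_wpM2r.
Qed.

End generator.

(** * Mild solutions are classical *)

Lemma continuous_addR (T : topologicalType) (R : realType) (f g : T -> R) :
  continuous f -> continuous g -> continuous (fun x => f x + g x : R).
Proof. by move=> cf cg x; apply: cvgD; [exact: cf|exact: cg]. Qed.

Section spatial_gain.
Variables (R : realType) (n : nat).
Implicit Types (x y z : 'rV[R]_n) (i : 'I_n) (F H : 'rV[R]_n -> R -> R) (a b s t T K M : R).
Notation G := (gauss R n).
Let mI (a b : R) : measurable (`[a, b] : set R). Proof. exact: measurable_itv. Qed.

Let mc i : measurable_fun setT (coordw i : 'rV[R]_n -> R). Proof. exact: measurable_coord. Qed.

Let ic i : G.-integrable setT (EFin \o (coordw i : 'rV[R]_n -> R)).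
Proof. exact: gauss_integrable_coord. Qed.

(** Projection of time onto [[a, b]]. Composing with it extends a function known on that interval to
    a continuous bounded function of all times. *)
Definition clip a b s : R := Num.max a (Num.min b s).

Lemma clip_continuous a b : continuous (clip a b).
Proof.
move=> s; have E : clip a b = (fun s => 2^-1 * (a + 2^-1 * (b + s - `|b - s|) + `|a - 2^-1 * (b + s - `|b - s|)|)).
  apply/funext => r; rewrite /clip.
  have -> : Num.min b r = 2^-1 * (b + r - `|b - r|).
    rewrite minElt; case: ltP => br; [rewrite ltr0_norm ?subr_lt0//|rewrite ger0_norm ?subr_ge0//]; lra.
  set m := 2^-1 * _; rewrite maxElt; case: ltP => am; [rewrite ltr0_norm ?subr_lt0//|rewrite ger0_norm ?subr_ge0//]; lra.
rewrite E; have c1 : continuous (fun s : R => 2^-1 * (b + s - `|b - s|) : R).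
  move=> r; apply: cvgMl_tmp; apply: cvgB; first by apply: cvgD; [exact: cvg_cst|exact: cvg_id].
  by apply: cvg_norm; apply: cvgB; [exact: cvg_cst|exact: cvg_id].
apply: cvgMl_tmp; apply: cvgD; first by apply: cvgD; [exact: cvg_cst|exact: c1].
by apply: cvg_norm; apply: cvgB; [exact: cvg_cst|exact: c1].
Qed.

Lemma clip_itv a b s : a <= b -> a <= clip a b s <= b.
Proof. by move=> ab; rewrite /clip le_max lexx/= ge_max ab ge_min lexx. Qed.

Lemma clip_id a b s : a <= s <= b -> clip a b s = s.
Proof.
move=> /andP[sa sb]; rewrite /clip.
by rewrite (min_idPr sb) (max_idPr sa).
Qed.

(** Only the source on [[0, t]] enters the Duhamel term, since [t * (1 - th ^+ 2)] stays there; this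
    is what makes clipping harmless. *)
Lemma duh_ext F H x t : 0 <= t -> (forall y s, 0 <= s <= t -> F y s = H y s) ->
  duh F x t = duh H x t.
Proof.
move=> t0 FH; rewrite /duh /duhw; apply: (congr1 (fun r => 2 * t * r)).
apply: eq_Rintegral => th /set_mem; rewrite /= in_itv/= => /andP[th0 th1].
apply: (congr1 (fun r => th * r)); rewrite /avgw; apply: eq_Rintegral => z _.
have th2 : th ^+ 2 <= 1 by rewrite expr_le1.
apply: (congr1 (fun r => cst 1 z * r)); apply: FH; rewrite mulr_ge0 ?subr_ge0//=.
by rewrite ler_piMr// gerBl sqr_ge0.
Qed.

(** The constant [2 * t] instead of [t] comes from bounding [th] by [1] under the integral; only its
    smallness with [t] matters. *)
Lemma duh_le F M x t : 0 <= t -> continuous (fun q => F q.1 q.2) ->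
  (forall z s, `|F z s| <= M) -> `|duh F x t| <= 2 * t * M.
Proof.
move=> t0 cF FM; rewrite /duh normrM ger0_norm ?mulr_ge0//; apply: ler_wpM2l; first by rewrite mulr_ge0.
have m1 : measurable_fun setT (cst 1 : 'rV[R]_n -> R) by exact: measurable_cst.
have i1 : G.-integrable setT (EFin \o (cst 1 : 'rV[R]_n -> R)) by exact: gauss_integrable_cst.
have := duhw_le cF FM x t m1 i1 (k := id).
under eq_Rintegral do rewrite /= normr1.
rewrite gauss_cst mulr1; apply; first by move=> ?; exact: cvg_id.
by move=> th /andP[th0 th1]; rewrite ger0_norm.
Qed.

(* The gradient of [heat s g] blows up as [s] tends to [0]; clipping [s] at [e]
   keeps it bounded. *)
Lemma spatial_gain i (g : 'rV[R]_n -> R) H K (e T : R) : 0 < e -> e <= T ->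
  continuous g -> (forall z, `|g z| <= K) ->
  continuous (fun q => H q.1 q.2) -> (forall z s, `|H z s| <= K) ->
  exists U K', [/\ continuous (fun q => U q.1 q.2), (forall z s, `|U z s| <= K') &
    forall s, e <= s <= T -> antider i (fun x => heat s g x + duh H x s) (U ^~ s)].
Proof.
move=> e0 eT cg gK cH HK.
have K0 : 0 <= K by exact: le_trans (normr_ge0 _) (gK 0).
have T0 : 0 < T by exact: lt_le_trans eT.
have cl0 s : 0 < clip e T s by have /andP[+ _] := clip_itv s eT; exact: lt_le_trans.
pose U x s := heat1 i (clip e T s) g x + duh1 i H x (clip e T s).
have ccl : continuous (fun q : 'rV[R]_n * R => clip e T q.2).
  exact: (continuous_sndR (@clip_continuous e T)).
have csq : continuous (fun q : 'rV[R]_n * R => Num.sqrt (2 * clip e T q.2)).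
  move=> q; apply: (cvg_comp (fun q : 'rV[R]_n * R => 2 * clip e T q.2) Num.sqrt); last exact: sqrt_continuous.
  by apply: cvgMl_tmp; exact: ccl.
pose C := \int[G]_z `|coordw i z|.
have C0 : 0 <= C by apply: Rintegral_ge0.
have cG : continuous (fun q : 'rV[R]_n * R => g q.1) by exact: continuous_fstR.
exists U, ((Num.sqrt (2 * e))^-1 * (K * C) + Num.sqrt (2 * T) * (K * C)); split.
- have c1 := duh1_continuous cH HK (i := i).
  move=> q; apply: cvgD; last first.
    apply: (cvg_comp2 (F := duh1 i H) (a := fst) (b := fun q : 'rV[R]_n * R => clip e T q.2) c1).
      exact: cvg_fst.
    exact: ccl.
  apply: cvgM; first by apply: cvgV; [rewrite gt_eqF// sqrtr_gt0 mulr_gt0|exact: csq].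
  apply: (avgw_cvg (F := fun x _ => g x) cG (fun z _ => gK z) (a := fst) (b := fun q : 'rV[R]_n * R => Num.sqrt (2 * clip e T q.2)) (c := snd) (mc i) (ic i)).
  + exact: cvg_fst.
  + exact: csq.
  + exact: cvg_snd.
- move=> z s; rewrite /U; apply: (le_trans (ler_normD _ _)); apply: lerD.
    rewrite /heat1 normrM; apply: ler_pM => //; last exact: (avgw_le _ _ (mc i) (ic i) (continuous_measurable_rV cg)).
    rewrite ger0_norm ?invr_ge0 ?sqrtr_ge0// lef_pV2 ?posrE ?sqrtr_gt0 ?mulr_gt0//.
    by rewrite ler_wsqrtr// ler_pM2l//; have /andP[] := clip_itv s eT.
  rewrite /duh1 normrM; apply: ler_pM => //.
    rewrite ger0_norm ?sqrtr_ge0//.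
    by rewrite ler_wsqrtr// ler_pM2l//; have /andP[] := clip_itv s eT.
  apply: (duhw_le cH HK _ _ (mc i) (ic i)) => [th|th _]; first exact: cvg_cst.
  by rewrite normr1.
- move=> s sT; rewrite /U (clip_id sT); have s0 : 0 < s by case/andP: sT => + _; exact: lt_le_trans.
  apply: antiderD.
  + exact: (heat1_continuous cg gK).
  + exact: (continuous_fix2 (F := duh1 i H) (s := s) (duh1_continuous cH HK (i := i))).
  + exact: (antider_heat1 i s0 cg gK).
  + exact: (antider_duh cH HK i (ltW s0)).
Qed.

End spatial_gain.

Section mild_regularity.
Variables (R : realType) (n : nat).
Implicit Types (x y z : 'rV[R]_n) (i : 'I_n) (a b s t : R).
Variables (phi : 'rV[R]_n -> R) (f f' : R -> R) (v : 'rV[R]_n -> R -> R) (M K T : R).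
Hypotheses (cphi : continuous phi) (phiM : forall z, `|phi z| <= M).
Hypotheses (df : forall z : R, is_derive z (1 : R) f (f' z)) (cf' : continuous f').
Hypotheses (fK : forall z : R, `|z| <= M -> `|f z| <= K) (f'K : forall z : R, `|z| <= M -> `|f' z| <= K).
Hypotheses (cv : continuous (fun q => v q.1 q.2)) (vM : forall z s, `|v z s| <= M).
Hypothesis v_mild : forall x t, 0 <= t <= T ->
  v x t = heat t phi x + duh (fun y s => f (v y s)) x t.

Let F y s := f (v y s).

Let cf : continuous f.
Proof.
by move=> z; apply: differentiable_continuous; apply/derivable1_diffP; have [] := df z.
Qed.

Let cF : continuous (fun q => F q.1 q.2).
Proof. by move=> q; apply: (cvg_comp (fun q => v q.1 q.2) f); [exact: cv|exact: cf]. Qed.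

Let FK z s : `|F z s| <= K. Proof. exact: fK. Qed.

Let M0 : 0 <= M. Proof. exact: le_trans (normr_ge0 _) (vM 0 0). Qed.

Let K0 : 0 <= K. Proof. exact: le_trans (normr_ge0 _) (FK 0 0). Qed.

(** Semigroup law for the datum and [duh_restart] for the source: the solution at time [s] becomes
    the datum. *)
Lemma mild_restart s t x : 0 <= s -> 0 <= t -> s + t <= T ->
  v x (s + t) = heat t (v ^~ s) x + duh (fun y r => F y (s + r)) x t.
Proof.
move=> s0 t0 stT; have st0 : 0 <= s + t <= T by rewrite addr_ge0.
have sT : 0 <= s <= T by rewrite s0/=; apply: le_trans stT; rewrite lerDl.
rewrite (v_mild x st0) -/F (duh_restart cF FK x t0 s0) addrA; congr (_ + _).
have cF2 := continuous_fix2 (F := duh F) (s := s) (duh_continuous cF FK).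
rewrite [s + t]addrC -(heat_comp x t0 s0 (continuous_measurable_rV cphi) phiM).
rewrite (_ : v ^~ s = (fun y => heat s phi y + duh F y s)); last first.
  by apply/funext => y; exact: v_mild.
have sK : 0 <= 2 * s * K by rewrite !mulr_ge0.
have hM z : `|heat s phi z| <= M + 2 * s * K.
  apply: (le_trans (heat_le s z (continuous_measurable_rV cphi) phiM)).
  by rewrite lerDl.
have dM z : `|duh F z s| <= M + 2 * s * K.
  apply: (le_trans (duh_le z s0 cF FK)); by rewrite lerDr.
have cH := avgw_continuous1 (c := Num.sqrt (2 * s)) (measurable_cst _) (gauss_integrable_cst n 1) cphi phiM.
exact: esym (heatD _ _ (continuous_measurable_rV cH) hM (continuous_measurable_rV cF2) dM).
Qed.

(** Two rounds of [spatial_gain]. The first gives a gradient [U] after time [e]. Differentiating the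
    equation restarted at [e] shows that [U] solves a linear equation of the same shape, with datum
    [U ^~ e] and the continuous source [f' (v) * U], so a second round differentiates [U]. *)
Lemma mild_twice i a : 0 < a -> a <= T -> exists V W C,
  [/\ continuous (fun q : 'rV[R]_n * R => V q.1 q.2), continuous (fun q : 'rV[R]_n * R => W q.1 q.2),
   (forall z s, `|V z s| <= C) /\ (forall z s, `|W z s| <= C),
   (forall t, a <= t <= T -> antider i (v ^~ t) (V ^~ t)) &
   (forall t, a <= t <= T -> antider i (V ^~ t) (W ^~ t))].
Proof.
(* Half of the waiting time for each of the two derivatives. *)
move=> a0 aT; pose e := a / 2.
have e0 : 0 < e by rewrite divr_gt0.
have ea : e + e = a by rewrite /e; lra.
have eT : e <= T by apply: le_trans aT; rewrite -ea lerDl ltW.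
pose N := M + K; have phiN z : `|phi z| <= N by apply: le_trans (phiM z) _; rewrite lerDl.
have FN z s : `|F z s| <= N by apply: le_trans (FK z s) _; rewrite lerDr.
have [U [K1 [cU UK1 aU]]] := spatial_gain i e0 eT cphi phiN cF FN.
have vU t : e <= t <= T -> antider i (v ^~ t) (U ^~ t).
  move=> /[dup] et /andP[et1 et2].
  rewrite (_ : v ^~ t = (fun x => heat t phi x + duh F x t)); first exact: aU.
  by apply/funext => y; apply: v_mild; rewrite et2 (le_trans _ et1)// ltW.
(* Clock of the equation restarted at [e], clipped so that its source is differentiable in space at
   every [s], not only while [e + s <= T]. *)
pose c s := clip e T (e + s).
have ccl : continuous (fun q : 'rV[R]_n * R => c q.2).
  apply: (continuous_sndR (f := c)) => s; apply: (cvg_comp (fun s => e + s) (clip e T)); last exact: clip_continuous.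
  by apply: cvgD; [exact: cvg_cst|exact: cvg_id].
have cvc : continuous (fun q : 'rV[R]_n * R => v q.1 (c q.2)).
  by move=> q; apply: (cvg_comp2 (F := v) (a := fst) (b := fun q : 'rV[R]_n * R => c q.2) cv); [exact: cvg_fst|exact: ccl].
have cUc : continuous (fun q : 'rV[R]_n * R => U q.1 (c q.2)).
  by move=> q; apply: (cvg_comp2 (F := U) (a := fst) (b := fun q : 'rV[R]_n * R => c q.2) cU); [exact: cvg_fst|exact: ccl].
pose F2 y s : R := f (v y (c s)).
pose F2i y s : R := f' (v y (c s)) * U y (c s).
have cF2 : continuous (fun q => F2 q.1 q.2).
  by move=> q; apply: (cvg_comp (fun q : 'rV[R]_n * R => v q.1 (c q.2)) f); [exact: cvc|exact: cf].
have cF2i : continuous (fun q => F2i q.1 q.2).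
  move=> q; apply: cvgM; last exact: cUc.
  by apply: (cvg_comp (fun q : 'rV[R]_n * R => v q.1 (c q.2)) f'); [exact: cvc|exact: cf'].
have K10 : 0 <= K1 by exact: le_trans (normr_ge0 _) (UK1 0 0).
have KK1 : 0 <= K * K1 by rewrite mulr_ge0.
have M0_ := M0; have K0_ := K0.
pose N2 := K + K * K1 + K1 + M.
have F2N y s : `|F2 y s| <= N2.
  by apply: le_trans (fK (vM _ _)) _; rewrite /N2; lra.
have F2iN y s : `|F2i y s| <= N2.
  rewrite /F2i normrM; apply: (@le_trans _ _ (K * K1)); last by rewrite /N2; lra.
  by apply: ler_pM => //; exact: f'K.
have UN2 z s : `|U z s| <= N2 by apply: le_trans (UK1 z s) _; rewrite /N2; lra.
have vN2 z s : `|v z s| <= N2 by apply: le_trans (vM z s) _; rewrite /N2; lra.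
have cle s : e <= c s <= T by exact: clip_itv.
have F2F2i s : antider i (F2 ^~ s) (F2i ^~ s).
  apply: is_derive_antider; first exact: (continuous_fix2 (F := F2i) (s := s) cF2i).
  move=> x; apply/is_derive_line.
  have cUs := continuous_fix2 (F := U) (s := c s) cU.
  have /is_derive_line d1 := antider_is_derive cUs (vU _ (cle s)) x.
  have df1 : is_derive (v (x + 0 *: (delta_mx 0 i : 'rV[R]_n)) (c s)) (1 : R) f (f' (v x (c s))).
    by rewrite scale0r addr0.
  exact: (is_derive1_comp (f := f) (g := fun h : R => v (x + h *: (delta_mx 0 i : 'rV[R]_n)) (c s)) (x := 0) df1 d1).
(* Both sides are continuous [i]-th derivatives of [v ^~ (e + t)], hence equal. *)
have UE t : 0 <= t -> e + t <= T ->
    U ^~ (e + t) = (fun x => heat t (U ^~ e) x + duh F2i x t).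
  move=> t0 etT; have eet : e <= e + t <= T by rewrite lerDl t0.
  have cUe := continuous_fix2 (F := U) (s := e) cU.
  have cve := continuous_fix2 (F := v) (s := e) cv.
  have ee : e <= e <= T by rewrite lexx.
  have cH : continuous (fun x => heat t (U ^~ e) x).
    exact: (avgw_continuous1 (measurable_cst _) (gauss_integrable_cst n 1) cUe (UN2 ^~ e)).
  have cD := continuous_fix2 (F := duh F2i) (s := t) (duh_continuous cF2i F2iN).
  apply: (antider_eq (i := i) (f := v ^~ (e + t))).
  - exact: (continuous_fix2 (F := U) (s := e + t) cU).
  - exact: continuous_addR.
  - exact: vU.
  - rewrite (_ : v ^~ (e + t) = (fun x => heat t (v ^~ e) x + duh F2 x t)); last first.
      apply/funext => x; rewrite (mild_restart x (ltW e0) t0 etT); congr (_ + _).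
      apply: duh_ext => // y s /andP[s0 st]; rewrite /F2 /F /c clip_id//.
      by rewrite lerDl s0/= (le_trans _ etT)// lerD2l.
    apply: antiderD => //.
    + exact: (antider_heat t cve (vN2 ^~ e) cUe (UN2 ^~ e) (vU _ ee)).
    + exact: (antider_duh_trans cF2 F2N t0 cF2i F2iN F2F2i).
have eTe : e <= T - e by rewrite lerBrDr ea.
have cUe := continuous_fix2 (F := U) (s := e) cU.
have [W [K2 [cW WK2 aW]]] := spatial_gain i e0 eTe cUe (UN2 ^~ e) cF2i F2iN.
(* The time of [W] is counted from the restart at [e]. *)
exists U, (fun x t => W x (t - e)), (K1 + K2).
have K20 : 0 <= K2 by exact: le_trans (normr_ge0 _) (WK2 0 0).
split => //.
- move=> q; apply: (cvg_comp2 (F := W) (a := fst) (b := fun q : 'rV[R]_n * R => q.2 - e) cW); first exact: cvg_fst.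
  by apply: cvgB; [exact: cvg_snd|exact: cvg_cst].
- split=> z s; first by apply: le_trans (UK1 z s) _; rewrite lerDl.
  by apply: le_trans (WK2 z _) _; rewrite lerDr.
- move=> t /andP[t1 t2]; apply: vU; rewrite t2 andbT; apply: le_trans t1.
  by rewrite -ea lerDl ltW.
- move=> t /andP[t1 t2].
  have te : 0 <= t - e by rewrite subr_ge0; apply: le_trans t1; rewrite -ea lerDl ltW.
  have ett : e + (t - e) = t by rewrite addrC subrK.
  have := UE (t - e) te; rewrite ett => /(_ t2) ->.
  by apply: aW; rewrite lerB// andbT lerBrDr ea.
Qed.

End mild_regularity.

Section time_derivative.
Variables (R : realType) (n : nat).
Implicit Types (x y z : 'rV[R]_n) (i : 'I_n) (a b s t : R).
Let mI (a b : R) : measurable (`[a, b] : set R). Proof. exact: measurable_itv. Qed.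

(** The integral of [r] over [[0, c]] is [c ^+ 2 / 2], which is [h] for [c = sqrt (2 * h)]: this
    matches the formula of [avgw_sub] with a time increment. *)
Lemma Rintegral_lin_near (g : R -> R) (g0 c eps : R) : 0 <= c -> continuous g ->
  (forall r, 0 <= r <= c -> `|g r - g0| <= eps) ->
  `|\int[leb R]_(r in `[0, c]) (r * g r) - c ^+ 2 / 2 * g0| <= c ^+ 2 / 2 * eps.
Proof.
move=> c0 cg H.
have crk (k : R) : continuous (fun r : R => r * k : R).
  by move=> r; apply: cvgMr_tmp; exact: cvg_id.
have intk (k : R) : \int[leb R]_(r in `[0, c]) (r * k) = c ^+ 2 / 2 * k.
  rewrite (Rintegral_leb (mI _ _)); last exact: continuous_measurable_leb.
  have dk (r : R) : is_derive r (1 : R) (fun r : R => k / 2 * (r * r)) (r * k).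
    by apply: is_derive_eq; rewrite /GRing.scale/=; field.
  by rewrite (Rintegral_is_derive c0 dk (crk k)); field.
have crg : continuous (fun r : R => r * g r : R).
  by move=> r; apply: cvgM; [exact: cvg_id|exact: cg].
have crgk : continuous (fun r : R => r * (g r - g0) : R).
  by move=> r; apply: cvgM; [exact: cvg_id|apply: cvgB; [exact: cg|exact: cvg_cst]].
rewrite -(intk g0) -(RintegralB (mI 0 c) (continuous_itv_integrable_leb 0 c crg) (continuous_itv_integrable_leb 0 c (crk g0))).
under eq_Rintegral do rewrite -mulrBr.
apply: (le_trans (le_normr_Rintegral (mI 0 c) (continuous_itv_integrable_leb 0 c crgk))).
rewrite -(intk eps); apply: le_Rintegral.
- exact: mI.
- by apply: continuous_itv_integrable_leb => r; apply: cvg_norm; exact: crgk.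
- exact: (continuous_itv_integrable_leb 0 c (crk eps)).
- move=> r; rewrite /= in_itv/= => /andP[r0 rc]; rewrite normrM ger0_norm//.
  by apply: ler_wpM2l => //; apply: H; rewrite r0.
Qed.

Variables (phi : 'rV[R]_n -> R) (f f' : R -> R) (v : 'rV[R]_n -> R -> R) (M K T : R).
Hypotheses (cphi : continuous phi) (phiM : forall z, `|phi z| <= M).
Hypotheses (df : forall z : R, is_derive z (1 : R) f (f' z)) (cf' : continuous f').
Hypotheses (fK : forall z : R, `|z| <= M -> `|f z| <= K) (f'K : forall z : R, `|z| <= M -> `|f' z| <= K).
Hypotheses (cv : continuous (fun q => v q.1 q.2)) (vM : forall z s, `|v z s| <= M).
Hypothesis v_mild : forall x t, 0 <= t <= T ->
  v x t = heat t phi x + duh (fun y s => f (v y s)) x t.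

Let F y s := f (v y s).

Let cf : continuous f.
Proof.
by move=> z; apply: differentiable_continuous; apply/derivable1_diffP; have [] := df z.
Qed.

Let cF : continuous (fun q => F q.1 q.2).
Proof. by move=> q; apply: (cvg_comp (fun q => v q.1 q.2) f); [exact: cv|exact: cf]. Qed.

Let FK z s : `|F z s| <= K. Proof. exact: fK. Qed.

Let M0 : 0 <= M. Proof. exact: le_trans (normr_ge0 _) (vM 0 0). Qed.

(** First-order expansion over [[s, s + h]] with [h >= 0], uniform for [s] near [t]. Leaving [s]
    free is what gives the left derivative too, although the semigroup only runs forward. *)
Let increment x t a C (V W : 'I_n -> 'rV[R]_n -> R -> R) eps :
  0 <= a -> M <= C ->
  (forall i, continuous (fun q : 'rV[R]_n * R => V i q.1 q.2)) ->
  (forall i, continuous (fun q : 'rV[R]_n * R => W i q.1 q.2)) ->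
  (forall i z s, `|V i z s| <= C) -> (forall i z s, `|W i z s| <= C) ->
  (forall i t, a <= t <= T -> antider i (v ^~ t) (V i ^~ t)) ->
  (forall i t, a <= t <= T -> antider i (V i ^~ t) (W i ^~ t)) ->
  0 < eps ->
  exists2 d, 0 < d & forall s h, 0 <= h < d -> `|s - t| < d -> a <= s -> s + h <= T ->
    `|v x (s + h) - v x s - h * (\sum_i W i x t + F x t)| <= h * eps.
Proof.
move=> a0 MC cV cW VC WC vV VW eps0.
have e2 : 0 < eps / 2 by rewrite divr_gt0.
have m1 : measurable_fun setT (cst 1 : 'rV[R]_n -> R) by exact: measurable_cst.
pose S (r s : R) : R := \sum_i avgw (cst 1) (W i ^~ s) x r.
have cS : continuous (fun q : R * R => S q.1 q.2).
  apply: (continuous_sumR (f := fun i (q : R * R) => avgw (cst 1) (W i ^~ q.2) x q.1)) => i q.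
  apply: (avgw_cvg (cW i) (WC i) (a := fun=> x) (b := fst) (c := snd) m1 (gauss_integrable_cst n 1)).
  - exact: cvg_cst.
  - exact: cvg_fst.
  - exact: cvg_snd.
have S0 : S 0 t = \sum_i W i x t.
  apply: eq_bigr => i _; rewrite /avgw; under eq_Rintegral do rewrite scale0r addr0 /= mul1r.
  exact: gauss_cst.
pose D (b r : R) : R := heat (b - r) (F ^~ r) x.
have cD : continuous (fun q : R * R => D q.1 q.2).
  move=> q; apply: (heat_cvg cF FK (a := fun=> x) (b := fun q : R * R => q.1 - q.2) (c := snd)).
  - exact: cvg_cst.
  - by apply: cvgB; [exact: cvg_fst|exact: cvg_snd].
  - exact: cvg_snd.
have D0 : D t t = F x t by rewrite /D subrr heat0.
have /cvgrPdist_le/(_ _ e2)/nbhs_ballP[d1 /= d10 H1] := cS (0, t).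
have /cvgrPdist_le/(_ _ e2)/nbhs_ballP[d2 /= d20 H2] := cD (t, t).
(* [d1 ^+ 2 / 2] forces [sqrt (2 * h) < d1], and [d2 / 2] keeps all of [[s, s + h]] within [d2] of
   [t]. *)
exists (Num.min d1 (Num.min (d1 ^+ 2 / 2) (d2 / 2))).
  by rewrite !lt_min d10 !divr_gt0// exprn_gt0.
move=> s h /andP[h0]; rewrite !lt_min => /and3P[hd1 hd12 hd2] /and3P[sd1 _ sd2] as_ shT.
have s0 : 0 <= s by exact: le_trans as_.
have sT : s <= T by apply: le_trans shT; rewrite lerDl.
pose c := Num.sqrt (2 * h).
have c2 : c ^+ 2 / 2 = h by rewrite sqr_sqrtr ?mulr_ge0//; field.
have c0 : 0 <= c by exact: sqrtr_ge0.
have cd1 : c < d1.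
  rewrite -(ltr_pXn2r (n := 2)) ?nnegrE// ?(ltW d10)// -(ltr_pM2r (x := 2^-1)) ?invr_gt0//.
  by rewrite c2.
have asT : a <= s <= T by rewrite as_.
have E1 : `|heat h (v ^~ s) x - v x s - h * S 0 t| <= h * (eps / 2).
  rewrite /heat -/c (@avgw_sub _ _ (v ^~ s) (fun i => V i ^~ s) (fun i => W i ^~ s) C x c c0); first last.
  - by move=> i; exact: VW.
  - by move=> i; exact: vV.
  - by move=> i z; exact: WC.
  - by move=> i z; exact: VC.
  - by move=> z; exact: le_trans (vM z s) MC.
  - by move=> i; exact: (continuous_fix2 (F := W i) (s := s) (cW i)).
  - by move=> i; exact: (continuous_fix2 (F := V i) (s := s) (cV i)).
  - exact: (continuous_fix2 (F := v) (s := s) cv).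
  rewrite -c2; apply: (Rintegral_lin_near (g := S ^~ s)) => //.
    exact: (continuous_fix2 (F := S) (s := s) cS).
  move=> r /andP[r0 rc]; rewrite distrC; apply: (H1 (r, s)); split => /=.
    by rewrite /ball/= sub0r normrN ger0_norm//; exact: le_lt_trans cd1.
  by rewrite /ball/= distrC.
have E2 : `|duh (fun y r => F y (s + r)) x h - h * F x t| <= h * (eps / 2).
  have ssh : s <= s + h by rewrite lerDl.
  have := duh_shiftE cF FK x ssh; rewrite [s + h - s]addrC addKr => <-.
  have cDs : continuous (D (s + h)) by exact: (continuous_fix1 (F := D) (x := s + h) cD).
  have cc : continuous (fun _ : R => F x t : R) by move=> ?; exact: cvg_cst.
  have := Rintegral_leb_cst (F x t) ssh; rewrite [s + h - s]addrC addKr => <-.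
  rewrite -(RintegralB (mI s (s + h)) (continuous_itv_integrable_leb _ _ cDs) (continuous_itv_integrable_leb _ _ cc)).
  have cDc : continuous (fun r : R => D (s + h) r - F x t : R).
    by move=> r; apply: cvgB; [exact: cDs|exact: cvg_cst].
  have := @le_normr_Rintegral_leb R _ s (s + h) (eps / 2) ssh cDc.
  rewrite [s + h - s]addrC addKr; apply => r /andP[sr rs].
  rewrite -D0 distrC; apply: (H2 (s + h, r)); split; rewrite /ball/= /ball_/=.
    move: hd2 sd2; rewrite !ltr_norml => ? /andP[? ?]; apply/andP; split; lra.
  move: hd2 sd2; rewrite !ltr_norml => ? /andP[? ?]; apply/andP; split; lra.
rewrite (mild_restart cphi phiM df fK cv vM v_mild x s0 h0 shT) -/F -S0.
have -> : heat h (v ^~ s) x + duh (fun y r => F y (s + r)) x h - v x s - h * (S 0 t + F x t) =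
  (heat h (v ^~ s) x - v x s - h * S 0 t) + (duh (fun y r => F y (s + r)) x h - h * F x t) by ring.
apply: (le_trans (ler_normD _ _)).
by rewrite (_ : h * eps = h * (eps / 2) + h * (eps / 2)); [exact: lerD|field].
Qed.

Lemma mild_classical x t : 0 < t < T ->
  [/\ derivable (v x) t 1, twice_derivable (v ^~ t) x &
      derive1 (v x) t = laplacian (v ^~ t) x + f (v x t)].
Proof.
move=> /andP[t0 tT]; pose a := t / 2.
have a0 : 0 < a by rewrite divr_gt0.
have at_ : a < t by rewrite /a; lra.
have aT : a <= T by apply: ltW; exact: lt_trans tT.
have /choice[V /choice[W /choice[C HC]]] := fun i => mild_twice cphi phiM df cf' fK f'K cv vM v_mild i a0 aT.
have C0 i : 0 <= C i by have [_ _ [H _] _ _] := HC i; exact: le_trans (normr_ge0 _) (H 0 0).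
pose C' := M + \sum_i C i.
have CC' i : C i <= C'.
  by rewrite /C' (bigD1 i)//= addrCA lerDl addr_ge0 ?M0// sumr_ge0.
have cV i : continuous (fun q : 'rV[R]_n * R => V i q.1 q.2) by have [] := HC i.
have cW i : continuous (fun q : 'rV[R]_n * R => W i q.1 q.2) by have [] := HC i.
have VC i z s : `|V i z s| <= C' by have [_ _ [H _] _ _] := HC i; exact: le_trans (H z s) (CC' i).
have WC i z s : `|W i z s| <= C' by have [_ _ [_ H] _ _] := HC i; exact: le_trans (H z s) (CC' i).
have vV i s : a <= s <= T -> antider i (v ^~ s) (V i ^~ s) by have [_ _ _ H _] := HC i; exact: H.
have VW i s : a <= s <= T -> antider i (V i ^~ s) (W i ^~ s) by have [_ _ _ _ H] := HC i; exact: H.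
have MC' : M <= C' by rewrite lerDl sumr_ge0.
have atT : a <= t <= T by rewrite !ltW.
have dV i y := antider_is_derive (continuous_fix2 (F := V i) (s := t) (cV i)) (vV i t atT) y.
have dW i y := antider_is_derive (continuous_fix2 (F := W i) (s := t) (cW i)) (VW i t atT) y.
have DV i : 'D_(basis_vec R i) (v ^~ t) = V i ^~ t.
  by apply/funext => y; have [_ ->] := dV i y.
have lapE : laplacian (v ^~ t) x = \sum_i W i x t.
  by apply: eq_bigr => i _; rewrite DV; have [_ ->] := dW i x.
have dt : is_derive t (1 : R) (v x) (\sum_i W i x t + F x t).
  set L := \sum_i _ + _; apply: cvg_is_derive; apply/cvgrPdist_le => eps eps0.
  have [d d0 H] := increment x t (ltW a0) MC' cV cW VC WC vV VW eps0.
  near=> h.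
  have h0 : h != 0 by near: h; exact: nbhs_dnbhs_neq.
  have hd : `|h| < d by near: h; exact: dnbhs0_lt.
  have ha : `|h| < t - a by near: h; apply: dnbhs0_lt; rewrite subr_gt0.
  have hT : `|h| < T - t by near: h; apply: dnbhs0_lt; rewrite subr_gt0.
  suff H1 : `|v x (h + t) - v x t - h * L| <= `|h| * eps.
    rewrite (_ : L - _ = - (h^-1 * (v x (h + t) - v x t - h * L))); last by field.
    by rewrite normrN normrM normfV ler_pdivrMl ?normr_gt0.
  (* For [h < 0] the expansion is based at [t + h] and run forward up to [t]. *)
  move: h0; rewrite neq_lt => /orP[h0|h0].
    have := H (h + t) (- h); rewrite (addrC h t) addrK.
    move: hd ha hT; rewrite ltr0_norm// => hd ha hT.
    rewrite (_ : t + h - t = h); last by ring.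
    rewrite (ltr0_norm h0) hd oppr_ge0 (ltW h0) => /(_ isT isT) H1.
    have -> : v x (t + h) - v x t - h * L = - (v x t - v x (t + h) - - h * L) by ring.
    by rewrite normrN; apply: H1; lra.
  move: hd ha hT; rewrite gtr0_norm// => hd ha hT.
  have := H t h; rewrite subrr normr0 d0 (ltW h0) hd (addrC h t) => /(_ isT isT); apply; lra.
split.
- by have [] := dt.
- move=> i; split; first by move=> y; have [] := dV i y.
  by rewrite DV; have [] := dW i x.
- by rewrite derive1E lapE; have [_ ->] := dt.
Unshelve. all: by end_near. Qed.

End time_derivative.

(** * Well-posedness of the integral equation *)

Section source_facts.
Variables (R : realType) (p : R).
Hypothesis p1 : 1 < p.
Implicit Types (a b z M : R).

Definition source' z : R := p * `|z| `^ (p - 1).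

Let pm1 : 0 < p - 1. Proof. by rewrite subr_gt0. Qed.

Let p0 : 0 < p. Proof. exact: lt_trans p1. Qed.

Lemma source_ge0E z : 0 <= z -> source p z = z `^ p.
Proof.
move=> z0; rewrite /source ger0_norm// -{2}(powRr1 z0) -powRD; first by rewrite subrK.
by rewrite subrK gt_eqF// ltr0n.
Qed.

Lemma source_ge0 z : 0 <= z -> 0 <= source p z.
Proof. by move=> z0; rewrite source_ge0E// powR_ge0. Qed.

Lemma sourceN z : source p (- z) = - source p z.
Proof. by rewrite /source normrN mulrN. Qed.

Lemma norm_powR_small a eps : 0 < a -> 0 < eps -> \forall z \near (0 : R), `|z| `^ a <= eps.
Proof.
move=> a0 eps0; have d0 : 0 < eps `^ a^-1 by rewrite powR_gt0.
apply/nbhs_ballP; exists (eps `^ a^-1) => //= z; rewrite /ball/= sub0r normrN => /ltW zd.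
have := ge0_ler_powR (ltW a0) _ _ zd; rewrite !nnegrE normr_ge0 (ltW d0) => /(_ isT isT).
by move=> /le_trans; apply; rewrite -powRrM mulVf ?gt_eqF// powRr1// ltW.
Qed.

Lemma norm_powR_continuous a : 0 < a -> continuous (fun z : R => `|z| `^ a : R).
Proof.
move=> a0 z; have [->|z0] := eqVneq z 0.
  apply/cvgrPdist_le => eps eps0; have := norm_powR_small a0 eps0; apply: filterS => y.
  by rewrite normr0 powR0 ?gt_eqF// sub0r normrN [`|_ `^ _|]ger0_norm ?powR_ge0.
apply: (cvg_comp (fun z : R => `|z|) (fun y : R => y `^ a)).
  by apply: cvg_norm; exact: cvg_id.
have nz0 : 0 < `|z| by rewrite normr_gt0.
have : {for `|z|, continuous (fun y : R => y `^ a)}; last exact.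
apply: differentiable_continuous; apply/derivable1_diffP.
by have [] := is_derive1_powR a nz0.
Qed.

Lemma source'_continuous : continuous source'.
Proof. by apply: continuous_mull; exact: norm_powR_continuous. Qed.

Let is_derive_source_gt0 z : 0 < z -> is_derive z (1 : R) (source p) (source' z).
Proof.
move=> z0; rewrite /source' gtr0_norm//.
have := is_derive1_powR p z0; apply: near_eq_is_derive => //.
near=> y; rewrite source_ge0E//; apply: ltW; near: y; exact: lt_nbhsr.
Unshelve. all: by end_near. Qed.

(** Negative arguments follow by oddness. At [0] the difference quotient is a power of exponent
    [p - 1 > 0] of the absolute value, which tends to [0]. *)
Lemma is_derive_source z : is_derive z (1 : R) (source p) (source' z).
Proof.
have [z0|z0|->] := ltgtP z 0; [|exact: is_derive_source_gt0|].
  have d1 : is_derive (- z) (1 : R) (source p) (source' (- z)).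
    by apply: is_derive_source_gt0; rewrite oppr_gt0.
  have d2 : is_derive z (1 : R) (fun y : R => - y) (-1).
    by apply: is_derive_eq.
  have d3 := is_derive1_comp (f := source p) (g := fun y : R => - y) (x := z) d1 d2.
  have d4 : is_derive z (1 : R) (- (source p \o (fun y : R => - y))) (source' z).
    by apply: is_derive_eq; rewrite /source' normrN mulrN1 opprK.
  by move: d4; congr is_derive; apply/funext => y; rewrite fctE /= sourceN opprK.
apply: cvg_is_derive; rewrite /source' normr0 powR0 ?gt_eqF// mulr0.
apply/cvgrPdist_le => eps eps0; near=> h.
have h0 : h != 0 by near: h; exact: nbhs_dnbhs_neq.
rewrite addr0 /source normr0 mulr0 subr0 mulrCA mulVf// mulr1 sub0r normrN.
rewrite ger0_norm ?powR_ge0//; near: h; apply: nbhs_dnbhs; exact: norm_powR_small.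
Unshelve. all: by end_near. Qed.

Lemma source_continuous : continuous (source p).
Proof.
by move=> z; apply: differentiable_continuous; apply/derivable1_diffP; have [] := is_derive_source z.
Qed.

Lemma source'_bound M z : 0 <= M -> `|z| <= M -> `|source' z| <= p * M `^ (p - 1).
Proof.
move=> M0 zM; rewrite /source' ger0_norm ?mulr_ge0 ?powR_ge0 ?(ltW p0)//.
apply: ler_wpM2l; first exact: ltW.
by apply: ge0_ler_powR; rewrite ?nnegrE//; exact: ltW.
Qed.

Lemma source_bound M z : 0 <= M -> `|z| <= M -> `|source p z| <= M `^ p.
Proof.
move=> M0 zM; rewrite /source normrM ger0_norm ?powR_ge0// -(source_ge0E M0) /source (ger0_norm M0).
apply: ler_pM => //; rewrite ?powR_ge0//.
by apply: ge0_ler_powR; rewrite ?nnegrE//; exact: ltW.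
Qed.

Lemma source_lipschitz M a b : 0 <= M -> `|a| <= M -> `|b| <= M ->
  `|source p a - source p b| <= p * M `^ (p - 1) * `|a - b|.
Proof.
move=> M0; wlog : a b / a < b => [H aM bM|ab aM bM].
  have [ab|ab|->] := ltgtP a b; first exact: H.
    by rewrite distrC [`|a - b|]distrC; exact: H.
  by rewrite !subrr normr0 mulr0.
have cs : {within `[a, b], continuous (source p)} by apply: continuous_subspaceT => x; exact: source_continuous.
have [c cab E] := MVT ab (fun x _ => is_derive_source x) cs.
rewrite distrC [`|a - b|]distrC E normrM; apply: ler_wpM2r => //.
apply: source'_bound => //; move: cab aM bM; rewrite in_itv/= !ler_norml => /andP[? ?] /andP[? ?] /andP[? ?].
by apply/andP; split; lra.
Qed.

End source_facts.

Lemma continuous_subR (T : topologicalType) (R : realType) (f g : T -> R) :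
  continuous f -> continuous g -> continuous (fun x => f x - g x : R).
Proof. by move=> cf cg x; apply: cvgB; [exact: cf|exact: cg]. Qed.

Section halving.
Variable R : realType.

Lemma half_le0 (x C : R) : (forall j : nat, x <= C / 2 ^+ j) -> x <= 0.
Proof.
move=> H; rewrite leNgt; apply/negP => x0.
pose k := Num.bound (`|C| / x).
have : `|C| / x < k%:R by apply: archi_boundP; rewrite divr_ge0// ltW.
rewrite ltr_pdivrMr// => Ck.
have := H k; rewrite ler_pdivlMr ?exprn_gt0// => xC.
have : x * 2 ^+ k <= k%:R * x by apply: le_trans xC _; apply: le_trans (ler_norm C) (ltW Ck).
rewrite mulrC ler_pM2r// leNgt => /negP; apply.
by rewrite -natrX ltr_nat ltn_expl.
Qed.

Lemma half_eq0 (x C : R) : (forall j : nat, `|x| <= C / 2 ^+ j) -> x = 0.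
Proof. by move=> /half_le0; rewrite normr_le0 => /eqP. Qed.

(** With [e j] halving at each index and steps of at most [e j / 2], the intervals of center [a j]
    and radius [e j] are nested; the limit is the supremum of their left ends. *)
Lemma half_cauchy (a : nat -> R) (C : R) : 0 <= C ->
  (forall j, `|a j.+1 - a j| <= C / 2 ^+ j) ->
  exists l, forall j, `|a j - l| <= 2 * C / 2 ^+ j.
Proof.
move=> C0 H; pose e j : R := 2 * C / 2 ^+ j.
have e0 j : 0 <= e j by rewrite divr_ge0 ?mulr_ge0// exprn_ge0.
have eS j : e j.+1 = e j / 2 by rewrite /e exprS; field; rewrite gt_eqF// exprn_gt0.
have eC j : C / 2 ^+ j = e j / 2 by rewrite /e; field; rewrite gt_eqF// exprn_gt0.
have H' j : `|a j.+1 - a j| <= e j / 2 by rewrite -eC.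
have inc : forall j k, a j - e j <= a (j + k)%N - e (j + k)%N.
  move=> j; elim=> [|k IH]; first by rewrite addn0.
  apply: (le_trans IH); rewrite addnS eS.
  by have := H' (j + k)%N; rewrite ler_norml => /andP[? _]; lra.
have dec : forall j k, a (j + k)%N + e (j + k)%N <= a j + e j.
  move=> j; elim=> [|k IH]; first by rewrite addn0.
  apply: le_trans IH; rewrite addnS eS.
  by have := H' (j + k)%N; rewrite ler_norml => /andP[_ ?]; lra.
have cross j k : a j - e j <= a k + e k.
  have := inc j k; have := dec k j; rewrite [(k + j)%N]addnC => h1 h2.
  by have := e0 (j + k)%N; lra.
pose A := [set a j - e j | j in [set: nat]].
have hA : has_sup A.
  split; first by exists (a 0%N - e 0%N), 0%N.
  by exists (a 0%N + e 0%N) => _ [j _ <-]; exact: cross.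
exists (sup A) => j; rewrite ler_norml; apply/andP; split.
  have : sup A <= a j + e j by apply: ge_sup; [exact: hA.1|move=> _ [k _ <-]; exact: cross].
  by rewrite /e; lra.
have : a j - e j <= sup A by apply: ub_le_sup; [exact: hA.2|exists j].
by rewrite /e; lra.
Qed.

End halving.

Section duhamel_difference.
Variables (R : realType) (n : nat).
Implicit Types (x y z : 'rV[R]_n) (F H : 'rV[R]_n -> R -> R) (s t M N : R).
Let mI (a b : R) : measurable (`[a, b] : set R). Proof. exact: measurable_itv. Qed.

Let i1 : (gauss R n).-integrable setT (EFin \o (cst 1 : 'rV[R]_n -> R)).
Proof. exact: gauss_integrable_cst. Qed.

Let m1 : measurable_fun setT (cst 1 : 'rV[R]_n -> R). Proof. exact: measurable_cst. Qed.

Lemma duh0 F x : duh F x 0 = 0.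
Proof. by rewrite /duh mulr0 mul0r. Qed.

Lemma duhB F H M x t : continuous (fun q => F q.1 q.2) -> (forall z s, `|F z s| <= M) ->
  continuous (fun q => H q.1 q.2) -> (forall z s, `|H z s| <= M) ->
  duh (fun y s => F y s - H y s) x t = duh F x t - duh H x t.
Proof.
move=> cF FM cH HM; rewrite /duh -mulrBr; apply: (congr1 (fun r => 2 * t * r)); rewrite /duhw.
have c_ J : continuous (fun q => J q.1 q.2) -> (forall z s, `|J z s| <= M) ->
    continuous (fun th : R => id th * avgw (cst 1) (J ^~ (t * (1 - th ^+ 2))) x (Num.sqrt (2 * t) * th) : R).
  move=> cJ JM th; apply: cvgM; first exact: cvg_id.
  apply: (duhw_integrand_cvg cJ JM (a := fun=> x) (b := fun=> t) (c := id) m1 i1).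
  - exact: cvg_cst.
  - exact: cvg_cst.
  - exact: cvg_id.
rewrite -(RintegralB (mI 0 1) (continuous_itv_integrable_leb 0 1 (c_ F cF FM)) (continuous_itv_integrable_leb 0 1 (c_ H cH HM))).
apply: eq_Rintegral => th _; rewrite -mulrBr; apply: (congr1 (fun r => th * r)).
set c := Num.sqrt _ * _; set s := t * _.
have iJ J (cJ : continuous (fun q => J q.1 q.2)) (JM : forall z s, `|J z s| <= M) :=
  avgw_integrable x c m1 i1 (measurable_source cJ s) (JM ^~ s).
rewrite /avgw -(RintegralB measurableT (iJ F cF FM) (iJ H cH HM)).
by apply: eq_Rintegral => z _; rewrite mulrBr.
Qed.

(** Clipping both sources to [[0, t]] turns a comparison on that interval into one for all times, as
    [duh_le] requires. *)
Lemma duh_sub_le F H M N x t : 0 <= t ->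
  continuous (fun q => F q.1 q.2) -> (forall z s, `|F z s| <= M) ->
  continuous (fun q => H q.1 q.2) -> (forall z s, `|H z s| <= M) ->
  (forall y s, 0 <= s <= t -> `|F y s - H y s| <= N) ->
  `|duh F x t - duh H x t| <= 2 * t * N.
Proof.
move=> t0 cF FM cH HM FH.
have ccl (J : 'rV[R]_n -> R -> R) : continuous (fun q => J q.1 q.2) -> continuous (fun q : 'rV[R]_n * R => J q.1 (clip 0 t q.2)).
  move=> cJ q; apply: (cvg_comp2 (F := J) (a := fst) (b := fun q : 'rV[R]_n * R => clip 0 t q.2) cJ).
    exact: cvg_fst.
  exact: (continuous_sndR (@clip_continuous R 0 t)).
have ext (J : 'rV[R]_n -> R -> R) : duh J x t = duh (fun y s => J y (clip 0 t s)) x t.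
  by apply: duh_ext => // y s st; rewrite clip_id.
rewrite (ext F) (ext H) -(duhB x t (ccl F cF) (fun z s => FM z _) (ccl H cH) (fun z s => HM z _)).
apply: duh_le => //; first exact: (continuous_subR (ccl F cF) (ccl H cH)).
by move=> z s; apply: FH; exact: clip_itv.
Qed.

End duhamel_difference.

(** * Uniqueness and local existence *)

Section uniqueness.
Variables (R : realType) (n : nat).
Implicit Types (x y z : 'rV[R]_n) (s t : R).
Variables (phi : 'rV[R]_n -> R) (f f' : R -> R) (v w : 'rV[R]_n -> R -> R) (M K L T : R).
Hypotheses (cphi : continuous phi) (phiM : forall z, `|phi z| <= M).
Hypotheses (df : forall z : R, is_derive z (1 : R) f (f' z)).
Hypotheses (fK : forall z : R, `|z| <= M -> `|f z| <= K).
Hypotheses (L0 : 0 <= L) (fL : forall a b : R, `|a| <= M -> `|b| <= M -> `|f a - f b| <= L * `|a - b|).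
Hypotheses (cv : continuous (fun q => v q.1 q.2)) (vM : forall z s, `|v z s| <= M).
Hypotheses (cw : continuous (fun q => w q.1 q.2)) (wM : forall z s, `|w z s| <= M).
Hypothesis v_mild : forall x t, 0 <= t <= T ->
  v x t = heat t phi x + duh (fun y s => f (v y s)) x t.
Hypothesis w_mild : forall x t, 0 <= t <= T ->
  w x t = heat t phi x + duh (fun y s => f (w y s)) x t.

Let cf : continuous f.
Proof.
by move=> z; apply: differentiable_continuous; apply/derivable1_diffP; have [] := df z.
Qed.

Let cfs (u : 'rV[R]_n -> R -> R) s : continuous (fun q => u q.1 q.2) ->
  continuous (fun q : 'rV[R]_n * R => f (u q.1 (s + q.2))).
Proof.
move=> cu q; apply: (cvg_comp (fun q : 'rV[R]_n * R => u q.1 (s + q.2)) f); last exact: cf.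
apply: (cvg_comp2 (F := u) (a := fst) (b := fun q : 'rV[R]_n * R => s + q.2) cu); first exact: cvg_fst.
by apply: cvgD; [exact: cvg_cst|exact: cvg_snd].
Qed.

(** Step length for which [2 * d * L], the contraction factor of the Duhamel term, is at most
    [1 / 2]. *)
Let d := (4 * (L + 1))^-1.
Let L1 : 0 < L + 1. Proof. by rewrite ltr_wpDl. Qed.

Let d0 : 0 < d. Proof. by rewrite invr_gt0 mulr_gt0. Qed.

(** Feeding a bound on [v - w] through the restarted equation halves it on a step of length [d];
    starting from [2 * M], every [2 * M / 2 ^+ j] is a bound. *)
Let step s : 0 <= s -> v ^~ s = w ^~ s ->
  forall t x, 0 <= t <= d -> s + t <= T -> v x (s + t) = w x (s + t).
Proof.
move=> s0 vws.
have M0 : 0 <= M by exact: le_trans (normr_ge0 _) (vM 0 0).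
suff H : forall j : nat, forall t x, 0 <= t <= d -> s + t <= T ->
    `|v x (s + t) - w x (s + t)| <= 2 * M / 2 ^+ j.
  by move=> t x td stT; apply/eqP; rewrite -subr_eq0; apply/eqP; apply: half_eq0 => j; exact: H.
elim=> [|j IH] t x /andP[t0 td] stT.
  rewrite expr0 divr1; apply: (le_trans (ler_normB _ _)).
  by rewrite mulr_natl mulr2n; apply: lerD.
rewrite (mild_restart cphi phiM df fK cv vM v_mild x s0 t0 stT).
rewrite (mild_restart cphi phiM df fK cw wM w_mild x s0 t0 stT) vws opprD addrACA subrr add0r.
have N0 : 0 <= 2 * M / 2 ^+ j by rewrite divr_ge0 ?mulr_ge0// exprn_ge0.
have := @duh_sub_le _ _ (fun y r => f (v y (s + r))) (fun y r => f (w y (s + r))) K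
  (L * (2 * M / 2 ^+ j)) x t t0 (@cfs v s cv) (fun z r => fK (vM z _)) (@cfs w s cw) (fun z r => fK (wM z _)).
have Hr : forall y r, 0 <= r <= t -> `|f (v y (s + r)) - f (w y (s + r))| <= L * (2 * M / 2 ^+ j).
  move=> y r /andP[r0 rt]; apply: (le_trans (fL (vM _ _) (wM _ _))); apply: ler_wpM2l => //.
  apply: IH; first by rewrite r0 (le_trans rt).
  by apply: le_trans stT; rewrite lerD2l.
move=> /(_ Hr) /le_trans; apply.
rewrite exprS (_ : 2 * M / (2 * 2 ^+ j) = 2^-1 * (2 * M / 2 ^+ j)); last first.
  by field; rewrite gt_eqF// exprn_gt0.
rewrite mulrA; apply: ler_wpM2r => //.
apply: (@le_trans _ _ (2 * d * (L + 1))); last first.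
  by rewrite (_ : 2 * d * (L + 1) = 2^-1)// /d; field; rewrite gt_eqF.
by apply: ler_pM; rewrite ?mulr_ge0// ?ler_pM2l// lerDl.
Qed.

Lemma mild_unique x t : 0 <= t <= T -> v x t = w x t.
Proof.
suff H : forall k : nat, forall t x, 0 <= t <= T -> t <= k%:R * d -> v x t = w x t.
  move=> tT; have /andP[t0 _] := tT; apply: (H (Num.bound (t / d))) => //.
  by rewrite -ler_pdivrMr//; apply: ltW; apply: archi_boundP; rewrite divr_ge0// ltW.
elim=> [|k IH] {}t {}x /andP[t0 tT] tk.
  have -> : t = 0 by apply/eqP; rewrite eq_le t0 andbT; rewrite mul0r in tk.
  have T0 : 0 <= (0 : R) <= T by rewrite lexx (le_trans t0 tT).
  by rewrite (v_mild x T0) (w_mild x T0) !duh0.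
(* The last step may be shorter than [d]; when [t < d] it starts at time [0]. *)
pose r := Num.min t d.
have r0 : 0 <= r by rewrite le_min t0 ltW.
have rd : r <= d by rewrite ge_min lexx orbT.
have s0 : 0 <= t - r by rewrite subr_ge0 ge_min lexx.
have -> : t = (t - r) + r by rewrite subrK.
apply: step => //; [|by rewrite r0|by rewrite subrK].
apply/funext => y; apply: IH.
  by rewrite s0/=; apply: le_trans tT; rewrite gerBl.
rewrite /r minElt; case: ifP => _; first by rewrite subrr mulr_ge0// ltW.
by move: tk; rewrite -[k.+1]addn1 natrD mulrDl mul1r; lra.
Qed.

End uniqueness.

Section picard.
Variables (R : realType) (n : nat).
Implicit Types (x y z : 'rV[R]_n) (s t : R) (w : 'rV[R]_n -> R -> R).
Variables (psi : 'rV[R]_n -> R) (f : R -> R) (M B K L d : R).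
Hypotheses (cpsi : continuous psi) (psi0 : forall z, 0 <= psi z) (psiM : forall z, psi z <= M).
Hypotheses (cf : continuous f) (MB : M + 1 <= B).
Hypotheses (f0 : forall z : R, 0 <= z -> 0 <= f z) (fK : forall z : R, `|z| <= B -> `|f z| <= K).
Hypotheses (L0 : 0 <= L) (fL : forall a b : R, `|a| <= B -> `|b| <= B -> `|f a - f b| <= L * `|a - b|).
Hypotheses (d0 : 0 < d) (dK : 2 * d * K <= 1) (dL : 2 * d * L <= 2^-1).

(** Invariant set of the iteration. Nonnegativity is part of it because it is required of
    solutions. *)
Let good w := continuous (fun q => w q.1 q.2) /\ forall z s, 0 <= w z s <= B.
Let c := clip 0 d.
(** The Picard map, with its time clipped to [[0, d]] so that the iterates are bounded and
    continuous at all times. *)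
Let Phi w x t := heat (c t) psi x + duh (fun y s => f (w y s)) x (c t).

Let c0 t : 0 <= c t. Proof. by have /andP[] := clip_itv t (ltW d0). Qed.

Let cd t : c t <= d. Proof. by have /andP[] := clip_itv t (ltW d0). Qed.

Let M0 : 0 <= M. Proof. exact: le_trans (psi0 0) (psiM 0). Qed.

Let B0 : 0 <= B. Proof. by apply: le_trans MB; rewrite addr_ge0. Qed.

Let psiN z : `|psi z| <= M. Proof. by rewrite ger0_norm. Qed.

Let ccl : continuous (fun q : 'rV[R]_n * R => c q.2).
Proof. exact: (continuous_sndR (@clip_continuous R 0 d)). Qed.

Let good_norm w z s : good w -> `|w z s| <= B.
Proof. by move=> [_ /(_ z s) /andP[w0 wB]]; rewrite ger0_norm. Qed.

Let good_cf w : good w -> continuous (fun q : 'rV[R]_n * R => f (w q.1 q.2)).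
Proof. by move=> [cw _] q; apply: (cvg_comp (fun q => w q.1 q.2) f); [exact: cw|exact: cf]. Qed.

Let good_fK w : good w -> forall z s, `|f (w z s)| <= K.
Proof. by move=> gw z s; apply: fK; exact: good_norm. Qed.

Let duh_ge0 (F : 'rV[R]_n -> R -> R) x t : 0 <= t -> (forall y s, 0 <= F y s) -> 0 <= duh F x t.
Proof.
move=> t0 F0; rewrite /duh mulr_ge0 ?mulr_ge0//; apply: Rintegral_ge0 => th.
rewrite /= in_itv/= => /andP[th0 _]; rewrite mulr_ge0//; apply: Rintegral_ge0 => z _.
by rewrite mulr_ge0.
Qed.

(** The Duhamel term is at most [2 * d * K <= 1], which fits into the margin between [M] and [B]. *)
Let good_Phi w : good w -> good (Phi w).
Proof.
move=> gw; have cF := good_cf gw; have FK := good_fK gw; split.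
  apply: continuous_addR => q; last first.
    apply: (cvg_comp2 (F := duh (fun y s => f (w y s))) (a := fst) (b := fun q : 'rV[R]_n * R => c q.2) (duh_continuous cF FK)).
      exact: cvg_fst.
    exact: ccl.
  have cG : continuous (fun q : 'rV[R]_n * R => psi q.1) by exact: continuous_fstR.
  apply: (heat_cvg (F := fun x _ => psi x) cG (fun z _ => psiN z) (a := fst) (b := fun q : 'rV[R]_n * R => c q.2) (c := snd)).
  - exact: cvg_fst.
  - exact: ccl.
  - exact: cvg_snd.
move=> z s; apply/andP; split.
  apply: addr_ge0; first exact: heat_ge0.
  by apply: duh_ge0 => // y r; apply: f0; have /andP[] := gw.2 y r.
apply: le_trans MB; apply: lerD.
  exact: le_trans (ler_norm _) (heat_le _ _ (continuous_measurable_rV cpsi) psiN).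
apply: (le_trans (ler_norm _)); apply: (le_trans (duh_le z (c0 s) cF FK)).
have K0 : 0 <= K by exact: le_trans (normr_ge0 _) (FK 0 0).
by apply: le_trans dK; apply: ler_wpM2r => //; apply: ler_wpM2l.
Qed.

Let Phi_contr w w' N : good w -> good w' -> (forall z s, `|w z s - w' z s| <= N) ->
  forall z s, `|Phi w z s - Phi w' z s| <= N / 2.
Proof.
move=> gw gw' H z s; rewrite /Phi opprD addrACA subrr add0r.
have N0 : 0 <= N by exact: le_trans (normr_ge0 _) (H 0 0).
apply: (@le_trans _ _ (2 * c s * (L * N))).
  apply: (duh_sub_le z (c0 s) (good_cf gw) (good_fK gw) (good_cf gw') (good_fK gw')) => y r _.
  apply: (le_trans (fL (good_norm y r gw) (good_norm y r gw'))).
  by apply: ler_wpM2l.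
rewrite mulrA [leRHS]mulrC; apply: ler_wpM2r => //; apply: le_trans dL.
by apply: ler_wpM2r => //; apply: ler_wpM2l.
Qed.

Lemma picard : exists w, [/\ continuous (fun q => w q.1 q.2), (forall z s, 0 <= w z s <= B) &
  forall x t, 0 <= t <= d -> w x t = heat t psi x + duh (fun y s => f (w y s)) x t].
Proof.
pose W j := iter j Phi (fun _ _ => 0).
have gW j : good (W j).
  elim: j => [|j IH]; last exact: good_Phi.
  by split => [q|z s]; [exact: cvg_cst|rewrite lexx B0].
have dW j z s : `|W j.+1 z s - W j z s| <= B / 2 ^+ j.
  elim: j z s => [|j IH] z s.
    by rewrite expr0 divr1 subr0; exact: good_norm (gW 1%N).
  have := Phi_contr (gW j.+1) (gW j) IH z s.
  by rewrite exprS invfM [2^-1 * _]mulrC mulrA.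
have /choice[w' Hw'] : forall q : 'rV[R]_n * R, exists l, forall j, `|W j q.1 q.2 - l| <= 2 * B / 2 ^+ j.
  by move=> q; apply: (half_cauchy B0) => j; exact: dW.
pose w z s := w' (z, s).
have Hw j z s : `|W j z s - w z s| <= 2 * B / 2 ^+ j by exact: (Hw' (z, s)).
have gw : good w.
  split; last first.
    move=> z s; apply/andP; split.
      rewrite -subr_le0 sub0r; apply: (@half_le0 _ _ (2 * B)) => j.
      have /andP[W0 _] := (gW j).2 z s; have := Hw j z s; rewrite ler_norml => /andP[_]; lra.
    rewrite -subr_le0; apply: (@half_le0 _ _ (2 * B)) => j.
    have /andP[_ WB] := (gW j).2 z s; have := Hw j z s; rewrite ler_norml => /andP[+ _]; lra.
  move=> q; apply/cvgrPdist_le => eps eps0.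
  have [j je] : exists j : nat, 2 * B / 2 ^+ j <= eps / 3.
    apply: contrapT => /forallNP H.
    have : eps / 3 <= 0.
      apply: (@half_le0 _ _ (2 * B)) => j; apply: ltW; rewrite ltNge; apply/negP; exact: H.
    by rewrite leNgt divr_gt0.
  have e3 : 0 < eps / 3 by rewrite divr_gt0.
  have /cvgrPdist_le/(_ _ e3) := (gW j).1 q.
  apply: filterS => q' Hq.
  have h1 := le_trans (Hw j q.1 q.2) je; have h2 := le_trans (Hw j q'.1 q'.2) je.
  rewrite (_ : w q.1 q.2 - w q'.1 q'.2 = - (W j q.1 q.2 - w q.1 q.2) + (W j q.1 q.2 - W j q'.1 q'.2) + (W j q'.1 q'.2 - w q'.1 q'.2)); last by ring.
  apply: (le_trans (ler_normD _ _)); rewrite (_ : eps = eps / 3 + eps / 3 + eps / 3); last by field.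
  apply: lerD => //; apply: (le_trans (ler_normD _ _)); rewrite normrN; exact: lerD.
(* [Phi w] and [w] are both within [2 * B / 2 ^+ j.+1] of the iterate [W j.+1], for every [j]. *)
have fix_ z s : Phi w z s = w z s.
  apply/eqP; rewrite -subr_eq0; apply/eqP; apply: (@half_eq0 _ _ (2 * B)) => j.
  have h1 := Phi_contr (gW j) gw (fun z s => Hw j z s) z s; have h2 := Hw j.+1 z s.
  have e2 : 2 * B / 2 ^+ j.+1 = 2 * B / 2 ^+ j / 2.
    by rewrite exprS; field; rewrite gt_eqF// exprn_gt0.
  rewrite e2 in h2.
  rewrite (_ : Phi w z s - w z s = - (W j.+1 z s - Phi w z s) + (W j.+1 z s - w z s)); last by ring.
  apply: (le_trans (ler_normD _ _)); rewrite normrN.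
  rewrite (_ : 2 * B / 2 ^+ j = 2 * B / 2 ^+ j / 2 + 2 * B / 2 ^+ j / 2); last by field; rewrite gt_eqF// exprn_gt0.
  exact: lerD.
exists w; split; [exact: gw.1|exact: gw.2|] => x t td.
by rewrite -{1}fix_ /Phi /c (clip_id td).
Qed.

End picard.

Lemma continuous_within_comp (X Y Z : topologicalType) (A : set Y) (g : Y -> Z) (h : X -> Y) :
  {within A, continuous g} -> continuous h -> (forall x, A (h x)) -> continuous (g \o h).
Proof.
move=> /subspace_continuousP cg ch Ah q B /(cg _ (Ah q)) HB.
have := ch q _ HB; rewrite /nbhs/=; apply: filterS => x Hx; exact: Hx.
Qed.

(** * From the integral equation to mild solutions and back *)

Section integral_equation.
Variables (R : realType) (n : nat).
Implicit Types (x y z : 'rV[R]_n) (F : 'rV[R]_n -> R -> R) (s t M : R).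
Let mI (a b : R) : measurable (`[a, b] : set R). Proof. exact: measurable_itv. Qed.

Lemma kernel_heatE (f : 'rV[R]_n -> R) M x t : 0 < t -> measurable_fun setT f ->
  (forall z, 0 <= f z) -> (forall z, `|f z| <= M) ->
  (\int[mes R n]_y (heat_kernel x y t * f y)%:E = (heat t f x)%:E)%E.
Proof.
move=> t0 mf f0 fM; rewrite (integral_heat_kernel x t0 mf f0) heatE /Rintegral fineK//.
exact: (integrable_fin_num measurableT (heat_integrable x (Num.sqrt (2 * t)) mf fM)).
Qed.

Lemma kernel_duhE F M x t : 0 < t -> continuous (fun q => F q.1 q.2) ->
  (forall z s, 0 <= F z s) -> (forall z s, `|F z s| <= M) ->
  (\int[lebesgue_measure]_(s in `[0%R, t]) \int[mes R n]_y
     (heat_kernel x y (t - s) * F y s)%:E = (duh F x t)%:E)%E.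
Proof.
move=> t0 cF F0 FM; pose h s := heat (t - s) (F ^~ s) x.
have ch : continuous h by exact: (continuous_fix1 (F := fun x s => heat (t - s) (F ^~ s) x) (x := x) (duh_integrand_continuous cF FM (b := t))).
have mh D : measurable_fun D (EFin \o h) by apply/measurable_EFinP; exact: continuous_measurable_leb.
(* The kernel represents [heat (t - s)] only for [s < t]; the end point [s = t] is a null set and is
   dropped from the interval, then restored. *)
have E s : s \in `[0, t[%classic ->
    (EFin \o h) s = (\int[mes R n]_y (heat_kernel x y (t - s) * F y s)%:E)%E.
  move=> /set_mem; rewrite /= in_itv/= => /andP[s0 st].
  by rewrite (kernel_heatE x _ (measurable_source cF s) (F0^~ s) (FM^~ s)) ?subr_gt0.
rewrite -integral_itv_bndo_bndc; last exact: (eq_measurable_fun _ E (mh _)).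
transitivity (\int[lebesgue_measure]_(s in `[0%R, t[) (EFin \o h) s)%E.
  by apply: eq_integral => s st; rewrite -E.
rewrite (integral_itv_bndo_bndc (mh _)).
rewrite -(integral_leb (mI 0 t) (mh _)) (duhE cF FM x (ltW t0)) /Rintegral fineK//.
exact: (integrable_fin_num (mI 0 t) (continuous_itv_integrable_leb 0 t ch)).
Qed.

Variables (p : R) (phi : 'rV[R]_n -> R) (M0 : R).
Hypotheses (p1 : 1 < p) (cphi : continuous phi) (phi0 : forall z, 0 <= phi z)
  (phiM : forall z, `|phi z| <= M0).

(** Turns the outcome of a fixed point argument into a solution in the sense of the statement:
    regularity is [mild_classical], the integral equation is the kernel form of [heat] and [duh]. *)
Lemma mild_solution_on (v : 'rV[R]_n -> R -> R) M T : 0 < T -> M0 <= M ->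
  continuous (fun q => v q.1 q.2) -> (forall z s, 0 <= v z s <= M) ->
  (forall x t, 0 <= t <= T -> v x t = heat t phi x + duh (fun y s => source p (v y s)) x t) ->
  solution_on p phi v T%:E.
Proof.
move=> T0 MM cv vM v_mild; have M0' : 0 <= M by have /andP[a b] := vM 0 0; exact: le_trans b.
have vN z s : `|v z s| <= M by have /andP[a b] := vM z s; rewrite ger0_norm.
have phiN z : `|phi z| <= M by exact: le_trans (phiM z) MM.
have cF : continuous (fun q : 'rV[R]_n * R => source p (v q.1 q.2)).
  by move=> q; apply: (cvg_comp (fun q => v q.1 q.2) (source p)); [exact: cv|exact: source_continuous].
have F0 z s : 0 <= source p (v z s) by apply: source_ge0 => //; have /andP[] := vM z s.
have FM z s : `|source p (v z s)| <= M `^ p by exact: source_bound.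
pose K := M `^ p + p * M `^ (p - 1).
have K1 : M `^ p <= K by rewrite lerDl mulr_ge0 ?powR_ge0// ltW// (lt_trans _ p1).
have K2 : p * M `^ (p - 1) <= K by rewrite lerDr powR_ge0.
have fK (z : R) : `|z| <= M -> `|source p z| <= K by move=> zM; exact: le_trans (source_bound p1 M0' zM) K1.
have f'K (z : R) : `|z| <= M -> `|source' p z| <= K by move=> zM; exact: le_trans (source'_bound p1 M0' zM) K2.
split.
- by rewrite lte_fin.
- by apply: continuous_subspaceT => q; exact: cv.
- by move=> x; rewrite v_mild ?lexx ?(ltW T0)// heat0 duh0 addr0.
- by move=> x t _ _; have /andP[] := vM x t.
- by move=> t1 _ _; exists M => x t _.
- move=> x t t0; rewrite lte_fin => tT.
  have tT' : 0 < t < T by rewrite t0.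
  exact: (mild_classical cphi phiN (is_derive_source p1) (source'_continuous p1) fK f'K cv vN v_mild x tT').
- move=> x t t0; rewrite lte_fin => tT.
  rewrite (kernel_heatE x t0 (continuous_measurable_rV cphi) phi0 phiM).
  rewrite (kernel_duhE x t0 cF F0 FM) -EFinD -v_mild// (ltW t0)/= ltW//.
Qed.

(** A solution is controlled only at times of its interval; freezing time outside [[0, t1]] gives a
    function that is continuous and bounded at all times. *)
Definition freeze (u : 'rV[R]_n -> R -> R) (t1 : R) x s : R := u x (clip 0 t1 s).

(** The converse passage, on each closed interval inside the life span. The bound is taken above
    [M0] so that one constant serves the datum and the solution. *)
Lemma solution_on_mild (u : 'rV[R]_n -> R -> R) (T : \bar R) t1 : solution_on p phi u T ->
  0 < t1 -> (t1%:E < T)%E -> exists2 M, M0 <= M &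
  [/\ continuous (fun q => freeze u t1 q.1 q.2), (forall z s, 0 <= freeze u t1 z s <= M) &
    forall x t, 0 <= t <= t1 ->
      freeze u t1 x t = heat t phi x + duh (fun y s => source p (freeze u t1 y s)) x t].
Proof.
move=> su t10 t1T; have [M uM] := solution_bounded su (ltW t10) t1T.
have tT s : s <= t1 -> (s%:E < T)%E by move=> st; apply: le_lt_trans t1T; rewrite lee_fin.
have cl s : 0 <= clip 0 t1 s <= t1 by apply: clip_itv; exact: ltW.
have M00 : 0 <= M0 by exact: le_trans (normr_ge0 _) (phiM 0).
have M1 : 0 <= M.
  by have := uM 0 0; rewrite lexx (ltW t10) => /(_ isT); exact: le_trans.
exists (M + M0); first by rewrite lerDr.
set v := freeze u t1.
have v0 z s : 0 <= v z s.
  by have /andP[a b] := cl s; apply: (solution_ge0 su) => //; exact: tT.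
have vM z s : v z s <= M + M0.
  by apply: le_trans (ler_norm _) _; apply: le_trans (uM z _ (cl s)) _; rewrite lerDl.
have cv : continuous (fun q => v q.1 q.2).
  apply: (continuous_within_comp (h := fun q : 'rV[R]_n * R => (q.1, clip 0 t1 q.2)) (solution_continuous su)).
    move=> q; have h1 : r.1 @[r --> q] --> q.1 by exact: cvg_fst.
    exact: (cvg_pair h1 (continuous_sndR (@clip_continuous R 0 t1) (x := q))).
  by move=> q /=; have /andP[a b] := cl q.2; split => //; exact: tT.
have vN z s : `|v z s| <= M + M0 by rewrite ger0_norm.
have cF : continuous (fun q : 'rV[R]_n * R => source p (v q.1 q.2)).
  by move=> q; apply: (cvg_comp (fun q => v q.1 q.2) (source p)); [exact: cv|exact: source_continuous].
have F0 z s : 0 <= source p (v z s) by exact: source_ge0.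
have FM z s : `|source p (v z s)| <= (M + M0) `^ p by apply: source_bound => //; rewrite addr_ge0.
split => [//|z s|x t /andP[]]; first by rewrite v0 vM.
rewrite le_eqVlt => /predU1P[<- _|t0 tt1].
  by rewrite heat0 duh0 addr0 /v /freeze clip_id ?lexx ?(ltW t10)// (solution_initial su).
apply: EFin_inj; rewrite EFinD.
rewrite -(kernel_heatE x t0 (continuous_measurable_rV cphi) phi0 phiM).
rewrite -(kernel_duhE x t0 cF F0 FM) {1}/v /freeze clip_id ?(ltW t0)//.
rewrite (solution_integral su x t0 (tT _ tt1)); congr (_ + _)%E.
apply: eq_integral => s /set_mem; rewrite /= in_itv/= => /andP[s0 st].
apply: eq_integral => y _; rewrite /v /freeze clip_id// s0/=; exact: le_trans tt1.
Qed.

End integral_equation.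

(** * Continuation past a time where the solution is bounded *)

Section continuation.
Variables (R : realType) (n : nat).
Implicit Types (x y z : 'rV[R]_n) (s t M N : R).
Variables (p : R) (phi : 'rV[R]_n -> R) (M0 : R).
Hypotheses (p1 : 1 < p) (cphi : continuous phi) (phi0 : forall z, 0 <= phi z)
  (phiM : forall z, `|phi z| <= M0).

Let p0 : 0 < p. Proof. exact: lt_trans p1. Qed.

Lemma source_mild_unique (v w : 'rV[R]_n -> R -> R) M T x t :
  continuous (fun q => v q.1 q.2) -> (forall z s, 0 <= v z s <= M) ->
  continuous (fun q => w q.1 q.2) -> (forall z s, 0 <= w z s <= M) ->
  (forall x t, 0 <= t <= T -> v x t = heat t phi x + duh (fun y s => source p (v y s)) x t) ->
  (forall x t, 0 <= t <= T -> w x t = heat t phi x + duh (fun y s => source p (w y s)) x t) ->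
  0 <= t <= T -> v x t = w x t.
Proof.
move=> cv vM cw wM v_mild w_mild tT.
have M00 : 0 <= M0 by exact: le_trans (normr_ge0 _) (phiM 0).
have M1 : 0 <= M by have /andP[a b] := vM 0 0; exact: le_trans b.
have MM0 : 0 <= M + M0 by exact: addr_ge0.
have phiN z : `|phi z| <= M + M0 by apply: le_trans (phiM z) _; rewrite lerDr.
have vN z s : `|v z s| <= M + M0.
  by have /andP[a b] := vM z s; rewrite ger0_norm//; apply: le_trans b _; rewrite lerDl.
have wN z s : `|w z s| <= M + M0.
  by have /andP[a b] := wM z s; rewrite ger0_norm//; apply: le_trans b _; rewrite lerDl.
have L0 : 0 <= p * (M + M0) `^ (p - 1) by rewrite mulr_ge0 ?powR_ge0// ltW.
have fK (z : R) : `|z| <= M + M0 -> `|source p z| <= (M + M0) `^ p by exact: source_bound.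
have fL (a b : R) : `|a| <= M + M0 -> `|b| <= M + M0 ->
    `|source p a - source p b| <= p * (M + M0) `^ (p - 1) * `|a - b| by exact: source_lipschitz.
have H := mild_unique cphi phiN (is_derive_source p1) fK L0 fL cv vN cw wN v_mild w_mild.
exact: H.
Qed.

(** The order of quantifiers is the point: [d] is fixed by [N] before the solution, its interval and
    the restart time [t0] are given. *)
Lemma continuation N : 0 <= N -> exists2 d, 0 < d &
  forall (u : 'rV[R]_n -> R -> R) (T : \bar R) t0, solution_on p phi u T ->
  0 < t0 -> (t0%:E < T)%E -> (forall x, u x t0 <= N) ->
  exists2 v, solution_on p phi v (t0 + d)%:E &
    forall x t, 0 <= t -> (t%:E < T)%E -> t < t0 + d -> v x t = u x t.
Proof.
move=> N0; pose B := N + 1; have B0 : 0 <= B by rewrite addr_ge0.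
pose K := B `^ p; pose L := p * B `^ (p - 1).
have K0 : 0 <= K by exact: powR_ge0.
have L0 : 0 <= L by rewrite mulr_ge0 ?powR_ge0// ltW.
have K1 : 0 < K + 1 by rewrite ltr_wpDl.
have L1 : 0 < L + 1 by rewrite ltr_wpDl.
(* The two bounds are those demanded by [picard]: stability of the range ([dK]) and contraction
   ([dL]). The [+ 1] keeps the denominators positive. *)
pose d := Num.min (2 * (K + 1))^-1 (4 * (L + 1))^-1.
have d0 : 0 < d by rewrite lt_min !invr_gt0 !mulr_gt0.
have dK : 2 * d * K <= 1.
  apply: (@le_trans _ _ (2 * (2 * (K + 1))^-1 * (K + 1))); last first.
    by rewrite (_ : _ * _ = 1)//; field; rewrite gt_eqF.
  by apply: ler_pM; rewrite ?mulr_ge0 ?(ltW d0)// ?ler_pM2l ?ge_min ?lexx// lerDl.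
have dL : 2 * d * L <= 2^-1.
  apply: (@le_trans _ _ (2 * (4 * (L + 1))^-1 * (L + 1))); last first.
    by rewrite (_ : _ * _ = 2^-1)//; field; rewrite gt_eqF.
  apply: ler_pM; [by rewrite mulr_ge0// ltW|exact: L0| |by rewrite lerDl].
  by rewrite ler_pM2l// ge_min lexx orbT.
exists d => // u T t0 su t00 t0T uN.
have [M MM [cvu vuM vu_mild]] := solution_on_mild p1 cphi phi0 phiM su t00 t0T.
set vu := freeze u t0 in cvu vuM vu_mild.
have tt0 : 0 <= t0 <= t0 by rewrite lexx ltW.
have vut0 x : vu x t0 = u x t0 by rewrite /vu /freeze clip_id.
pose psi x := vu x t0.
have cpsi : continuous psi by exact: (continuous_fix2 (F := vu) (s := t0) cvu).
have psi0 z : 0 <= psi z by have /andP[] := vuM z t0.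
have psiN z : psi z <= N by rewrite /psi vut0.
have f0 (z : R) : 0 <= z -> 0 <= source p z by exact: source_ge0.
have fK (z : R) : `|z| <= B -> `|source p z| <= K by exact: source_bound.
have fL (a b : R) : `|a| <= B -> `|b| <= B -> `|source p a - source p b| <= L * `|a - b|.
  exact: source_lipschitz.
have [w [cw wB w_mild]] := picard cpsi psi0 psiN (source_continuous p1) (lexx B) f0 fK L0 fL d0 dK dL.
have w0 x : w x 0 = psi x by rewrite w_mild ?lexx ?(ltW d0)// heat0 duh0 addr0.
pose v x t := vu x t + (w x (clip 0 d (t - t0)) - psi x).
have v_le x t : t <= t0 -> v x t = vu x t.
  move=> tl; rewrite /v (_ : clip 0 d (t - t0) = 0) ?w0 ?subrr ?addr0//.
  by apply/max_idPl; rewrite ge_min subr_le0 tl orbT.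
have v_ge x t : t0 <= t -> v x t = w x (clip 0 d (t - t0)).
  move=> tl; rewrite /v (_ : vu x t = psi x); first by rewrite addrC subrK.
  rewrite /psi /vu /freeze; congr (u x _); rewrite (@clip_id _ 0 t0 t0)// /clip (min_idPl tl).
  exact: (max_idPr (ltW t00)).
have v_add x t : 0 <= t <= d -> v x (t0 + t) = w x t.
  by move=> /andP[t1 t2]; rewrite v_ge ?lerDl// [t0 + t]addrC addrK clip_id// t1.
have M00 : 0 <= M0 by exact: le_trans (normr_ge0 _) (phiM 0).
have M1 : 0 <= M by exact: le_trans MM.
have vM z s : 0 <= v z s <= M + B.
  have [st|/ltW st] := leP s t0.
    by rewrite v_le//; have /andP[-> b] := vuM z s; apply: le_trans b _; rewrite lerDl.
  by rewrite v_ge//; have /andP[-> b] := wB z (clip 0 d (s - t0)); apply: le_trans b _; rewrite lerDr.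
have cv : continuous (fun q => v q.1 q.2).
  apply: continuous_addR; first exact: cvu.
  apply: continuous_subR; last exact: continuous_fstR.
  move=> q; apply: (cvg_comp2 (F := w) (a := fst) (b := fun q : 'rV[R]_n * R => clip 0 d (q.2 - t0)) cw).
    exact: cvg_fst.
  apply: (cvg_comp (fun q : 'rV[R]_n * R => q.2 - t0) (clip 0 d)); last exact: clip_continuous.
  by apply: cvgB; [exact: cvg_snd|exact: cvg_cst].
have MB0 : 0 <= M + B by rewrite addr_ge0.
have vN z s : `|v z s| <= M + B by have /andP[a b] := vM z s; rewrite ger0_norm.
have cF : continuous (fun q : 'rV[R]_n * R => source p (v q.1 q.2)).
  by move=> q; apply: (cvg_comp (fun q => v q.1 q.2) (source p)); [exact: cv|exact: source_continuous].
have FM z s : `|source p (v z s)| <= (M + B) `^ p by exact: source_bound.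
have v_mild0 x t : 0 <= t <= t0 -> v x t = heat t phi x + duh (fun y s => source p (v y s)) x t.
  move=> /andP[t1 t2]; rewrite v_le// vu_mild ?t1//; congr (_ + _).
  by apply: duh_ext => // y s /andP[_ st]; rewrite v_le// (le_trans st).
have v_mild x t : 0 <= t <= t0 + d -> v x t = heat t phi x + duh (fun y s => source p (v y s)) x t.
  move=> /andP[t1 t2]; have [tl|/ltW tl] := leP t t0; first by apply: v_mild0; rewrite t1.
  have [r rE] : exists r, t = t0 + r by exists (t - t0); rewrite addrC subrK.
  have r0 : 0 <= r by move: tl; rewrite rE lerDl.
  have rd : r <= d by move: t2; rewrite rE lerD2l.
  have r0d : 0 <= r <= d by rewrite r0.
  (* Beyond [t0], the equation of [w] with datum [psi] is the equation of [v] restarted at [t0];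
     expanding [psi] by [v_mild0] recovers the equation from time [0]. *)
  rewrite rE v_add// w_mild// (duh_restart cF FM x r0 (ltW t00)) addrA.
  have -> : duh (fun y s => source p (v y (t0 + s))) x r = duh (fun y s => source p (w y s)) x r.
    by apply: duh_ext => // y s /andP[s0 sr]; rewrite v_add// s0 (le_trans sr).
  congr (_ + _); rewrite [t0 + r]addrC -(heat_comp x r0 (ltW t00) (continuous_measurable_rV cphi) phiM).
  have sK : 0 <= 2 * t0 * (M + B) `^ p by rewrite mulr_ge0 ?powR_ge0 ?mulr_ge0 ?(ltW t00).
  have hM z : `|heat t0 phi z| <= M0 + 2 * t0 * (M + B) `^ p.
    apply: (le_trans (heat_le t0 z (continuous_measurable_rV cphi) phiM)).
    by rewrite lerDl.
  have dM z : `|duh (fun y s => source p (v y s)) z t0| <= M0 + 2 * t0 * (M + B) `^ p.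
    by apply: (le_trans (duh_le z (ltW t00) cF FM)); rewrite lerDr.
  have cH := avgw_continuous1 (c := Num.sqrt (2 * t0)) (measurable_cst _) (gauss_integrable_cst n 1) cphi phiM.
  have cD := continuous_fix2 (F := duh (fun y s => source p (v y s))) (s := t0) (duh_continuous cF FM).
  rewrite -(heatD r x (continuous_measurable_rV cH) hM (continuous_measurable_rV cD) dM).
  by congr heat; apply/funext => y; rewrite -v_mild0// v_le.
exists v; first by apply: (mild_solution_on p1 cphi phi0 phiM (M := M + B) _ _ cv vM v_mild); rewrite ?addr_gt0// (le_trans MM)// lerDl.
(* Up to [t0] both functions agree by construction; past [t0], [v] and [u] frozen at [t] solve the
   same mild equation on [[0, t]], and uniqueness applies. *)
move=> x t t1 tT td; have [tl|tl] := leP t t0.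
  by rewrite v_le// /vu /freeze clip_id// t1.
have t_gt0 : 0 < t by exact: lt_trans tl.
have [M' MM' [cw' w'M w'_mild]] := solution_on_mild p1 cphi phi0 phiM su t_gt0 tT.
set w' := freeze u t in cw' w'M w'_mild.
have ttt : 0 <= t <= t by rewrite lexx t1.
have <- : w' x t = u x t by rewrite /w' /freeze clip_id.
have M'0 : 0 <= M' by exact: le_trans MM'.
apply: (source_mild_unique (M := M + B + M') (T := t)) => //.
- by move=> z s; have /andP[-> b] := vM z s; apply: le_trans b _; rewrite lerDl.
- by move=> z s; have /andP[-> b] := w'M z s; apply: le_trans b _; rewrite lerDr.
- move=> y s /andP[s0 st]; apply: v_mild; rewrite s0/=; exact: le_trans st (ltW td).
Qed.

End continuation.

(** * Density of level sets and life span *)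

Section balls.
Variables (R : realType) (n : nat).
Implicit Types (x y z : 'rV[R]_n) (r s t : R).

Lemma enorm_lt x r : 0 < r -> (enorm x < r) = (\sum_i x 0 i ^+ 2 < r ^+ 2).
Proof. by move=> r0; rewrite -enorm_sqr ltr_pXn2r// ?nnegrE ?sqrtr_ge0// ltW. Qed.

(** Coordinatewise, [(a + b) ^ 2 <= (1 + s / r) * a ^ 2 + (1 + r / s) * b ^ 2]. The weights are
    those for which the bounds [r ^ 2] and [s ^ 2] add up to exactly [(r + s) ^ 2]. *)
Lemma enorm_ltD x y r s : 0 < r -> 0 < s -> enorm x < r -> enorm y < s ->
  enorm (x + y) < r + s.
Proof.
move=> r0 s0; rewrite !enorm_lt ?addr_gt0// => xr ys.
apply: (@le_lt_trans _ _ ((1 + s / r) * (\sum_i x 0 i ^+ 2) + (1 + r / s) * (\sum_i y 0 i ^+ 2))).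
  rewrite !mulr_sumr -big_split/=; apply: ler_sum => i _; rewrite mxE.
  rewrite -subr_ge0 (_ : _ - _ = (s * x 0 i - r * y 0 i) ^+ 2 / (r * s)).
    by rewrite divr_ge0 ?sqr_ge0// mulr_ge0// ltW.
  by field; rewrite !gt_eqF.
rewrite (_ : (r + s) ^+ 2 = (1 + s / r) * r ^+ 2 + (1 + r / s) * s ^+ 2); last first.
  by field; rewrite !gt_eqF.
by apply: ltrD; rewrite ltr_pM2l// addr_gt0// divr_gt0.
Qed.

Lemma enormZ r x : 0 <= r -> enorm (r *: x) = r * enorm x.
Proof.
move=> r0; rewrite /enorm (_ : \sum_i _ = r ^+ 2 * \sum_i x 0 i ^+ 2).
  by rewrite sqrtrM ?sqr_ge0// sqrtr_sqr ger0_norm.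
by rewrite mulr_sumr; apply: eq_bigr => i _; rewrite mxE exprMn.
Qed.

Lemma coord_le_enorm x i : `|x 0 i| <= enorm x.
Proof.
rewrite -sqrtr_sqr; apply: ler_wsqrtr; rewrite (bigD1 i)//= lerDl.
by apply: sumr_ge0 => j _; exact: sqr_ge0.
Qed.

Lemma measurable_eball x r : measurable (eball x r).
Proof.
have m : measurable_fun setT (fun y : 'rV[R]_n => enorm (y - x)).
  apply: (measurableT_comp (@measurable_enorm R n)).
  have := measurable_rV_shift (- x).
  by apply: eq_measurable_fun => y _; rewrite addrC.
rewrite (_ : eball x r = setT `&` [set y | enorm (y - x) < r]); last by rewrite setTI.
have := m measurableT `]-oo, r[%classic (measurable_itv _).
by congr measurable; apply/seteqP; split => y /=; rewrite in_itv/=.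
Qed.

Local Open Scope ereal_scope.
Local Notation mu := (mes R n).

Let mes_indicE (B : set 'rV[R]_n) : measurable B -> \int[mu]_y (\1_B y)%:E = mu B.
Proof. by move=> mB; rewrite (integral_indic mu measurableT mB) setIT. Qed.

Lemma mes_eball x r : (0 < r)%R -> mu (eball x r) = (r ^+ n)%:E * mu (eball 0%R 1%R).
Proof.
move=> r0.
rewrite -(mes_indicE (measurable_eball x r)) -(mes_indicE (measurable_eball 0%R 1%R)).
rewrite (ge0_integral_mes_affine x r0)//; last first.
  by apply/measurable_EFinP; exact: measurable_indic (measurable_eball x r).
congr (_ * _); apply: eq_integral => y _; congr EFin; rewrite !indicE; congr (_%:R).
congr nat_of_bool; apply/idP/idP; rewrite !inE /eball/= [(x + _)%R]addrC addrK subr0 enormZ ?(ltW r0)//.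
  by rewrite -ltr_pdivlMl// mulVf ?gt_eqF.
by rewrite -[X in (_ -> _ < X)%R]mulr1 ltr_pM2l.
Qed.

Lemma integral_heat_kernel1 : \int[mu]_y (heat_kernel 0%R y 1)%:E = 1.
Proof.
have h := @integral_heat_kernel R n 0%R 1%R (cst 1%R) ltr01 (@measurable_cst _ _ _ _ _ (1%R:R)) (fun _ => ler01).
transitivity (\int[mu]_y (heat_kernel 0%R y 1 * cst 1%R y)%:E).
  by apply: eq_integral => y _; rewrite /= mulr1.
rewrite h; exact: (integral_prob_cst (gauss R n) 1%:E).
Qed.

Let cK : R := ((4 * pi * 1) `^ (n%:R / 2))^-1.
Let cK0 : (0 < cK)%R.
Proof. by rewrite invr_gt0 powR_gt0// !mulr_gt0// pi_gt0. Qed.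

(** The heat kernel at time [1] has integral [1] and is at least [d] on the unit ball, which bounds
    the volume without computing it. *)
Lemma mes_eball1_fin : mu (eball 0%R 1%R) < +oo.
Proof.
pose d := (cK * expR (- (1 / 4)))%R; have d0 : (0 < d)%R by rewrite mulr_gt0 ?expR_gt0.
have mB := measurable_eball 0%R 1%R.
have : d%:E * mu (eball 0%R 1%R) <= 1.
  rewrite -integral_heat_kernel1 -(mes_indicE mB).
  rewrite -ge0_integralZl//; first last.
  - by rewrite lee_fin ltW.
  - by apply/measurable_EFinP; exact: measurable_indic.
  apply: ge0_le_integral => //.
  - by move=> y _; rewrite -EFinM lee_fin mulr_ge0// ltW.
  - by apply/measurable_EFinP; apply: measurable_funM => //; exact: measurable_indic.
  - by apply/measurable_EFinP; exact: measurable_heat_kernel.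
  - move=> y _; rewrite -EFinM lee_fin indicE; case: (boolP (y \in _)) => yB; last first.
      by rewrite mulr0 heat_kernel_ge0.
    rewrite mulr1 /d /heat_kernel; apply: ler_wpM2l; first exact: ltW.
    rewrite ler_expR lerN2 mulr1; apply: ler_wpM2r => //.
    move: yB; rewrite inE /eball/= subr0 sub0r => yB.
    rewrite -(expr1n _ 2) ler_pXn2r ?nnegrE ?sqrtr_ge0//; apply: ltW.
    by move: yB; rewrite /enorm; under [X in _ -> (_ X < _)%R]eq_bigr do rewrite mxE sqrrN.
move=> h; rewrite ltey; apply/eqP => E; move: h; rewrite E gt0_muley ?lte_fin//.
Qed.

(** The same kernel is at most [cK]; on a null space its integral could not be [1]. *)
Lemma mes_setT_gt0 : 0 < mu setT.
Proof.
rewrite lt0e measure_ge0 andbT; apply/eqP => E.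
have := integral_heat_kernel1; rewrite (_ : \int[mu]_y _ = 0).
  by move=> E1; have := @lte01 R; rewrite E1 ltxx.
apply/eqP; rewrite eq_le; apply/andP; split; last first.
  by apply: integral_ge0 => y _; rewrite lee_fin heat_kernel_ge0.
apply: (@le_trans _ _ (\int[mu]_y cK%:E)).
  apply: ge0_le_integral => //.
  - by move=> y _; rewrite lee_fin heat_kernel_ge0.
  - by apply/measurable_EFinP; exact: measurable_heat_kernel.
  - move=> y _; rewrite lee_fin /heat_kernel -[leRHS]mulr1; apply: ler_wpM2l; first exact: ltW.
    by rewrite -expR0 ler_expR oppr_le0 divr_ge0// sqr_ge0.
apply: (@le_trans _ _ (cK%:E * mu setT)); first by rewrite integral_cst.
by rewrite E mule0.
Qed.

(** If the unit ball were null, so would be all its dilates by [mes_eball], and countably many of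
    them cover the space. *)
Lemma mes_eball1_gt0 : 0 < mu (eball 0%R 1%R).
Proof.
rewrite lt0e measure_ge0 andbT; apply/eqP => E.
have null k : mu.-negligible (eball 0%R k.+1%:R).
  have E2 : mu (eball 0%R k.+1%:R) = 0 by rewrite mes_eball ?ltr0n// E mule0.
  exact: (negligibleP _ (measurable_eball _ _)).2 E2.
have := negligible_bigcup null; rewrite (_ : \bigcup_k _ = setT).
  by move/(negligibleP _ measurableT) => E'; have := mes_setT_gt0; rewrite E' ltxx.
apply/seteqP; split => // y _; exists (Num.bound (enorm y)) => //; rewrite /eball/= subr0.
by apply: lt_trans (archi_boundP (sqrtr_ge0 _)) _; rewrite ltr_nat.
Qed.

End balls.

Section density_bound.
Variables (R : realType) (n : nat).
Implicit Types (x y z : 'rV[R]_n) (r s t : R).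
Local Notation mu := (mes R n).
Local Notation G := (gauss R n).

Lemma enormN x : enorm (- x) = enorm x.
Proof. by rewrite /enorm; congr Num.sqrt; apply: eq_bigr => i _; rewrite mxE sqrrN. Qed.

Lemma measurable_scaled_ball (c rho : R) : measurable [set z : 'rV[R]_n | enorm (c *: z) < rho].
Proof.
have m : measurable_fun setT (fun z : 'rV[R]_n => enorm (c *: z)).
  apply: (measurableT_comp (@measurable_enorm R n)).
  have := measurable_rV_affine (0 : 'rV[R]_n) c; apply: eq_measurable_fun => z _.
  by rewrite add0r.
have := m measurableT `]-oo, rho[%classic (measurable_itv _).
by rewrite setTI; congr measurable; apply/seteqP; split => y /=; rewrite in_itv/=.
Qed.

(** Continuity of the Gaussian measure from below along balls of integer radius. *)
Lemma gauss_ball_cvg (c : R) (q : R) : 0 <= c -> q < 1 ->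
  exists2 rho, 0 < rho & (q%:E < G [set z : 'rV[R]_n | (enorm (c *: z) < rho)%R])%E.
Proof.
move=> c0 q1; pose Z (k : nat) := [set z : 'rV[R]_n | enorm (c *: z) < k%:R].
have mZ k : measurable (Z k) by exact: measurable_scaled_ball.
have UZ : \bigcup_k Z k = setT.
  apply/seteqP; split => // z _; exists (Num.bound (enorm (c *: z))) => //.
  exact: archi_boundP (sqrtr_ge0 _).
have ndZ : {homo Z : m k / (m <= k)%N >-> (m <= k)%O}.
  move=> m k mk; apply/subsetPset => z /= zm; apply: lt_le_trans zm _.
  by rewrite ler_nat.
have cv : (G \o Z) k @[k --> \oo] --> (1%E : \bar R).
  have := nondecreasing_cvg_mu mZ _ ndZ (mu := G); rewrite UZ => /(_ measurableT).
  by move=> H; rewrite -(probability_setT G); exact: H.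
have [k qk] : exists k, (q%:E < G (Z k))%E.
  apply: contrapT => /forallNP H.
  have : (1 <= q%:E :> \bar R)%E.
    apply: (cvge_le _ cv); apply: nearW => k /=; rewrite leNgt; exact/negP.
  by rewrite lee_fin leNgt q1.
(* The [+ 1] makes the radius positive even for [k = 0]. *)
exists (k%:R + 1); first by rewrite ltr_wpDl.
apply: (lt_le_trans qk); apply: le_measure; rewrite ?inE//; first exact: measurable_scaled_ball.
by move=> z /= zk; apply: (lt_le_trans zk); rewrite lerDl.
Qed.

Variables (phi : 'rV[R]_n -> R) (M0 m t : R).
Hypotheses (cphi : continuous phi) (phi0 : forall z, 0 <= phi z)
  (phiM : forall z, `|phi z| <= M0) (m0 : 0 <= m)
  (heat_m : forall x, heat t phi x <= m).

Let mphi := continuous_measurable_rV cphi.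
Let c := Num.sqrt (2 * t).

Lemma measurable_level a : measurable [set y | a <= phi y].
Proof.
have mp : measurable_fun setT phi by exact: mphi.
have := mp measurableT `[a, +oo[%classic (measurable_itv _).
by rewrite setTI; congr measurable; apply/seteqP; split => y /=; rewrite in_itv/= andbT.
Qed.

(** The integral of [heat t phi] over the larger ball is at most [m] times its volume. Conversely,
    exchange it with the Gaussian average: for each [z] with [enorm (c *: z) < rho], a translation
    by [c *: z] maps the points of [eball x r] where [phi >= alpha] into the larger ball, so the
    inner integral is at least [alpha] times their measure. *)
Lemma level_mes_le alpha x r rho : 0 < alpha -> 0 < r -> 0 < rho ->
  (alpha%:E * G [set z : 'rV[R]_n | (enorm (c *: z) < rho)%R] * mu (eball x r `&` [set y | (alpha <= phi y)%R])
   <= m%:E * mu (eball x (r + rho)%R))%E.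
Proof.
move=> a0 r0 rho0; set Z := [set z | _]; set A := [set y | (alpha <= phi y)%R].
set B := eball x (r + rho); have mB : measurable B by exact: measurable_eball.
have mA : measurable A by exact: measurable_level.
have mZ : measurable Z by exact: measurable_scaled_ball.
have mBA : measurable (eball x r `&` A) by apply: measurableI => //; exact: measurable_eball.
have m1B : measurable_fun setT (\1_B : 'rV[R]_n -> R) by exact: measurable_indic.
pose f (q : 'rV[R]_n * 'rV[R]_n) : R := \1_B q.1 * phi (q.1 + c *: q.2).
have mf : measurable_fun setT (EFin \o f).
  apply/measurable_EFinP; apply: measurable_funM; first exact: (measurableT_comp m1B measurable_fst).
  apply: (measurableT_comp mphi); apply: measurable_rVD; first exact: measurable_fst.
  by apply: measurable_rVZ => //; exact: measurable_snd.
have f0 q : (0 <= (EFin \o f) q)%E by rewrite lee_fin mulr_ge0.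
have ft := fubini_tonelli (m1 := mu) (m2 := G) (EFin \o f) mf f0.
have hc : continuous (heat t phi).
  exact: (avgw_continuous1 (c := c) (measurable_cst _) (gauss_integrable_cst n 1) cphi phiM).
have mBE : (\int[mu]_y (\1_B y)%:E = mu B)%E by rewrite (integral_indic mu measurableT mB) setIT.
have mBAE : (\int[mu]_y (\1_(eball x r `&` A) y)%:E = mu (eball x r `&` A))%E.
  by rewrite (integral_indic mu measurableT mBA) setIT.
have le1 : (\int[mu]_y \int[G]_z (EFin \o f) (y, z) <= m%:E * mu B)%E.
  rewrite -mBE -(ge0_integralTZl mu (f := fun y => (\1_B y)%:E)) => [|||//]; first last.
  - by move=> y; rewrite lee_fin.
  - exact/measurable_EFinP.
  have Ey y : (\int[G]_z (EFin \o f) (y, z) = (\1_B y * heat t phi y)%:E)%E.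
    have iph := heat_integrable y c mphi phiM.
    rewrite heatE EFinM /Rintegral fineK; last exact: (integrable_fin_num measurableT iph).
    rewrite -(ge0_integralTZl G (f := fun z => (phi (y + c *: z))%:E)) => [|||//].
    - by apply: eq_integral => z _; rewrite -EFinM.
    - exact: (measurable_int G iph).
    - by move=> z; rewrite lee_fin.
  rewrite (_ : (\int[mu]_y \int[G]_z (EFin \o f) (y, z) = \int[mu]_y (\1_B y * heat t phi y)%:E)%E); last first.
    by apply: eq_integral => y _; exact: Ey.
  apply: ge0_le_integral => //.
  - by move=> y _; rewrite lee_fin mulr_ge0// heat_ge0.
  - apply/measurable_EFinP; apply: measurable_funM => //.
    exact: continuous_measurable_rV.
  - by apply/measurable_EFinP; exact: measurable_funM.
  - by move=> y _; rewrite -EFinM lee_fin mulrC; apply: ler_wpM2r.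
apply: le_trans le1; rewrite ft.
set K := mu (eball x r `&` A).
have K0 : (0 <= K)%E by exact: measure_ge0.
have inner z : Z z -> (alpha%:E * K <= \int[mu]_y (EFin \o f) (y, z))%E.
  move=> Zz; have mfz : measurable_fun setT (fun y => (EFin \o f) (y, z))
    by apply: (measurableT_comp mf); apply/measurable_fun_pairP; split; [exact: measurable_id|exact: measurable_cst].
  rewrite (ge0_integral_mes_affine (- (c *: z)) ltr01 mfz (fun y => f0 (y, z))) expr1n mul1e.
  rewrite /K -mBAE -(ge0_integralTZl mu (f := fun y => (\1_(eball x r `&` A) y)%:E)) => [|||]; first last.
  - exact: ltW.
  - by move=> y; rewrite lee_fin.
  - by apply/measurable_EFinP; exact: measurable_indic.
  apply: ge0_le_integral => //.
  - by move=> y _; rewrite -EFinM lee_fin mulr_ge0// ltW.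
  - by apply/measurable_EFinP; apply: measurable_funM => //; exact: measurable_indic.
  - apply: (measurableT_comp mfz); exact: measurable_rV_affine.
  - move=> y _; rewrite -EFinM lee_fin /f/= scale1r addrAC addNr add0r.
    rewrite !indicE; case: (boolP (y \in _)) => [|_]; last by rewrite mulr0 mulr_ge0.
    rewrite inE => -[yr yA]; rewrite mem_set ?mulr1 ?mul1r//.
    rewrite /B /eball/= addrAC -addrA addrC; apply: enorm_ltD => //.
      by rewrite [- x + y]addrC.
    by rewrite enormN.
have mG : measurable_fun setT (fun z => \int[mu]_y (EFin \o f) (y, z))%E.
  exact: (measurable_fun_fubini_tonelli_G (m1 := mu) (EFin \o f) mf f0).
have g0 z : (0 <= \int[mu]_y (EFin \o f) (y, z))%E by apply: integral_ge0 => y _; exact: f0.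
apply: (@le_trans _ _ (\int[G]_(z in Z) \int[mu]_y (EFin \o f) (y, z))%E); last first.
  by apply: ge0_subset_integral.
apply: (@le_trans _ _ (\int[G]_(z in Z) (alpha%:E * K))%E).
  by rewrite integral_cst// muleAC.
apply: ge0_le_integral => //.
- by move=> z _; rewrite mule_ge0// lee_fin ltW.
- exact: measurable_funTS.
Qed.

(** Division by the volume of [eball x r]; by scaling, the ratio of the two balls is
    [(1 + rho / r) ^+ n], whatever the center. *)
Lemma density_le alpha q rho x r : 0 < alpha -> 0 < q -> 0 < r -> 0 < rho ->
  (q%:E <= G [set z : 'rV[R]_n | (enorm (c *: z) < rho)%R])%E ->
  fine (mu (eball x r `&` [set y | alpha <= phi y])) / fine (mu (eball x r)) <=
  m / alpha / q * (1 + rho * r^-1) ^+ n.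
Proof.
move=> a0 q0 r0 rho0 qG; set BA := eball x r `&` _.
have mBA : measurable BA by apply: measurableI; [exact: measurable_eball|exact: measurable_level].
have B1 : (mu (eball 0 1) < +oo)%E by exact: mes_eball1_fin.
have B1f : (mu (eball 0 1) \is a fin_num)%E by rewrite ge0_fin_numE.
pose b := fine (mu (eball 0 1)); have bE : mu (eball 0 1) = b%:E by rewrite fineK.
have b0 : 0 < b by rewrite -lte_fin -bE; exact: mes_eball1_gt0.
have Br : mu (eball x r) = (r ^+ n * b)%:E by rewrite mes_eball// bE.
have Brr : mu (eball x (r + rho)) = ((r + rho) ^+ n * b)%:E by rewrite mes_eball ?addr_gt0// bE.
have BAf : mu BA \is a fin_num.
  rewrite ge0_fin_numE//; apply: (@le_lt_trans _ _ (mu (eball x r))); last by rewrite Br ltry.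
  by apply: le_measure; [rewrite inE|rewrite inE; exact: measurable_eball|move=> y []].
pose k := fine (mu BA); have kE : mu BA = k%:E by rewrite fineK.
have k0 : 0 <= k by exact: fine_ge0.
have rn : 0 < r ^+ n by exact: exprn_gt0.
have : alpha * q * k <= m * ((r + rho) ^+ n * b).
  rewrite -lee_fin (EFinM (alpha * q)) (EFinM alpha) (EFinM m) -Brr -kE.
  apply: le_trans (level_mes_le x a0 r0 rho0).
  by apply: lee_wpmul2r => //; apply: lee_wpmul2l => //; rewrite lee_fin ltW.
rewrite Br/= -/k => H.
rewrite (_ : (1 + rho * r^-1) ^+ n = (r + rho) ^+ n / r ^+ n); last first.
  by rewrite -expr_div_n mulrDl mulfV ?gt_eqF.
rewrite ler_pdivrMr ?mulr_gt0// -(ler_pM2l (mulr_gt0 a0 q0)).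
apply: (le_trans H); rewrite (_ : alpha * q * _ = m * ((r + rho) ^+ n * b))//.
by field; rewrite !gt_eqF.
Qed.

(** First [q] is chosen close to [1], which fixes [rho]; then [r] tends to infinity and the ratio of
    balls tends to [1]. *)
Lemma upper_density_le alpha : 0 < alpha -> (upper_density phi alpha <= (m / alpha)%:E)%E.
Proof.
move=> a0; have ma0 : 0 <= m / alpha by rewrite divr_ge0// ltW.
apply/lee_addgt0Pr => e e0; rewrite -EFinD.
(* With [u = m / alpha], this choice gives [u / q < u + e] and [0 < q < 1], also when [u = 0]. *)
pose q := (m / alpha + e / 2 / 2) / (m / alpha + e / 2).
have d0 : 0 < m / alpha + e / 2 by rewrite ltr_wpDl// divr_gt0.
have q0 : 0 < q by rewrite divr_gt0// ltr_wpDl// !divr_gt0.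
have q1 : q < 1 by rewrite ltr_pdivrMr// mul1r ltrD2l; lra.
have [rho rho0 qG] := gauss_ball_cvg (sqrtr_ge0 (2 * t)) q1.
have mq : m / alpha / q < m / alpha + e.
  rewrite ltr_pdivrMr// /q mulrA ltr_pdivlMr//.
  move: (m / alpha) ma0 => u u0; nra.
(* In the variable [s = 1 / r], large radii are a neighborhood of [0]. *)
have cg : continuous (fun s : R => m / alpha / q * (1 + rho * s) ^+ n : R).
  move=> s; apply: cvgMl_tmp.
  apply: (cvg_comp (fun s : R => 1 + rho * s) (fun y : R => y ^+ n)); last exact: exprn_continuous.
  by apply: cvgD; [exact: cvg_cst|apply: cvgMl_tmp; exact: cvg_id].
have e1 : 0 < m / alpha + e - m / alpha / q by rewrite subr_gt0.
have /cvgrPdist_le/(_ _ e1)/nbhs_ballP[d /= dpos Hd] := cg 0.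
have Hr r : d^-1 < r -> (density phi alpha r <= (m / alpha + e)%:E)%E.
  move=> dr; have r0 : 0 < r by apply: lt_trans dr; rewrite invr_gt0.
  apply: ge_ereal_sup => _ [x _ <-]; rewrite lee_fin.
  apply: (le_trans (density_le x a0 q0 r0 rho0 (ltW qG))).
  have : ball 0 d r^-1.
    rewrite /ball/= sub0r normrN gtr0_norm ?invr_gt0// -[ltRHS]invrK ltf_pV2 ?posrE ?invr_gt0//.
  move=> /Hd; rewrite /= mulr0 addr0 expr1n mulr1 distrC => /(le_trans (ler_norm _)); lra.
apply: (@le_trans _ _ (ereal_sup (density phi alpha @` [set r | d^-1 < r]))).
  apply: ereal_inf_lbound; exists [set r | d^-1 < r] => //.
  by exists d^-1; split; [exact: num_real|].
by apply: ge_ereal_sup => _ [r dr <-]; exact: Hr.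
Qed.

End density_bound.

(** * The differential inequality along the heat flow *)

Section fujita_bound.
Variables (R : realType) (n : nat).
Implicit Types (x y z : 'rV[R]_n) (r s t : R).
Local Notation G := (gauss R n).
Let mI (a b : R) : measurable (`[a, b] : set R). Proof. exact: measurable_itv. Qed.

Variable p : R.
Hypothesis p1 : 1 < p.

(** The tangent of the convex function at [m], obtained from Young's inequality for [a] and
    [m ^ (p - 1)] with exponents [p] and [p / (p - 1)]. *)
Lemma powR_tangent (a m : R) : 0 <= a -> 0 <= m ->
  p * m `^ (p - 1) * a - (p - 1) * m `^ p <= a `^ p.
Proof.
move=> a0 m0; have p0 : 0 < p by exact: lt_trans p1.
have pm1 : 0 < p - 1 by rewrite subr_gt0.
pose q := p / (p - 1); have q0 : 0 < q by rewrite divr_gt0.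
have pq : p^-1 + q^-1 = 1 by rewrite /q; field; rewrite !gt_eqF.
have := conjugate_powR a0 (powR_ge0 m (p - 1)) p0 q0 pq.
rewrite -powRrM (_ : (p - 1) * q = p); last by rewrite /q; field; rewrite gt_eqF.
rewrite -(ler_pM2l p0) (_ : p * (a `^ p / p + m `^ p / q) = a `^ p + (p - 1) * m `^ p); last first.
  by rewrite /q; field; rewrite !gt_eqF.
by move: (a `^ p) (m `^ p) (m `^ (p - 1)) => u v w; lra.
Qed.

(** Jensen's inequality by averaging the tangent inequality taken at the mean [m = heat t g x]. *)
Lemma heat_jensen (g : 'rV[R]_n -> R) M t x : continuous g -> (forall z, 0 <= g z <= M) ->
  heat t g x `^ p <= heat t (fun y => source p (g y)) x.
Proof.
move=> cg gM; have gN z : `|g z| <= M by have /andP[a b] := gM z; rewrite ger0_norm.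
have g0 z : 0 <= g z by have /andP[] := gM z.
have M0 : 0 <= M by exact: le_trans (normr_ge0 _) (gN 0).
have mg := continuous_measurable_rV cg.
have cs : continuous (fun y => source p (g y)).
  by move=> y; apply: (cvg_comp g (source p)); [exact: cg|exact: source_continuous].
have ms := continuous_measurable_rV cs.
have sM z : `|source p (g z)| <= M `^ p by exact: source_bound.
have m0 := heat_ge0 t x g0; set m := heat t g x in m0 *.
pose a := p * m `^ (p - 1); pose b := (p - 1) * m `^ p.
have ig := heat_integrable x (Num.sqrt (2 * t)) mg gN.
have is_ := heat_integrable x (Num.sqrt (2 * t)) ms sM.
have iag : G.-integrable setT (EFin \o (fun z => a * g (x + Num.sqrt (2 * t) *: z))).
  exact: (integrableZl measurableT a ig).
have ib := gauss_integrable_cst n b.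
have : \int[G]_z (a * g (x + Num.sqrt (2 * t) *: z) - b) <= heat t (fun y => source p (g y)) x.
  rewrite heatE; apply: le_Rintegral => //.
  - exact: (integrableB measurableT iag ib).
  - by move=> z _; rewrite source_ge0E//; exact: powR_tangent.
rewrite (RintegralB measurableT iag ib) (RintegralZl a measurableT ig) gauss_cst -heatE -/m.
rewrite /a /b; have -> : p * m `^ (p - 1) * m = p * m `^ p.
  by rewrite -mulrA -(source_ge0E p1 m0) /source ger0_norm.
by move: (m `^ p) => u; lra.
Qed.

Variables (phi : 'rV[R]_n -> R) (v : 'rV[R]_n -> R -> R) (M T : R).
Hypotheses (cphi : continuous phi) (phiM : forall z, 0 <= phi z <= M)
  (cv : continuous (fun q => v q.1 q.2)) (vM : forall z s, 0 <= v z s <= M)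
  (v_mild : forall x t, 0 <= t <= T ->
    v x t = heat t phi x + duh (fun y s => source p (v y s)) x t).

Let phiN z : `|phi z| <= M. Proof. by have /andP[a b] := phiM z; rewrite ger0_norm. Qed.

Let vN z s : `|v z s| <= M. Proof. by have /andP[a b] := vM z s; rewrite ger0_norm. Qed.

Let M0 : 0 <= M. Proof. exact: le_trans (normr_ge0 _) (phiN 0). Qed.

Let F y s := source p (v y s).
Let cF : continuous (fun q : 'rV[R]_n * R => F q.1 q.2).
Proof. by move=> q; apply: (cvg_comp (fun q => v q.1 q.2) (source p)); [exact: cv|exact: source_continuous]. Qed.

Let FM z s : `|F z s| <= M `^ p. Proof. exact: source_bound. Qed.

(** Since [h' = k >= h ^ p], the derivative of [h ^ (1 - p)] is at most [1 - p]. Comparing the times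
    [0], where [h] equals [heat T phi x], and [T], where the nonnegative [h ^ (1 - p)] is dropped,
    gives the bound. *)
Lemma heat_blowup_bound x : 0 < T -> 0 < heat T phi x ->
  (p - 1) * T <= heat T phi x `^ (1 - p).
Proof.
move=> T0; set m := heat T phi x => m_gt0.
pose h s := heat (T - s) (v ^~ s) x; pose k s := heat (T - s) (F ^~ s) x.
have ck : continuous k.
  exact: (continuous_fix1 (F := fun x s => heat (T - s) (F ^~ s) x) (x := x) (duh_integrand_continuous cF FM (b := T))).
have ch : continuous h.
  exact: (continuous_fix1 (F := fun x s => heat (T - s) (v ^~ s) x) (x := x) (duh_integrand_continuous cv vN (b := T))).
have kh s : h s `^ p <= k s.
  exact: (heat_jensen _ _ (continuous_fix2 (F := v) (s := s) cv) (vM ^~ s)).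
have k0 s : 0 <= k s by exact: le_trans (powR_ge0 _ _) (kh s).
(* Applying [heat (T - s)] to the mild equation puts [heat (T - r)] in front of the source at time
   [r]; [s] survives only as the upper limit, so [h] can be differentiated by the fundamental
   theorem. *)
have hE s : 0 <= s <= T -> h s = m + \int[lebesgue_measure]_(r in `[0, s]) k r.
  move=> sT; have /andP[s0 s1] := sT; have Ts : 0 <= T - s by rewrite subr_ge0.
  have sK : 0 <= 2 * s * M `^ p by rewrite mulr_ge0 ?powR_ge0 ?mulr_ge0.
  have hM z : `|heat s phi z| <= M + 2 * s * M `^ p.
    apply: (le_trans (heat_le s z (continuous_measurable_rV cphi) phiN)).
    by rewrite lerDl.
  have dM z : `|duh F z s| <= M + 2 * s * M `^ p.
    by apply: (le_trans (duh_le z s0 cF FM)); rewrite lerDr.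
  have cH := avgw_continuous1 (c := Num.sqrt (2 * s)) (measurable_cst _) (gauss_integrable_cst n 1) cphi phiN.
  have cD := continuous_fix2 (F := duh F) (s := s) (duh_continuous cF FM).
  rewrite /h (_ : v ^~ s = (fun y => heat s phi y + duh F y s)); last first.
    by apply/funext => y; exact: v_mild.
  rewrite (heatD _ _ (continuous_measurable_rV cH) hM (continuous_measurable_rV cD) dM).
  rewrite (heat_comp x Ts s0 (continuous_measurable_rV cphi) phiN) (heat_duh cF FM x Ts s0).
  rewrite subrK -/m -(Rintegral_leb (mI 0 s)); last exact: continuous_measurable_leb.
  by [].
have h_ge s : 0 <= s <= T -> m <= h s.
  by move=> sT; rewrite hE// lerDl; apply: Rintegral_ge0 => r _; exact: k0.
have dh s : 0 < s < T -> is_derive s (1 : R) h (k s).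
  move=> /andP[s0 sT].
  have [dI vI] := continuous_FTC1_closed sT (continuous_itv_integrable 0 T ck) s0 (ck s).
  pose I (s : R) := \int[lebesgue_measure]_(r in `[0, s]) k r.
  have dI1 : is_derive s (1 : R) I (k s).
    by apply: DeriveDef; [exact: dI|rewrite -derive1E vI].
  have : is_derive s (1 : R) (cst m + I) (k s) by apply: is_derive_eq; rewrite add0r.
  apply: near_eq_is_derive => //.
  near=> r; rewrite hE ?fctE//; apply/andP; split; apply: ltW.
    by near: r; exact: lt_nbhsr.
  by near: r; exact: lt_nbhsl.
(* Nonincreasing exactly when [h' >= h ^ p]; its monotonicity integrates the inequality. *)
pose g s := h s `^ (1 - p) + (p - 1) * s.
have h_gt0 s : 0 <= s <= T -> 0 < h s by move=> sT; exact: lt_le_trans (h_ge s sT).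
have dg s : 0 < s < T -> is_derive s (1 : R) g ((1 - p) * h s `^ (1 - p - 1) * k s + (p - 1)).
  move=> sT; have sT' : 0 <= s <= T by have /andP[a b] := sT; rewrite !ltW.
  have d1 := is_derive1_powR (1 - p) (h_gt0 s sT').
  have d2 := is_derive1_comp (f := fun y : R => y `^ (1 - p)) (g := h) (x := s) d1 (dh s sT).
  have d3 : is_derive s (1 : R) (fun s : R => (p - 1) * s) (p - 1).
    by apply: is_derive_eq; rewrite /GRing.scale/= mulr1.
  exact: (is_deriveD d2 d3).
have gT : g T <= g 0.
  apply: (@ler0_derive1_nincr _ g 0 T) => //; last exact: ltW.
  - by move=> s; rewrite in_itv/= => sT; have [] := dg s sT.
  - move=> s; rewrite in_itv/= => sT; rewrite derive1E; have [_ ->] := dg s sT.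
    have sT' : 0 <= s <= T by have /andP[a b] := sT; rewrite !ltW.
    have hs := h_gt0 s sT'.
    have : 1 <= h s `^ (1 - p - 1) * k s.
      have E : h s `^ (1 - p - 1) * h s `^ p = 1.
        rewrite -powRD; last by rewrite (gt_eqF hs) implybT.
        by rewrite (_ : 1 - p - 1 + p = 0) ?powRr0//; ring.
      by rewrite -[X in X <= _]E; apply: ler_wpM2l; [exact: powR_ge0|exact: kh].
    rewrite -mulrA; move: (_ * k s) => u u1; have := p1; nra.
  - apply: continuous_in_subspaceT => s; rewrite inE/= in_itv/= => sT.
    apply: cvgD; last by apply: cvgMl_tmp; exact: cvg_id.
    apply: (cvg_comp h (fun y : R => y `^ (1 - p))); first exact: ch.
    have : {for (h s), continuous (fun y : R => y `^ (1 - p))}; last exact.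
    apply: differentiable_continuous; apply/derivable1_diffP.
    by have [] := is_derive1_powR (1 - p) (h_gt0 s sT).
have h0 : h 0 = m.
  rewrite /h subr0 (_ : v ^~ 0 = phi)//; apply/funext => y.
  by rewrite v_mild ?lexx ?(ltW T0)// heat0 duh0 addr0.
move: gT; rewrite /g h0 mulr0 addr0; apply: le_trans; by rewrite lerDr powR_ge0.
Unshelve. all: by end_near. Qed.

End fujita_bound.

Lemma continuous_normR (T : topologicalType) (R : realType) (f : T -> R) :
  continuous f -> continuous (fun x => `|f x|).
Proof. by move=> cf x; apply: cvg_norm; exact: cf. Qed.

(** For a continuous function an essential bound is a pointwise one: a point of excess would have a
    whole ball of excess, of positive measure, inside a null set. *)
Lemma sup_norm_le (R : realType) (n : nat) (u : 'rV[R]_n -> R -> R) (t N : R) :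
  continuous (u ^~ t) -> (sup_norm u t <= N%:E)%E -> forall x, `|u x t| <= N.
Proof.
move=> cu; rewrite /sup_norm unlock mes_setT_gt0 => /ess_sup_inf.ess_supP [A [mA A0 HA]] x.
rewrite leNgt; apply/negP => Nx.
have cn := continuous_normR cu (x := x).
have : \forall y \near x, N < `|u y t| by exact: (cvgr_gt _ cn _ Nx).
move=> /nbhs_ballP[r /= r0 Hr].
have : (mes R n (eball x r) <= mes R n A)%E.
  apply: le_measure; [by rewrite inE; exact: measurable_eball|by rewrite inE|].
  move=> y yr; apply: HA => /=; rewrite lee_fin => uN.
  have /Hr : ball x r y.
    split => // i j; rewrite ord1 /ball/=; apply: le_lt_trans yr.
    by rewrite distrC; have := coord_le_enorm (y - x) j; rewrite !mxE.
  by rewrite ltNge uN.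
rewrite A0 mes_eball// leNgt mule_gt0 ?mes_eball1_gt0//.
by rewrite lte_fin exprn_gt0.
Qed.

Section life_span.
Variables (R : realType) (n : nat) (p : R) (phi : 'rV[R]_n -> R) (M0 : R).
Variables (u : 'rV[R]_n -> R -> R) (T : \bar R).
Hypotheses (p1 : 1 < p) (cphi : continuous phi) (phi0 : forall z, 0 <= phi z)
  (phiM : forall z, `|phi z| <= M0) (su : solution_on p phi u T).

Let pm1 : 0 < p - 1. Proof. by rewrite subr_gt0. Qed.

(** [heat_blowup_bound] solved for [heat t phi x]: a bound uniform in [x], ready to be the [m] of
    [upper_density_le]. Where the average is not positive nothing has to be inverted. *)
Lemma heat_le_of_solution t x : 0 < t -> (t%:E < T)%E ->
  heat t phi x <= (((p - 1) * t) `^ (p - 1)^-1)^-1.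
Proof.
move=> t0 tT; have [M MM [cv vM v_mild]] := solution_on_mild p1 cphi phi0 phiM su t0 tT.
have w0 : 0 < ((p - 1) * t) `^ (p - 1)^-1 by rewrite powR_gt0// mulr_gt0.
have [m0|m0] := leP (heat t phi x) 0; first by apply: (le_trans m0); rewrite invr_ge0 ltW.
have phiMM z : 0 <= phi z <= M.
  by rewrite phi0/=; apply: le_trans MM; apply: le_trans (phiM z); exact: ler_norm.
have H := heat_blowup_bound p1 cphi phiMM cv vM v_mild t0 m0.
rewrite -[leLHS]invrK lef_pV2 ?posrE ?invr_gt0//.
have -> : (heat t phi x)^-1 = (heat t phi x `^ (1 - p)) `^ (p - 1)^-1.
  rewrite -powRrM (_ : (1 - p) / (p - 1) = -1) ?powR_inv1 ?(ltW m0)//.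
  by field; rewrite gt_eqF.
by apply: ge0_ler_powR; rewrite ?nnegrE ?powR_ge0 ?invr_ge0 ?mulr_ge0 ?(ltW t0) ?(ltW pm1).
Qed.

(** All comparisons take place at real times [t < T]; this covers an infinite [T] as well. *)
Lemma life_span_le alpha : 0 < alpha -> (0 < upper_density phi alpha)%E ->
  (T <= ((p - 1)^-1 * (alpha * fine (upper_density phi alpha)) `^ (1 - p))%:E)%E.
Proof.
move=> a0 D0.
have key t : 0 < t -> (t%:E < T)%E ->
    (upper_density phi alpha <= ((((p - 1) * t) `^ (p - 1)^-1)^-1 / alpha)%:E)%E.
  move=> t0 tT; apply: (upper_density_le cphi phi0 phiM (t := t)) => //.
    by rewrite invr_ge0 powR_ge0.
  by move=> x; exact: heat_le_of_solution.
have [t1 t10 t1T] : exists2 t, 0 < t & (t%:E < T)%E.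
  have := solution_gt0 su; case: T => [r|_|//]; last by exists 1; rewrite ?ltry.
  by rewrite lte_fin => r0; exists (r / 2); rewrite ?lte_fin ?divr_gt0// ltr_pdivrMr//; lra.
(* Finiteness, from the bound at one time of existence, makes [fine] faithful. *)
have Df : upper_density phi alpha \is a fin_num.
  rewrite ge0_fin_numE; last exact: ltW.
  by apply: (le_lt_trans (key t1 t10 t1T)); rewrite ltry.
pose D := fine (upper_density phi alpha).
have DE : upper_density phi alpha = D%:E by rewrite fineK.
have D0' : 0 < D by rewrite -lte_fin -DE.
have aD : 0 < alpha * D by rewrite mulr_gt0.
rewrite -/D; set b := _ * _.
have b0 : 0 < b by rewrite mulr_gt0 ?invr_gt0// powR_gt0.
have tb t : 0 < t -> (t%:E < T)%E -> t <= b.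
  move=> t0 tT; have := key t t0 tT; rewrite DE lee_fin ler_pdivlMr// mulrC => H.
  rewrite /b -ler_pdivrMl ?invr_gt0// invrK.
  have w0 : 0 < ((p - 1) * t) `^ (p - 1)^-1 by rewrite powR_gt0// mulr_gt0.
  have pt0 : 0 <= (p - 1) * t by rewrite mulr_ge0// ltW.
  have -> : (p - 1) * t = (((p - 1) * t) `^ (p - 1)^-1) `^ (p - 1).
    by rewrite -powRrM mulVf ?gt_eqF// powRr1.
  have -> : (alpha * D) `^ (1 - p) = (alpha * D)^-1 `^ (p - 1).
    by rewrite -(powR_inv1 (ltW aD)) -powRrM mulN1r opprB.
  apply: ge0_ler_powR; rewrite ?nnegrE ?(ltW pm1) ?powR_ge0 ?invr_ge0 ?(ltW aD)//.
  by rewrite -[leLHS]invrK lef_pV2 ?posrE ?invr_gt0.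
(* If [T] exceeded [b], some real [t] would lie strictly between them, against [tb]. *)
rewrite leNgt; apply/negP => bT.
have [t bt tT] : exists2 t, b < t & (t%:E < T)%E.
  move: bT; case: T => [r|_|//]; last by exists (b + 1); rewrite ?ltry// ltrDl.
  rewrite lte_fin => br; exists ((b + r) / 2); first by lra.
  by rewrite lte_fin; lra.
by have := tb t (lt_trans b0 bt) tT; rewrite leNgt bt.
Qed.

End life_span.

Theorem theorem1p2 (R : realType) (n : nat) (p : R) (phi : 'rV[R]_n -> R)
    (n_ge1 : (1 <= n)%N) (p_gt1 : 1 < p)
    (phi_ge0 : forall x, 0 <= phi x)
    (phi_bounded : exists M : R, forall x, `|phi x| <= M)
    (phi_continuous : continuous phi)
    (phi_neq0 : exists x, phi x != 0)
    (dens : exists2 alpha : R, 0 < alpha & (0 < upper_density phi alpha)%E)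
    (u : 'rV[R]_n -> R -> R) (Tmax : \bar R)
    (u_max : maximal_solution p phi u Tmax) :
  blows_up_at u Tmax /\
  (forall alpha : R, 0 < alpha -> (0 < upper_density phi alpha)%E ->
     (Tmax <= ((p - 1)^-1 *
               (alpha * fine (upper_density phi alpha)) `^ (1 - p))%:E)%E).
Proof.
have [M0 phiM] := phi_bounded; have [su u_maximal] := u_max.
have life := life_span_le p_gt1 phi_continuous phi_ge0 phiM su.
split => //.
have [a a0 D0] := dens.
have Too : (Tmax < +oo)%E by apply: (le_lt_trans (life a a0 D0)); rewrite ltry.
split => //.
have T_gt0 := solution_gt0 su.
have Tf : Tmax \is a fin_num by rewrite ge0_fin_numE// ltW.
pose T := fine Tmax; have TE : Tmax = T%:E by rewrite fineK.
have T0 : 0 < T by rewrite -lte_fin -TE.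
rewrite -/T; apply/cvgeyPge => A.
(* The level [A] is arbitrary, possibly negative, hence the absolute value. Since [d] depends on it
   alone, every [t] in []T - d, T[] is treated, which gives a limit. *)
have [d d0 ext] := continuation p_gt1 phi_continuous phi_ge0 phiM (normr_ge0 A).
have Td : T - d < T by rewrite ltrBlDr ltrDl.
near=> t.
have tT : t < T by near: t; exact: nbhs_left_lt.
have t0 : 0 < t by near: t; exact: nbhs_left_gt.
have dt : T - d < t by near: t; exact: nbhs_left_gt.
have tTmax : (t%:E < Tmax)%E by rewrite TE lte_fin.
apply: (@le_trans _ _ `|A|%:E); first by rewrite lee_fin ler_norm.
(* A sup norm below the level at time [t] would extend the solution up to [t + d > T], against
   maximality. *)
rewrite leNgt; apply/negP => /ltW uA.
have [M _ [cv _ _]] := solution_on_mild p_gt1 phi_continuous phi_ge0 phiM su t0 tTmax.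
have cu : continuous (u ^~ t).
  rewrite (_ : u ^~ t = freeze u t ^~ t).
    exact: (continuous_fix2 (F := freeze u t) (s := t) cv).
  by apply/funext => y; rewrite /freeze clip_id// lexx ltW.
have uN x : u x t <= `|A| by exact: le_trans (ler_norm _) (sup_norm_le cu uA x).
have [v sv vu] := ext u Tmax t su t0 tTmax uN.
have := u_maximal v _ sv (fun x s s0 sT sd => vu x s s0 sT sd).
by rewrite TE lee_fin leNgt -ltrBlDr dt.
Unshelve. all: by end_near. Qed.
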